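(* Fix a total order on finite nonempty sets of positive integers. For every partition $\mu=(\mu_1,\ldots,\mu_\ell)$, \[ e_\mu=\sum_T\tilde s_{\overline{shape(T)}}, \] where the sum is over all tableaux $T$ (French notation) of skew shape $\lambda/(\lambda_2)$ for some partition $\lambda$ (the leftmost $\lambda_2$ cells of the first row blank, all other cells filled) whose filled cells contain non-empty sets of positive integers (no repeated entries inside a set), which are weakly increasing along rows and up columns, whose total content (multiset union of the entries) is $\{\!\!\{1^{\mu_1},\ldots,\ell^{\mu_\ell}\}\!\!\}$, and such that a given set may appear more than once in the same column if and only if it has an odd number of elements, and may appear more than once in the same row if and only if it has an even number of elements. Here $\overline{\lambda}=(\lambda_2,\lambda_3,\ldots)$ for $\lambda=shape(T)$ the outer shape.
   Context: $Sym=\mathbb{Q}[p_1,p_2,\ldots]$ with elementary functions $e_\lambda$, complete functions $h_\lambda$, Schur functions $s_\lambda$. A multiset partition of a multiset $S$ is a multiset of nonempty multisets with multiset union $S$; $\tilde m(\pi)$ is the partition of multiplicities of the distinct multisets in $\pi$. The basis $\{\tilde h_\lambda\}$ is determined recursively by $h_\lambda=\sum_\pi\tilde h_{\tilde m(\pi)}$, summed over multiset partitions $\pi$ of $\{\!\!\{1^{\lambda_1},\ldots,\ell(\lambda)^{\lambda_{\ell(\lambda)}}\}\!\!\}$. The irreducible character basis is $\tilde s_\lambda=\sum_{|\mu|\le|\lambda|}K^{-1}_{(n-|\lambda|,\lambda),(n-|\mu|,\mu)}\tilde h_\mu$ for any $n\ge 2|\lambda|$, with $K^{-1}$ the inverse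 Kostka matrix ($s_\alpha=\sum_\beta K^{-1}_{\alpha\beta}h_\beta$). *)

(* Defs.v *)
From mathcomp Require Import all_boot all_algebra finmap mpoly.
Set Implicit Arguments. Unset Strict Implicit. Unset Printing Implicit Defensive.
Import GRing.Theory.

Definition is_partition (s : seq nat) : bool :=
  sorted geq s && all (fun x => 0 < x) s.

(* Finite type of partitions of n, padded with zeros to length n. *)
Definition is_ptn (n : nat) (p : {ffun 'I_n -> 'I_n.+1}) : bool :=
  [forall i : 'I_n, forall j : 'I_n, (i <= j) ==> (p j <= p i)] &&
  (\sum_(i < n) (p i : nat) == n).
Notation PT n := {p : {ffun 'I_n -> 'I_n.+1} | is_ptn p}.
Definition ptseq (n : nat) (p : PT n) : seq nat :=
  [seq (val p i : nat) | i <- enum 'I_n & 0 < val p i].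

Local Open Scope ring_scope.

(* Sym, realised in N variables: {mpoly rat[N]}.  (An identity holds in
   Sym iff it holds in the symmetric polynomials in N variables for all N.) *)
Section SymN.
Variable N : nat.
Definition hk (k : nat) : {mpoly rat[N]} :=
  \sum_(m : 'X_{1..N < k.+1} | mdeg m == k) 'X_[m].
Definition h_ (l : seq nat) : {mpoly rat[N]} := \prod_(k <- l) hk k.
Definition e_ (l : seq nat) : {mpoly rat[N]} := \prod_(k <- l) mesym N rat k.
End SymN.

(* Multiset partitions of the multiset {1^{l_1},...,r^{l_r}} (r = size l).
   A sub-multiset (block) is a multiplicity vector 'I_r -> nat (entries
   bounded by |l|); a multiset partition is a multiplicity function on blocks
   (multiplicities bounded by |l|), only nonempty blocks may occur, and the
   multiset union of the blocks is the whole multiset.  These bounds are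
   automatic, so nothing is lost. *)
Notation Blk l := {ffun 'I_(size l) -> 'I_(sumn l).+1}.
Notation MSP l := {ffun Blk l -> 'I_(sumn l).+1}.

Definition msp_valid (l : seq nat) (pi : MSP l) : bool :=
  [forall B : Blk l, (0 < pi B)%N ==> [exists i, (0 < B i)%N]] &&
  [forall i : 'I_(size l), (\sum_(B : Blk l) (pi B * B i))%N == nth 0%N l i].

Definition mtilde (l : seq nat) (pi : MSP l) : seq nat :=
  sort geq [seq (pi B : nat) | B <- enum (Blk l) & (0 < pi B)%N].

Definition msp_sum (R : nmodType) (f : seq nat -> R) (l : seq nat) : R :=
  \sum_(pi : MSP l | msp_valid pi) f (mtilde pi).

(* Kostka numbers: K_{lam,mu} = #SSYT of shape lam and content mu.
   Cells (r,c), 0-indexed, cell iff c < lam_r; entries 1..size mu, 0 = no cell. *)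
Definition ssyt (lam mu : seq nat)
  (T : {ffun 'I_(sumn lam) * 'I_(sumn lam) -> 'I_(size mu).+1}) : bool :=
  let incell := fun x : 'I_(sumn lam) * 'I_(sumn lam) => (x.2 < nth 0%N lam x.1)%N in
  [forall x, incell x == (0 < T x)%N] &&
  [forall r : 'I_(sumn lam), forall c : 'I_(sumn lam), forall c' : 'I_(sumn lam),
     [&& (c < c')%N, incell (r, c) & incell (r, c')] ==> (T (r, c) <= T (r, c'))%N] &&
  [forall r : 'I_(sumn lam), forall r' : 'I_(sumn lam), forall c : 'I_(sumn lam),
     [&& (r < r')%N, incell (r, c) & incell (r', c)] ==> (T (r, c) < T (r', c))%N] &&
  [forall k : 'I_(size mu), #|[set x | (T x : nat) == k.+1]| == nth 0%N mu k].

Definition kostka (lam mu : seq nat) : nat :=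
  #|[set T : {ffun 'I_(sumn lam) * 'I_(sumn lam) -> 'I_(size mu).+1} | @ssyt lam mu T]|.

(* A_{mu,lam} := K_{lam,mu}, i.e. h_mu = sum_lam A_{mu,lam} s_lam. *)
Definition kostkaT (n : nat) : 'M[rat]_#|{: PT n}| :=
  \matrix_(i, j) (kostka (ptseq (enum_val j)) (ptseq (enum_val i)))%:R.

(* Inverse Kostka numbers in the paper's convention
   s_a = sum_b Kinv_{a,b} h_b, i.e. Kinv = (K^T)^{-1}; partitions of n. *)
Definition Kinv (n : nat) (a b : seq nat) : rat :=
  match [pick p : PT n | ptseq p == a], [pick q : PT n | ptseq q == b] with
  | Some p, Some q => invmx (kostkaT n) (enum_rank p) (enum_rank q)
  | _, _ => 0
  end.

(* \tilde s_l := sum_{|mu| <= |l|} Kinv_{(n-|l|,l),(n-|mu|,mu)} \tilde h_mu,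
   with the admissible choice n = 2|l| + 1 (>= 2|l|). *)
Definition tildes (N : nat) (th : seq nat -> {mpoly rat[N]}) (l : seq nat)
  : {mpoly rat[N]} :=
  let k := sumn l in let n := (2 * k).+1 in
  \sum_(j < k.+1) \sum_(m : PT j)
     Kinv n ((n - k)%N :: l) ((n - j)%N :: ptseq m) *: th (ptseq m).

Local Open Scope fset_scope.
Definition posset (A : {fset nat}) : bool := (A != fset0) && (0%N \notin A).
Definition setF (r : nat) (A : {set 'I_r}) : {fset nat} := [fset (val i).+1 | i in A].
Local Close Scope fset_scope.

(* Tableaux of skew shape lam/(lam_2), French notation: row 0 is the bottom
   (first) row.  Shape lam given by row lengths lf (bounded by B), cell (r,c)
   0-indexed.  Bound B = 2|mu|+1 is automatic: at most |mu| filled cells. *)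
Definition tabB (mu : seq nat) : nat := (2 * sumn mu).+1.

Definition lamseq (B : nat) (lf : {ffun 'I_B -> 'I_B}) : seq nat :=
  [seq (lf i : nat) | i <- enum 'I_B].

Definition filled (B : nat) (lf : {ffun 'I_B -> 'I_B}) (x : 'I_B * 'I_B) : bool :=
  (x.2 < nth 0%N (lamseq lf) x.1)%N &&
  ((x.1 != 0%N :> nat) || (nth 0%N (lamseq lf) 1 <= x.2)%N).

Definition lambar (B : nat) (lf : {ffun 'I_B -> 'I_B}) : seq nat :=
  [seq x <- behead (lamseq lf) | (0 < x)%N].

Definition tab_valid (le : rel {fset nat}) (mu : seq nat)
  (lf : {ffun 'I_(tabB mu) -> 'I_(tabB mu)})
  (F : {ffun 'I_(tabB mu) * 'I_(tabB mu) -> {set 'I_(size mu)}}) : bool :=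
  sorted geq (lamseq lf) &&
  [forall x, filled lf x == (F x != set0)] &&
  [forall r : 'I_(tabB mu), forall c : 'I_(tabB mu), forall c' : 'I_(tabB mu),
     [&& (c < c')%N, filled lf (r, c) & filled lf (r, c')] ==>
       le (setF (F (r, c))) (setF (F (r, c')))] &&
  [forall r : 'I_(tabB mu), forall r' : 'I_(tabB mu), forall c : 'I_(tabB mu),
     [&& (r < r')%N, filled lf (r, c) & filled lf (r', c)] ==>
       le (setF (F (r, c))) (setF (F (r', c)))] &&
  [forall r : 'I_(tabB mu), forall c : 'I_(tabB mu), forall c' : 'I_(tabB mu),
     [&& (c < c')%N, filled lf (r, c), filled lf (r, c') & F (r, c) == F (r, c')] ==>
       ~~ odd #|F (r, c)|] &&
  [forall r : 'I_(tabB mu), forall r' : 'I_(tabB mu), forall c : 'I_(tabB mu),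
     [&& (r < r')%N, filled lf (r, c), filled lf (r', c) & F (r, c) == F (r', c)] ==>
       odd #|F (r, c)|] &&
  [forall i : 'I_(size mu), #|[set x | i \in F x]| == nth 0%N mu i].

Definition tab_sum (le : rel {fset nat}) (N : nat) (th : seq nat -> {mpoly rat[N]})
  (mu : seq nat) : {mpoly rat[N]} :=
  \sum_(lf : {ffun 'I_(tabB mu) -> 'I_(tabB mu)})
    \sum_(F : {ffun 'I_(tabB mu) * 'I_(tabB mu) -> {set 'I_(size mu)}} | tab_valid le lf F)
      tildes th (lambar lf).

(* Main.v *)
Require Import Defs.
From mathcomp Require Import all_boot all_algebra finmap mpoly zify.
Set Implicit Arguments. Unset Strict Implicit. Unset Printing Implicit Defensive.
Import GRing.Theory.

(** Let [L] be the linear map from the free algebra on [h_1, h_2, ...] sending the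
    monomial [h_alpha] to [th alpha], and let [e_k] be defined there by
    [sum_i (-1)^i e_(n-i) h_i = 0]. The definition of [th] says that [h_mu] is [L] of
    the coefficient of [x^mu] in the product of the series [H(x^B)] over all monomials
    [B <> 1]. Giving some variables an elementary type (at most linear in each
    monomial, [H] replaced by [E] on the monomials of odd degree in them), the
    substitution [z := - y] of a complete variable by the opposite of an elementary
    one makes the factors cancel in pairs, since [H(u) E(-u) = 1]; by induction on the
    elementary degree, [e_mu] is [L] of the sum, over the multisets of nonempty sets of
    content [mu], of the products of [h_m] (even sets) and [e_m] (odd sets).

    Such a product expands in the irreducible characters according to chains of shapes
    whose steps are horizontal or vertical strips, starting at one long row: for
    products of [h]'s this is the inversion of the Kostka matrix, and the relation
    between [e] and [h] is matched by the vanishing of the alternating sum over the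
    shapes between two given ones, which form a box. The chains are the tableaux of
    the statement, the long row playing the role of the blank cells. *)

(** * Chains of horizontal and vertical strips *)

(** The function [th] is not multiplicative: [h_mu] is a product, while [th mu] is a mere value
    attached to [mu]. Elementary functions therefore cannot be expanded inside the defining
    recursion; they are introduced in the free algebra, and [L] is applied last. The products of
    [e]'s and [h]'s in [N] variables and the images under [L] of the coefficients then satisfy one
    and the same alternating relation, which lowers the elementary degree until only the complete
    case, the one governed by the hypothesis on [th], is left. This relation moves exponents from an
    elementary variable to an idle complete one. To guarantee an idle variable, monomials of degree
    [D] are taken in [D.+1] variables. On the character side every [tildes] uses its own [n]. All
    are brought to [n = 2D+1], because Kostka numbers do not change when long first rows grow
    together. The same lengthening explains the blank cells: [lambda_2] is the least length of the
    initial row from which growing it leaves the count of chains unchanged. *)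

Notation Sh n := {ffun 'I_n -> 'I_n.+1}.

(** Rows are read as a function on all naturals, zero from [n] on, so that comparing rows [i] and
    [i.+1] needs no boundary case. A term of [Sh n] need not be decreasing; that is the separate
    condition [mono]. *)
Definition pt n (lam : Sh n) (i : nat) : nat :=
  oapp (fun j : 'I_n => val (lam j)) 0 (insub i).

Lemma pt_ord n (lam : Sh n) (i : 'I_n) : pt lam i = lam i.
Proof. by rewrite /pt valK. Qed.

Lemma pt_default n (lam : Sh n) i : n <= i -> pt lam i = 0.
Proof. by move=> ni; rewrite /pt insubF //= ltnNge ni. Qed.

Lemma pt_le n (lam : Sh n) i : pt lam i <= n.
Proof.
by rewrite /pt; case: insubP => //= j _ _; rewrite -ltnS.
Qed.

Lemma pt_inj n (lam lam' : Sh n) : pt lam =1 pt lam' -> lam = lam'.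
Proof. by move=> E; apply/ffunP => i; apply: val_inj; rewrite /= -!pt_ord E. Qed.

Definition sh_of n (f : nat -> nat) : Sh n := [ffun i : 'I_n => inord (f i)].

Lemma pt_sh_of n (f : nat -> nat) i : f i <= n -> (n <= i -> f i = 0) ->
  pt (sh_of n f) i = f i.
Proof.
move=> fb f0; case: (ltnP i n) => [lin|lni]; last by rewrite pt_default // f0.
by rewrite -[i]/(val (Ordinal lin)) pt_ord ffunE inordK.
Qed.

Definition sz n (lam : Sh n) : nat := \sum_(i < n) lam i.

Lemma szE n (lam : Sh n) : sz lam = \sum_(i < n) pt lam i.
Proof. by apply: eq_bigr => i _; rewrite pt_ord. Qed.

Definition mono n (lam : Sh n) : bool := [forall i : 'I_n, pt lam i.+1 <= lam i].

Lemma monoP n (lam : Sh n) :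
  reflect (forall i, pt lam i.+1 <= pt lam i) (mono lam).
Proof.
apply: (iffP forallP) => H i; last by rewrite -pt_ord.
case: (ltnP i n) => [lin|lni]; last by rewrite pt_default // ltnW.
by have := H (Ordinal lin); rewrite -pt_ord.
Qed.

Lemma mono_le n (lam : Sh n) i j : mono lam -> i <= j -> pt lam j <= pt lam i.
Proof.
move=> /monoP m; elim: j => [|j IH]; first by rewrite leqn0 => /eqP->.
rewrite leq_eqVlt => /orP[/eqP-> //|/IH]; exact: leq_trans.
Qed.

Definition strip n (t : bool) (rho lam : Sh n) : bool :=
  [forall i : 'I_n, (rho i <= lam i) &&
    if t then lam i <= (rho i).+1 else pt lam i.+1 <= rho i].

Lemma stripP n t (rho lam : Sh n) :
  reflect (forall i, pt rho i <= pt lam i /\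
             if t then pt lam i <= (pt rho i).+1 else pt lam i.+1 <= pt rho i)
          (strip t rho lam).
Proof.
apply: (iffP forallP) => H i.
  case: (ltnP i n) => [lin|lni].
    by have := H (Ordinal lin); rewrite -!pt_ord => /andP[].
  by rewrite !pt_default ?(leq_trans lni) //; case: t {H}.
by have [] := H i; rewrite -!pt_ord => -> ->.
Qed.

(** Monotonicity of the target is demanded because a vertical strip does not force it; a horizontal
    strip does. *)
Definition step n (x : nat * bool) (rho lam : Sh n) : bool :=
  [&& mono lam, strip x.2 rho lam & sz lam == sz rho + x.1].

(* [Kc w rho lam] counts the chains of shapes from [rho] to [lam] whose
   successive differences are horizontal ([false]) or vertical ([true]) strips
   of the sizes listed in [w]. *)
Fixpoint Kc n (w : seq (nat * bool)) (rho lam : Sh n) : nat :=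
  if w is x :: w' then \sum_(nu | step x rho nu) Kc w' nu lam
  else (rho == lam).

Lemma Kc_cat n w1 w2 (rho lam : Sh n) :
  Kc (w1 ++ w2) rho lam = \sum_nu Kc w1 rho nu * Kc w2 nu lam.
Proof.
elim: w1 rho => [|x w1 IH] rho /=.
  rewrite (bigD1 rho) //= eqxx mul1n big1 ?addn0 // => nu.
  by rewrite eq_sym => /negPf->.
rewrite (eq_bigr _ (fun nu _ => IH nu)) exchange_big /=.
by apply: eq_bigr => nu _; rewrite big_distrl.
Qed.

Lemma Kc_rcons n w x (rho lam : Sh n) :
  Kc (rcons w x) rho lam = \sum_(nu | step x nu lam) Kc w rho nu.
Proof.
rewrite -cats1 Kc_cat [RHS]big_mkcond; apply: eq_bigr => nu _ /=.
rewrite big_mkcond (bigD1 lam) //= eqxx big1 ?addn0; last first.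
  by move=> i /negPf->; case: ifP.
by case: ifP; rewrite ?muln1 ?muln0.
Qed.

Definition wt (w : seq (nat * bool)) := sumn (map fst w).

Lemma strip_sub n t (rho lam : Sh n) i : strip t rho lam -> pt rho i <= pt lam i.
Proof. by move/stripP/(_ i) => []. Qed.

Lemma KcP n w (rho lam : Sh n) : 0 < Kc w rho lam ->
  (forall i, pt rho i <= pt lam i) /\ sz lam = sz rho + wt w.
Proof.
elim: w rho => [|x w IH] rho /=.
  by case: eqP => // -> _; rewrite addn0.
rewrite lt0n sum_nat_eq0 => /forallPn /= [nu].
rewrite negb_imply -lt0n => /andP[/and3P[_ st /eqP s] /IH[le ->]].
split; last by rewrite s /wt /= addnA.
by move=> i; apply: leq_trans (le i); apply: strip_sub st.
Qed.

Lemma Kc_mono n w (rho lam : Sh n) : mono rho -> 0 < Kc w rho lam -> mono lam.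
Proof.
elim: w rho => [|x w IH] rho mr /=; first by case: eqP => // <-.
rewrite lt0n sum_nat_eq0 => /forallPn /= [nu].
rewrite negb_imply -lt0n => /andP[/and3P[m _ _]]; exact: IH.
Qed.

Lemma sz_le_eq n (rho lam : Sh n) :
  (forall i, pt rho i <= pt lam i) -> sz lam <= sz rho -> rho = lam.
Proof.
move=> le szle; apply/ffunP => i; apply: val_inj => /=; apply/eqP.
rewrite eqn_leq -!pt_ord le /= leqNgt; apply/negP => lt.
move: szle; rewrite leqNgt => /negP; apply; rewrite !szE.
rewrite (bigD1 i) // [X in _ < X](bigD1 i) //= -addSn leq_add //.
exact: leq_sum.
Qed.

Lemma step0 n t (rho lam : Sh n) : mono rho -> step (0, t) rho lam = (rho == lam).
Proof.
move=> m; apply/and3P/eqP => /= [[_ st /eqP s]|<-].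
  by apply: sz_le_eq => [i|]; [apply: strip_sub st | rewrite s addn0].
split=> //; last by rewrite addn0.
by apply/stripP => i; split=> //; case: t => //; exact/monoP.
Qed.

Lemma Kc_cons0 n t w (rho lam : Sh n) : mono rho ->
  Kc ((0, t) :: w) rho lam = Kc w rho lam.
Proof.
by move=> m /=; under eq_bigl => nu do rewrite step0 // eq_sym; rewrite big_pred1_eq.
Qed.

Lemma card_bij (T U : finType) (A : {set T}) (B : {set U}) f g :
  (forall x, x \in A -> f x \in B /\ g (f x) = x) ->
  (forall y, y \in B -> g y \in A /\ f (g y) = y) -> #|A| = #|B|.
Proof.
move=> H1 H2.
have inj : {in A &, injective f} by move=> x y /H1[_ ex] /H1[_ ey] e; rewrite -ex e ey.
rewrite -(card_in_imset inj); congr #|pred_of_set _|; apply/setP => y.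
apply/imsetP/idP => [[x /H1[] ? _ -> //]|/H2[gA e]]; by exists (g y).
Qed.

(** * Commutation of two horizontal strips *)

Section Swap.
Variables (n : nat) (rho lam : Sh n).

(** A shape [nu] between two horizontal strips amounts to an independent choice of each row in
    [[lo i, hi i]]. Reflecting every row in its interval is the Bender-Knuth involution written on
    shapes; it exchanges the two sizes. *)
Let lo i := maxn (pt rho i) (pt lam i.+1).
Let hi i := if i is j.+1 then minn (pt lam i) (pt rho j) else pt lam 0.
Let flip (nu : Sh n) : Sh n := sh_of n (fun i => lo i + hi i - pt nu i).

Lemma two_hstripsE nu : strip false rho nu && strip false nu lam =
  [forall i : 'I_n, lo i <= pt nu i <= hi i].
Proof.
apply/andP/forallP => [[/stripP s1 /stripP s2] i|H].
  have [a b] := s1 i; have [c d] := s2 i.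
  rewrite geq_max a d /= /hi; case: (i : nat) c => [//|j] c.
  by rewrite leq_min c; case: (s1 j).
have H' i : i < n -> lo i <= pt nu i <= hi i by move=> l; exact: (H (Ordinal l)).
have H2 i : pt nu i <= hi i by case: (ltnP i n) => [/H'/andP[]//|?]; rewrite pt_default.
have H1 i : lo i <= pt nu i.
  case: (ltnP i n) => [/H'/andP[]//|?].
  by rewrite /lo !pt_default // (leq_trans _ (leqnSn _)).
have nl i : pt nu i <= pt lam i.
  by apply: leq_trans (H2 i) _; case: i => //= j; rewrite geq_minl.
split; apply/stripP => i; split.
- by apply: leq_trans (H1 i); rewrite leq_maxl.
- by apply: leq_trans (H2 i.+1) _; rewrite geq_minr.
- exact: nl.
- by apply: leq_trans (H1 i); rewrite leq_maxr.
Qed.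

Lemma sum_lo_hi : \sum_(i < n) lo i + \sum_(i < n) hi i = sz rho + sz lam.
Proof.
rewrite !szE -!(big_mkord xpredT (fun i => lo i)) -!(big_mkord xpredT (fun i => hi i)).
rewrite -!(big_mkord xpredT (fun i => pt _ i)).
(* The sums are offset by one row: [lo k] and [hi k.+1] are the maximum and the minimum of the same
   two numbers [pt rho k] and [pt lam k.+1]. *)
have H k : \sum_(0 <= i < k) lo i + \sum_(0 <= i < k.+1) hi i =
  \sum_(0 <= i < k) pt rho i + \sum_(0 <= i < k.+1) pt lam i.
  elim: k => [|k IH]; first by rewrite !big_nil !big_nat1.
  rewrite big_nat_recr // [X in _ + X]big_nat_recr //= addnACA IH.
  rewrite [in RHS]big_nat_recr // [X in _ = _ + X]big_nat_recr //= [RHS]addnACA.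
  congr (_ + _); rewrite /lo; lia.
have := H n; rewrite !(big_nat_recr n) //= (pt_default lam (leqnn n)) addn0.
have hk k : pt lam k = 0 -> hi k = 0 by case: k => [|k] //= ->; rewrite min0n.
by rewrite (hk n) ?addn0 // pt_default.
Qed.

Lemma flipP nu : strip false rho nu -> strip false nu lam ->
  [/\ strip false rho (flip nu), strip false (flip nu) lam,
      sz (flip nu) + sz nu = sz rho + sz lam & flip (flip nu) = nu].
Proof.
move=> s1 s2; have := two_hstripsE nu; rewrite s1 s2 => /esym /forallP H.
have hin i : hi i <= n by case: i => [|i] /=; rewrite ?pt_le // geq_min pt_le.
have ptf (i : 'I_n) : pt (flip nu) i = lo i + hi i - pt nu i.
  rewrite pt_sh_of //; first by move: (H i) (hin i); lia.
  by rewrite leqNgt ltn_ord.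
have := two_hstripsE (flip nu).
have -> : [forall i : 'I_n, lo i <= pt (flip nu) i <= hi i].
  by apply/forallP => i; rewrite ptf; move: (H i); lia.
move=> /andP[-> ->]; split=> //.
- rewrite -sum_lo_hi !szE -!big_split /=; apply: eq_bigr => i _.
  by rewrite ptf; move: (H i); lia.
- apply/ffunP => i; apply: val_inj; rewrite /= -!pt_ord pt_sh_of ?ptf //.
  + by move: (H i); lia.
  + by move: (H i) (hin i); lia.
  + by rewrite leqNgt ltn_ord.
Qed.

Lemma hstrip_mono nu : strip false nu lam -> mono nu.
Proof.
move=> /stripP s; apply/monoP => i; apply: leq_trans (proj1 (s i.+1)) (proj2 (s i)).
Qed.

Lemma hstep_swap a b : mono lam ->
  #|[set nu | step (a, false) rho nu && step (b, false) nu lam]| =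
  #|[set nu | step (b, false) rho nu && step (a, false) nu lam]|.
Proof.
move=> ml; apply: (@card_bij _ _ _ _ flip flip) => nu; rewrite !inE;
  case/andP => /and3P[/= m1 s1 /eqP z1] /and3P[/= m2 s2 /eqP z2];
  have [t1 t2 z3 ->] := flipP s1 s2; split=> //; rewrite /step /= t1 t2 ml
  (hstrip_mono t2) /=; apply/andP; split; apply/eqP; lia.
Qed.

End Swap.

Lemma Kc_two n x y (rho lam : Sh n) :
  Kc [:: x; y] rho lam = #|[set nu | step x rho nu && step y nu lam]|.
Proof.
rewrite (Kc_rcons [:: x]) cardsE -sum1_card [RHS]big_mkcond [LHS]big_mkcond /=.
apply: eq_bigr => nu _; rewrite unfold_in /=.
rewrite big_mkcond (bigD1 nu) //= eqxx big1 ?addn0; last first.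
  by move=> i /negPf->; case: ifP.
by case: (step x rho nu); case: (step y nu lam).
Qed.

Lemma Kc_hswap n a b w (rho lam : Sh n) :
  Kc [:: (a, false), (b, false) & w] rho lam =
  Kc [:: (b, false), (a, false) & w] rho lam.
Proof.
rewrite (Kc_cat [:: (a, false); (b, false)]) (Kc_cat [:: (b, false); (a, false)]).
apply: eq_bigr => nu _; congr (_ * _); rewrite !Kc_two.
have [m|m] := boolP (mono nu); first exact: hstep_swap.
by apply: eq_card => k; rewrite !inE /step !(negPf m) !andbF.
Qed.

(** Every shape reached by a step is decreasing, so the tails need to agree only there; facts such
    as [Kc_cons0] are available only from decreasing shapes. *)
Lemma Kc_eq_tail n w w1 w2 (rho lam : Sh n) : mono rho ->
  (forall nu, mono nu -> Kc w1 nu lam = Kc w2 nu lam) ->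
  Kc (w ++ w1) rho lam = Kc (w ++ w2) rho lam.
Proof.
move=> m E; elim: w rho m => [|x w IH] rho m; first exact: E.
by apply: eq_bigr => nu /and3P[mn _ _]; apply: IH.
Qed.

Definition hw : seq nat -> seq (nat * bool) := map (fun a => (a, false)).

Lemma Kc_hmove n a s w (rho lam : Sh n) : mono rho ->
  Kc ((a, false) :: hw s ++ w) rho lam = Kc (hw s ++ (a, false) :: w) rho lam.
Proof.
elim: s rho => [|b s IH] rho m //; rewrite [hw _]/= !cat_cons Kc_hswap.
by apply: eq_bigr => nu /and3P[mn _ _]; apply: IH.
Qed.

Lemma Kc_hperm n s1 s2 (rho lam : Sh n) : mono rho -> perm_eq s1 s2 ->
  Kc (hw s1) rho lam = Kc (hw s2) rho lam.
Proof.
elim: s1 s2 rho => [|a s1 IH] s2 rho m p.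
  by move: p; rewrite perm_sym => /perm_nilP ->.
have /splitPr sp : a \in s2 by rewrite -(perm_mem p) mem_head.
case: sp p => u v; rewrite perm_sym perm_catC /= perm_cons perm_catC perm_sym => p.
rewrite /hw map_cat /= -/hw -Kc_hmove // -map_cat.
by apply: eq_bigr => nu /and3P[mn _ _]; apply: IH.
Qed.

Lemma Kc_hfilter n s (rho lam : Sh n) : mono rho ->
  Kc (hw [seq a <- s | 0 < a]) rho lam = Kc (hw s) rho lam.
Proof.
elim: s rho => [|[|a] s IH] rho m //; first by rewrite [LHS]IH // [RHS]Kc_cons0.
by apply: eq_bigr => nu /and3P[mn _ _]; apply: IH.
Qed.

(** * Cancellation for a vertical strip followed by a horizontal one *)

Section Cancel.
Local Open Scope ring_scope.
Variables (n : nat) (rho lam : Sh n).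
Hypotheses (mr : mono rho) (ml : mono lam).

Let box (i : 'I_n) (v : 'I_n.+1) : bool :=
  [&& rho i <= v, v <= (rho i).+1, pt lam i.+1 <= v & v <= lam i]%N.

Lemma vh_boxE nu : [&& mono nu, strip true rho nu & strip false nu lam] =
  [forall i, box i (nu i)].
Proof.
apply/and3P/forallP => [[_ /stripP s1 /stripP s2] i|H].
  by have [] := s1 i; have [] := s2 i; rewrite /box !pt_ord => -> -> -> ->.
have s2 : strip false nu lam.
  by apply/forallP => i; case/and4P: (H i) => _ _ -> ->.
split=> //; first exact: hstrip_mono s2.
by apply/forallP => i; case/and4P: (H i) => -> -> _ _.
Qed.

(** By [vh_boxE] the sum factors into alternating sums over one integer interval per row. It
    suffices to find a row whose interval is empty or has exactly two elements. *)
Lemma vh_alternating : rho != lam ->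
  \sum_(nu | [&& mono nu, strip true rho nu & strip false nu lam])
     (-1) ^+ sz nu = 0 :> rat.
Proof.
move=> ne.
transitivity (\sum_(nu : Sh n) \prod_i (if box i (nu i) then (-1) ^+ nu i else 0 : rat)).
  rewrite big_mkcond; apply: eq_bigr => nu _; rewrite vh_boxE.
  case: ifP => [/forallP H|/negbT/forallPn[i ni]].
    by rewrite -prodrXr; apply: eq_bigr => i _; rewrite H.
  by rewrite (bigD1 i) //= (negPf ni) mul0r.
rewrite -(bigA_distr_bigA (fun i (v : 'I_n.+1) => if box i v then (-1) ^+ v else 0)).
have [sub|/forallPn[i]] := boolP [forall i, rho i <= lam i]%N; last first.
  rewrite -ltnNge => lt; rewrite (bigD1 i) //= big1 ?mul0r // => v _.
  by case: ifP => // /and4P[a b c d]; lia.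
have [i0 /= Pi0] : exists i : 'I_n, (rho i < lam i)%N.
  apply/existsP; apply: contraNT ne; rewrite negb_exists => /forallP H.
  apply/eqP/ffunP => i; apply: val_inj; apply/eqP.
  by rewrite eqn_leq (forallP sub) leqNgt H.
(* Take the last row where [rho] is shorter than [lam]. In the next row [lam] does not exceed [rho],
   hence [pt lam i.+1 <= rho i], and the interval of row [i] is exactly [rho i, (rho i).+1], two
   terms of opposite sign. *)
pose i := [arg max_(j > i0 | (rho j < lam j)%N) j].
have [Pi imax] : (rho i < lam i)%N /\ forall j : 'I_n, (rho j < lam j -> j <= i)%N.
  by rewrite /i; case: arg_maxnP.
have nxt : (pt lam i.+1 <= rho i)%N.
  case: (ltnP i.+1 n) => [l|?]; last by rewrite pt_default.
  have := imax (Ordinal l); rewrite -!pt_ord /=.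
  have /monoP/(_ i) := mr; move: (pt _ _) (pt _ _) (pt _ _) => a b c; lia.
have b : (rho i < n)%N by have := ltn_ord (lam i); lia.
rewrite (bigD1 i) //= (_ : \sum_(_ < _) _ = 0) ?mul0r //.
rewrite (bigD1 (rho i)) // (bigD1 (inord (rho i).+1)) /=; last first.
  by apply/eqP => /(congr1 val); rewrite /= inordK; lia.
rewrite big1 => [|v /andP[/eqP v1 /eqP v2]].
  rewrite /box inordK // !leqnn nxt Pi leqnSn (leq_trans nxt) // (ltnW Pi) /=.
  by rewrite addr0 exprS mulN1r subrr.
case: ifP => // /and4P[h1 h2 _ _]; exfalso.
have [/val_inj//|e] : v = rho i :> nat \/ v = (rho i).+1 :> nat by lia.
by apply: v2; apply: val_inj; rewrite /= inordK.
Qed.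

End Cancel.

(** The counterpart on chains of [sum_i (-1)^i e_(a-i) h_i = 0]. The shape [nu] after both strips is
    fixed first; [0 < a] makes it differ from [rho], as [vh_alternating] requires. *)
Lemma Kc_vh_cancel n a w (rho lam : Sh n) : mono rho -> 0 < a ->
  (\sum_(i < a.+1) (-1) ^+ i *
     (Kc [:: ((a - i)%N, true), (i : nat, false) & w] rho lam)%:R = 0 :> rat)%R.
Proof.
move=> mr a0.
have E (i : 'I_a.+1) := Kc_cat [:: (a - i, true); (i : nat, false)] w rho lam.
under eq_bigr => i _ do rewrite [Kc _ _ _]E natr_sum mulr_sumr.
rewrite exchange_big big1 // => nu _.
under eq_bigr => i _ do rewrite natrM mulrA.
rewrite -mulr_suml (_ : \sum_(i < a.+1) _ = 0)%R ?mul0r //.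
(* Sizes leave a single index: once [sz nu = sz rho + a], the intermediate shape [k] forces
   [i = sz nu - sz k]. The double sum is thus a sum over the box, with a sign depending on [sz k]
   only up to the global factor [(-1) ^+ sz nu]. *)
have step2 i k : i <= a -> step (a - i, true) rho k && step (i, false) k nu =
    [&& [&& mono k, strip true rho k & strip false k nu],
        mono nu & (sz nu == sz rho + a) && (i == sz nu - sz k)].
  move=> ia; rewrite /step /=.
  case: (mono k) => //=; case: (mono nu); rewrite ?andbF //=.
  have [s1|] := boolP (strip true rho k); rewrite ?andbF //=.
  have [s2|] := boolP (strip false k nu); rewrite ?andbF //=.
  have l1 : sz rho <= sz k by rewrite !szE; apply: leq_sum => j _; apply: strip_sub s1.
  have l2 : sz k <= sz nu by rewrite !szE; apply: leq_sum => j _; apply: strip_sub s2.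
  lia.
under eq_bigr => i _.
  rewrite Kc_two cardsE -sum1_card natr_sum mulr_sumr big_mkcond /=.
  under eq_bigr => k _ do rewrite unfold_in /= (step2 _ _ (leq_ord i)) mulr1.
  over.
rewrite exchange_big /=.
have [/andP[mn /eqP sn]|/negPf nn] := boolP (mono nu && (sz nu == sz rho + a)); last first.
  by rewrite big1 // => k _; rewrite big1 // => i _; rewrite (andbA (mono nu)) nn /= andbF.
have alt : (\sum_(k | [&& mono k, strip true rho k & strip false k nu])
    (-1) ^+ sz k = 0 :> rat)%R.
  by apply: vh_alternating => //; apply/eqP => e; move: sn; rewrite e; lia.
transitivity ((-1) ^+ sz nu * 0 : rat)%R; last exact: mulr0.
rewrite -[X in (_ = _ * X)%R]alt mulr_sumr [RHS]big_mkcond /=.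
apply: eq_bigr => k _.
rewrite mn sn eqxx /=; case: ifP => [/and3P[mk s1 s2]|] /=; last by rewrite big1.
have l1 : sz rho <= sz k by rewrite !szE; apply: leq_sum => j _; apply: strip_sub s1.
have l2 : sz k <= sz nu by rewrite !szE; apply: leq_sum => j _; apply: strip_sub s2.
have lt : sz nu - sz k < a.+1 by lia.
rewrite -sn (bigD1 (Ordinal lt)) //= eqxx big1 => [|i /eqP ni]; last first.
  by case: eqP => // e; case: ni; apply: val_inj.
by rewrite addr0 -[in RHS](subnK l2) exprD -mulrA -expr2 sqrr_sign mulr1.
Qed.

(** * Lengthening the first row of a chain *)

Section Embed.
Variables (n1 n2 d : nat).
Hypothesis len : n1 <= n2.

Definition shift_head (f : nat -> nat) i := f i + (i == 0) * d.
Definition emb (lam : Sh n1) : Sh n2 := sh_of n2 (shift_head (pt lam)).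

Lemma pt_emb (lam : Sh n1) i : pt lam 0 + d <= n2 -> 0 < n2 ->
  pt (emb lam) i = shift_head (pt lam) i.
Proof.
move=> b n0; rewrite pt_sh_of // /shift_head.
- by case: i => [|i]; rewrite ?mul1n //= addn0 (leq_trans (pt_le _ _)).
- move=> l; rewrite pt_default ?(leq_trans len) //; case: i l => //; lia.
Qed.

Lemma sz_emb (lam : Sh n1) : pt lam 0 + d <= n2 -> 0 < n2 -> sz (emb lam) = sz lam + d.
Proof.
move=> b n0; rewrite !szE (eq_bigr _ (fun (i : 'I_n2) _ => pt_emb i b n0)) big_split /=.
congr (_ + _).
  rewrite (big_ord_widen _ (fun i => pt lam i) len) [RHS]big_mkcond /=.
  by apply: eq_bigr => i _; case: ltnP => // ?; rewrite pt_default.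
rewrite (bigD1 (Ordinal n0)) //= mul1n big1 ?addn0 // => i /eqP ni.
by case: eqP => // e; case: ni; apply: val_inj.
Qed.

(** Only comparisons of row 1 with row 0 could be altered by the shift. The last two hypotheses make
    all of these hold both before and after it. *)
Lemma step_emb x (rho nu : Sh n1) : 0 < n2 -> pt rho 0 + d <= n2 -> pt nu 0 + d <= n2 ->
  pt nu 1 <= pt rho 0 -> pt rho 0 <= pt nu 0 ->
  step x (emb rho) (emb nu) = step x rho nu.
Proof.
case: x => a t n0 b1 b2 h1 h0; rewrite /step !sz_emb //=; congr [&& _, _ & _].
- apply/monoP/monoP => m i; have := m i; rewrite !pt_emb // /shift_head;
    case: i => [|i]; lia.
- apply/stripP/stripP => m i; have := m i; rewrite !pt_emb // /shift_head;
    case: t {m}; case: i => [|i]; lia.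
- lia.
Qed.

(* The first row may be lengthened as long as it does not interact with the
   second one along the chain, i.e. [lam_1 <= rho_0]. *)
Lemma Kc_emb w (rho lam : Sh n1) : 0 < n2 -> pt lam 0 + d <= n2 ->
  pt lam 1 <= pt rho 0 -> pt rho 0 + d <= n2 -> Kc w (emb rho) (emb lam) = Kc w rho lam.
Proof.
move=> n0 bl; elim: w rho => [|x w IH] rho hl br.
  rewrite /=; congr (nat_of_bool _); apply/eqP/eqP => [e|-> //].
  apply: pt_inj => i; have := congr1 (fun l => pt l i) e.
  by rewrite /= !pt_emb // /shift_head => /addIn.
pose inv (nu : Sh n2) : Sh n1 := sh_of n1 (fun i => pt nu i - (i == 0) * d).
pose sub n (nu mu : Sh n) := [forall i : 'I_n, pt nu i <= pt mu i].
have subP n (nu mu : Sh n) : reflect (forall i, pt nu i <= pt mu i) (sub n nu mu).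
  apply: (iffP forallP) => // H i; case: (ltnP i n) => [l|?]; last by rewrite pt_default.
  exact: (H (Ordinal l)).
(* A shape not contained in the end shape carries no chain. Keeping only those contained in it
   supplies the bounds under which [inv] undoes [emb]. *)
have restr n (r l : Sh n) : Kc (x :: w) r l =
    \sum_(nu | step x r nu && sub n nu l) Kc w nu l.
  rewrite /= [RHS]big_mkcondr; apply: eq_bigr => nu _; case: ifP => // /negP s.
  by case: (posnP (Kc w nu l)) => // /KcP[/subP].
rewrite !restr.
have ptinv (nu : Sh n2) i : sub _ nu (emb lam) -> pt (inv nu) i = pt nu i - (i == 0) * d.
  move/subP/(_ i); rewrite pt_emb // /shift_head => le.
  rewrite pt_sh_of //; first by have := pt_le lam i; lia.
  by move=> /(pt_default lam) e; lia.
rewrite (reindex_onto emb inv) /= => [|nu /andP[/and3P[_ st _] sb]]; last first.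
  (* As [nu] contains [emb rho], its first row is at least [d], so the truncated subtraction in
     [inv] is exact. *)
  have := strip_sub 0 st; rewrite pt_emb // /shift_head mul1n => st0.
  have b : pt (inv nu) 0 + d <= n2 by rewrite ptinv //; have := pt_le nu 0; lia.
  by apply: pt_inj => i; rewrite pt_emb // /shift_head ptinv //; case: i => [|i]; lia.
have main nu : sub _ nu lam -> pt rho 0 <= pt nu 0 ->
  [/\ pt nu 0 + d <= n2, pt nu 1 <= pt rho 0 & pt lam 1 <= pt nu 0].
  by move=> /subP sb; have := sb 0; have := sb 1; split; lia.
have P nu : step x (emb rho) (emb nu) && sub _ (emb nu) (emb lam) && (inv (emb nu) == nu)
    = step x rho nu && sub _ nu lam.
  apply/andP/andP => [[/andP[st sb] /eqP e]|[st sb]].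
    have r0 : pt rho 0 + d <= pt (emb nu) 0.
      by case/and3P: (st) => _ /(strip_sub 0); rewrite pt_emb // /shift_head mul1n.
    have nub : pt nu 0 + d <= n2.
      by rewrite -e ptinv //; have := pt_le (emb nu) 0; lia.
    have sb' : sub _ nu lam.
      by apply/subP => i; have /subP/(_ i) := sb; rewrite !pt_emb // leq_add2r.
    have r0' : pt rho 0 <= pt nu 0.
      by move: r0; rewrite pt_emb // /shift_head mul1n leq_add2r.
    by have [h1 h2 h3] := main _ sb' r0'; rewrite -(step_emb x n0 br).
  have r0 : pt rho 0 <= pt nu 0 by case/and3P: (st) => _ /(strip_sub 0).
  have [h1 h2 h3] := main _ sb r0.
  have sb' : sub _ (emb nu) (emb lam).
    by apply/subP => i; rewrite !pt_emb // leq_add2r; apply: subP.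
  rewrite step_emb // st sb'; split=> //; apply/eqP/pt_inj => i.
  by rewrite ptinv // pt_emb // /shift_head addnK.
rewrite (eq_bigl _ _ P); apply: eq_bigr => nu /andP[/and3P[_ st _] sb].
by have [|h1 h2 h3] := main _ sb; [exact: strip_sub st | apply: IH].
Qed.
End Embed.

(** * Tableaux as chains *)

Lemma card_ord_lt n k : k <= n -> #|[set c : 'I_n | c < k]| = k.
Proof.
move=> kn; rewrite -sum1dep_card (big_ord_narrow kn) /=.
by rewrite sum1_card card_ord.
Qed.

Lemma card_ord_interval n p q : q <= n -> #|[set c : 'I_n | p <= c < q]| = q - p.
Proof.
move=> qn; have [pq|/ltnW qp] := leqP p q; last first.
  rewrite (eqP (_ : q - p == 0)) ?subn_eq0 //; apply/eqP; rewrite cards_eq0.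
  by apply/eqP/setP => c; rewrite !inE; lia.
have := cardsID [set c : 'I_n | c < p] [set c : 'I_n | c < q].
have -> : [set c : 'I_n | c < q] :&: [set c : 'I_n | c < p] = [set c : 'I_n | c < p].
  by apply/setP => c; rewrite !inE; lia.
have -> : [set c : 'I_n | c < q] :\: [set c : 'I_n | c < p] = [set c : 'I_n | p <= c < q].
  by apply/setP => c; rewrite !inE -leqNgt.
by rewrite !card_ord_lt ?(leq_trans pq) //; lia.
Qed.

Lemma card_skew n (nu lam : Sh n) :
  #|[set x : 'I_n * 'I_n | pt nu x.1 <= x.2 < pt lam x.1]| =
  \sum_(r < n) (pt lam r - pt nu r).
Proof.
rewrite -sum1dep_card.
rewrite -(pair_big_dep xpredT (fun r c : 'I_n => pt nu r <= c < pt lam r) (fun _ _ => 1)).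
by apply: eq_bigr => r _; rewrite sum1dep_card card_ord_interval // pt_le.
Qed.

Lemma downset_card n (A : {set 'I_n}) :
  (forall c c' : 'I_n, c' < c -> c \in A -> c' \in A) ->
  forall c, (c \in A) = (c < #|A|).
Proof.
move=> down c; apply/idP/idP => [cA|].
  rewrite -(card_ord_lt (ltn_ord c)) subset_leq_card //; apply/subsetP => c'.
  rewrite inE ltnS leq_eqVlt => /orP[/eqP/val_inj-> //|/down]; exact.
apply: contraLR => cA; rewrite -leqNgt -(card_ord_lt (ltnW (ltn_ord c))).
apply/subset_leq_card/subsetP => c' c'A; rewrite inE ltnNge; apply: contra cA.
rewrite leq_eqVlt => /orP[/eqP/val_inj-> //|/down]; exact.
Qed.

Lemma leq_cells n p q : p <= n -> (forall c : 'I_n, c < p -> c < q) -> p <= q.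
Proof.
move=> pn H; rewrite leqNgt; apply/negP => qp.
have := H (Ordinal (leq_trans qp pn)) qp; by rewrite ltnn.
Qed.

Section Tableaux.
Variables (X : finType) (x0 : X) (t : X -> bool) (Mf : X -> nat) (n : nat).
Implicit Types (rho lam nu : Sh n) (s : seq X) (T : {ffun 'I_n * 'I_n -> X}).

(** The order of the letters is their position in [s]; equality is tolerated only for the letters
    selected by [rep]. *)
Definition letter_lt s (rep : X -> bool) a b :=
  (index a s < index b s) || (a == b) && rep a.

Definition inskew rho lam (x : 'I_n * 'I_n) := pt rho x.1 <= x.2 < pt lam x.1.

(* Fillings of [lam/rho] by the letters of [s], listed in increasing order; the
   letters of type [true] may be repeated in columns, the others in rows. *)
Definition tabok s rho lam T : bool :=
  [&& [forall i : 'I_n, pt rho i <= pt lam i],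
      [forall x, if inskew rho lam x then T x \in s else T x == x0],
      [forall r : 'I_n, forall c : 'I_n, forall c' : 'I_n,
         [&& c < c', T (r, c) \in s & T (r, c') \in s] ==>
         letter_lt s (predC t) (T (r, c)) (T (r, c'))],
      [forall r : 'I_n, forall r' : 'I_n, forall c : 'I_n,
         [&& r < r', T (r, c) \in s & T (r', c) \in s] ==>
         letter_lt s t (T (r, c)) (T (r', c))] &
      all (fun a => #|[set x | T x == a]| == Mf a) s].

Lemma tabokP s rho lam T : reflect
  [/\ forall i, pt rho i <= pt lam i,
      forall x, if inskew rho lam x then is_true (T x \in s) else T x = x0,
      forall r c c' : 'I_n, c < c' -> T (r, c) \in s -> T (r, c') \in s ->
         letter_lt s (predC t) (T (r, c)) (T (r, c')),
      forall r r' c : 'I_n, r < r' -> T (r, c) \in s -> T (r', c) \in s ->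
         letter_lt s t (T (r, c)) (T (r', c)) &
      forall a, a \in s -> #|[set x | T x == a]| = Mf a]
  (tabok s rho lam T).
Proof.
apply: (iffP and5P) => -[h1 h2 h3 h4 h5]; split.
- move=> i; case: (ltnP i n) => [l|?]; last by rewrite pt_default.
  exact: (forallP h1 (Ordinal l)).
- by move=> x; have := forallP h2 x; case: ifP => // _ /eqP.
- move=> r c c' a b d; have /forallP/(_ c)/forallP/(_ c')/implyP := forallP h3 r.
  by apply; rewrite a b d.
- move=> r c c' a b d; have /forallP/(_ c)/forallP/(_ c')/implyP := forallP h4 r.
  by apply; rewrite a b d.
- by move=> a sa; apply/eqP; exact: (allP h5).
- by apply/forallP.
- by apply/forallP => x; have := h2 x; case: ifP => // _ ->.
- by do 3!apply/forallP => ?; apply/implyP => /and3P[]; exact: h3.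
- by do 3!apply/forallP => ?; apply/implyP => /and3P[]; exact: h4.
- by apply/allP => a sa; apply/eqP; exact: h5.
Qed.

Lemma tab_nil rho lam : #|[set T | tabok [::] rho lam T]| = (rho == lam).
Proof.
have [e|ne] := eqVneq rho lam.
  rewrite [RHS]/= -(cards1 ([ffun=> x0] : {ffun 'I_n * 'I_n -> X})); congr #|pred_of_set _|.
  apply/setP => T; rewrite !inE; apply/tabokP/eqP => [[_ h _ _ _]|->].
    by apply/ffunP => x; rewrite ffunE; have := h x; rewrite e /inskew; case: ifP => //; lia.
  split=> // [i|x]; first by rewrite e.
  by rewrite ffunE e /inskew; case: ifP => //; lia.
apply: eq_card0 => T; rewrite inE; apply/tabokP => -[sub h _ _ _].
case/eqP: ne; apply: sz_le_eq => //; rewrite !szE; apply: leq_sum => r _.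
apply: (leq_cells (pt_le _ _)) => c lc; rewrite ltnNge; apply/negP => rc.
by have := h (r, c); rewrite /inskew /= rc lc.
Qed.

Section Step.
Variables (s : seq X) (a : X) (rho lam : Sh n).
Hypotheses (sa : uniq (rcons s a)) (x0s : x0 \notin rcons s a).
Hypotheses (mr : mono rho) (ml : mono lam).

Let as_ : a \notin s. Proof. by move: sa; rewrite rcons_uniq => /andP[]. Qed.
Let x0a : x0 != a. Proof. by move: x0s; rewrite mem_rcons inE => /norP[]. Qed.
Let x0s' : x0 \notin s. Proof. by move: x0s; rewrite mem_rcons inE => /norP[]. Qed.

(** The shape left when the largest letter [a] is erased. Row lengths are defined as cardinalities,
    since only for a valid tableau are the remaining cells left-justified ([nuofE]). *)
Let nuof T : Sh n :=
  [ffun r : 'I_n => inord #|[set c : 'I_n | (c < pt rho r) || (T (r, c) \in s)]|].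
Let rem T : {ffun 'I_n * 'I_n -> X} := [ffun x => if T x == a then x0 else T x].
Let add nu T : {ffun 'I_n * 'I_n -> X} := [ffun x => if inskew nu lam x then a else T x].

Let idx x : x \in s -> index x (rcons s a) = index x s.
Proof. by move=> xs; rewrite -cats1 index_cat xs. Qed.
Let idxa : index a (rcons s a) = size s.
Proof. by rewrite -cats1 index_cat (negPf as_) /= eqxx addn0. Qed.

Let lt_s rep x y : x \in s -> y \in s ->
  letter_lt (rcons s a) rep x y = letter_lt s rep x y.
Proof. by move=> xs ys; rewrite /letter_lt !idx. Qed.

Let lt_sa rep x : x \in s -> letter_lt (rcons s a) rep x a.
Proof. by move=> xs; rewrite /letter_lt (idx xs) idxa index_mem xs. Qed.

Let lt_as rep x : x \in s -> letter_lt (rcons s a) rep a x = false.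
Proof.
move=> xs; rewrite /letter_lt (idx xs) idxa ltnNge index_size /=.
by case: eqP => // e; move: as_; rewrite e xs.
Qed.

Let lt_aa rep : letter_lt (rcons s a) rep a a = rep a.
Proof. by rewrite /letter_lt ltnn eqxx. Qed.

Let in_rcons x : x \in rcons s a -> x = a \/ x \in s.
Proof. by rewrite mem_rcons inE => /orP[/eqP|]; [left|right]. Qed.

Lemma nuofE T : (forall r c c' : 'I_n, c' < c -> T (r, c) \in s ->
    (c' < pt rho r) || (T (r, c') \in s)) ->
  forall r c : 'I_n, (c < pt (nuof T) r) = (c < pt rho r) || (T (r, c) \in s).
Proof.
move=> down r c; rewrite pt_ord ffunE inordK; last first.
  by rewrite ltnS -[n in X in _ <= X]card_ord max_card.
rewrite -downset_card ?inE // => c1 c2 lt; rewrite !inE => /orP[l|]; last exact: down.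
by rewrite (ltn_trans lt l).
Qed.

(** The letter [a], being the largest, cannot precede a letter of [s] in a row or a column, so its
    cells are exactly those of [lam] outside [nu]. That it may not be repeated in a row (type
    [true]) or in a column (type [false]) makes this difference a strip of the matching type. *)
Lemma tabok_remove T : tabok (rcons s a) rho lam T ->
  [/\ mono (nuof T), step (Mf a, t a) (nuof T) lam, tabok s rho (nuof T) (rem T)
    & add (nuof T) (rem T) = T].
Proof.
move/tabokP => [sub fill row col cnt]; set nu := nuof T.
have ins x : T x \in s -> inskew rho lam x /\ T x \in rcons s a.
  move=> xs; split; last by rewrite mem_rcons inE xs orbT.
  by have := fill x; case: ifP => // _ e; move: x0s'; rewrite -e xs.
have nuE (r c : 'I_n) : (c < pt nu r) = (c < pt rho r) || (T (r, c) \in s).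
  apply: nuofE => {}r {}c c' lt cs; have [//|rc] := ltnP c' (pt rho r) => /=.
  have [/andP[/= _ cl] cs'] := ins _ cs.
  have c's : T (r, c') \in rcons s a.
    by have := fill (r, c'); rewrite /inskew /= rc (ltn_trans lt cl).
  by case: (in_rcons c's) => // e; have := row r c' c lt c's cs'; rewrite e lt_as.
have aE x : (T x == a) = inskew nu lam x.
  case: x => r c; rewrite /inskew /= leqNgt nuE negb_or -leqNgt.
  have := fill (r, c); rewrite /inskew /=; case: (pt rho r <= c) => /= [|->]; last by rewrite (negPf x0a).
  case: (c < pt lam r) => [/in_rcons[->|cs]|->]; rewrite ?eqxx ?as_ ?cs ?andbF //=.
    by apply/negP => /eqP e; move: as_; rewrite -e cs.
  exact: negPf.
have rn r : pt rho r <= pt nu r.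
  case: (ltnP r n) => [l|?]; last by rewrite pt_default.
  apply: (@leq_cells n); rewrite ?pt_le // => c lc.
  by have := nuE (Ordinal l) c; rewrite lc.
have nl r : pt nu r <= pt lam r.
  case: (ltnP r n) => [l|?]; last by rewrite pt_default.
  apply: (@leq_cells n); rewrite ?pt_le // => c.
  rewrite (nuE (Ordinal l)) => /orP[lc|/ins[/andP[] //]].
  exact: leq_trans (sub _).
have mn : mono nu.
  apply/monoP => r; case: (ltnP r.+1 n) => [l|?]; last by rewrite pt_default.
  apply: (@leq_cells n); rewrite ?pt_le // => c lc.
  have := nuE (Ordinal (ltnW l)) c; rewrite /= => ->.
  have := nuE (Ordinal l) c; rewrite lc => /esym /orP[lc'|cs].
    by rewrite (leq_trans lc') //; exact/monoP.
  have [//|rc] := ltnP c (pt rho r) => /=.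
  have [/andP[/= _ cl] cs'] := ins _ cs.
  have := fill (Ordinal (ltnW l), c); rewrite /inskew /= rc.
  rewrite (leq_trans cl) /=; last exact/monoP.
  move=> c's; case: (in_rcons c's) => // e.
  by have := col (Ordinal (ltnW l)) (Ordinal l) c (leqnn _) c's cs'; rewrite e lt_as.
have arc r c : pt nu r <= c -> c < pt lam r -> forall (lr : r < n) (lc : c < n),
    T (Ordinal lr, Ordinal lc) = a.
  by move=> h1 h2 lr lc; apply/eqP; rewrite aE /inskew /= h1 h2.
have arcs : a \in rcons s a by rewrite mem_rcons mem_head.
split=> //.
- rewrite /step ml /=; apply/andP; split.
    (* A failure of the strip condition at row [r] would produce two adjacent cells outside [nu],
       side by side in row [r] or one above the other in rows [r] and [r.+1], both containing
       [a]. *)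
    apply/stripP => r; split=> //; case: ifPn => ta.
      rewrite leqNgt; apply/negP => lt.
      have rn' : r < n by rewrite ltnNge; apply/negP => /(pt_default lam) e; rewrite e in lt.
      have c2 : (pt nu r).+1 < n by apply: leq_trans lt (pt_le _ _).
      have e1 := arc r (pt nu r) (leqnn _) (ltnW lt) rn' (ltnW c2).
      have e2 := arc r (pt nu r).+1 (leqnSn _) lt rn' c2.
      by have := row (Ordinal rn') (Ordinal (ltnW c2)) (Ordinal c2) (leqnn _);
        rewrite e1 e2 lt_aa /= ta => /(_ arcs arcs).
    rewrite leqNgt; apply/negP => lt.
    have rn' : r.+1 < n by rewrite ltnNge; apply/negP => /(pt_default lam) e; rewrite e in lt.
    have c2 : pt nu r < n by apply: leq_trans lt (pt_le _ _).
    have e1 := arc r (pt nu r) (leqnn _) (leq_trans lt (monoP _ ml _)) (ltnW rn') c2.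
    have e2 := arc r.+1 (pt nu r) (monoP _ mn _) lt rn' c2.
    by have := col (Ordinal (ltnW rn')) (Ordinal rn') (Ordinal c2) (leqnn _);
      rewrite e1 e2 lt_aa /= (negPf ta) => /(_ arcs arcs).
  rewrite -cnt // (_ : [set x | T x == a] = [set x | inskew nu lam x]); last first.
    by apply/setP => x; rewrite !inE aE.
  rewrite card_skew !szE -big_split /=; apply/eqP; apply: eq_bigr => r _.
  by rewrite subnKC.
- have rs x : T x \in s -> rem T x = T x.
    by move=> xs; rewrite ffunE; case: eqP => // e; move: as_; rewrite -e xs.
  have rsE x : (rem T x \in s) = (T x \in s).
    by rewrite ffunE; case: eqP => // ->; rewrite (negPf x0s') (negPf as_).
  apply/tabokP; split=> //.
  + move=> [r c]; rewrite /inskew /= nuE; have := fill (r, c); rewrite /inskew /=.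
    case: (leqP (pt rho r) c) => [rc|lt] /=; last first.
      by move=> e; rewrite ffunE e; case: eqP.
    case: ifP => [_ /in_rcons[e|cs]|_ e].
    * by rewrite ffunE e eqxx (negPf as_).
    * by rewrite cs rs.
    * by rewrite e (negPf x0s') ffunE e; case: eqP.
  + move=> r c c' lt; rewrite !rsE => h h'; rewrite !rs // -lt_s //.
    by apply: row; rewrite // mem_rcons inE ?h ?h' orbT.
  + move=> r c c' lt; rewrite !rsE => h h'; rewrite !rs // -lt_s //.
    by apply: col; rewrite // mem_rcons inE ?h ?h' orbT.
  + move=> b bs; rewrite -cnt; last by rewrite mem_rcons inE bs orbT.
    apply: eq_card => x; rewrite !inE ffunE; case: (T x =P a) => // ->.
    by rewrite eq_sym (negPf (memPn x0s' _ bs)) eq_sym (negPf (memPn as_ _ bs)).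
- apply/ffunP => x; rewrite !ffunE -aE; by case: eqP.
Qed.

Lemma tabok_add nu T : mono nu -> step (Mf a, t a) nu lam -> tabok s rho nu T ->
  [/\ tabok (rcons s a) rho lam (add nu T), nuof (add nu T) = nu & rem (add nu T) = T].
Proof.
move=> mn /and3P[_ /= st /eqP szl] /tabokP[sub fill row col cnt].
have sc x : T x \in s -> pt rho x.1 <= x.2 < pt nu x.1.
  by move=> xs; have := fill x; rewrite -/(inskew rho nu x); case: ifP => // _ e; move: x0s'; rewrite -e xs.
have nl r : pt nu r <= pt lam r := strip_sub r st.
have skn x : T x \in s -> inskew nu lam x = false.
  by move=> /sc /andP[_ h]; rewrite /inskew leqNgt h.
have addsE x : (add nu T x \in s) = (T x \in s).
  rewrite ffunE; case: ifP => // sk; rewrite (negPf as_); apply/esym.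
  by apply: contraTF sk => /skn ->.
have adda x : (add nu T x == a) = inskew nu lam x.
  rewrite ffunE; case: ifP => [_|_]; first exact: eqxx.
  have := fill x; case: ifP => [_ xs|_ ->]; last exact: negPf.
  by apply: contraNF as_ => /eqP <-.
have addT x : T x \in s -> add nu T x = T x by move=> /skn e; rewrite ffunE e.
have rsE x : (add nu T x \in rcons s a) = inskew nu lam x || (T x \in s).
  by rewrite mem_rcons inE adda addsE.
split.
- apply/tabokP; split.
  + by move=> i; apply: leq_trans (sub i) _.
  + move=> [r c]; rewrite rsE /inskew /=; have := fill (r, c); rewrite /inskew /=.
    have := sub r; have := nl r; case: (leqP (pt nu r) c) => h1 h2 h3 /=.
      rewrite (leq_trans h3 h1) /=; case: (ltnP c (pt lam r)) => // h4 e.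
      by rewrite ffunE /inskew /= h1 (ltnNge c) h4.
    rewrite (leq_trans h1 h2) andbT; case: ifP => // _ e.
    by rewrite ffunE /inskew /= leqNgt h1.
  + move=> r c c' lt; rewrite !rsE.
    have [sk' h _|sk' h /= h'] := boolP (inskew nu lam (r, c')).
      have /eqP -> : add nu T (r, c') == a by rewrite adda.
      case sk: (inskew nu lam (r, c)) h => /= h; last by rewrite lt_sa // addsE.
      have /eqP -> : add nu T (r, c) == a by rewrite adda.
      rewrite lt_aa /=; apply/negP => ta.
      have /stripP/(_ r)[_] := st; rewrite ta.
      by move: sk sk' lt; rewrite /inskew /=; clear; lia.
    have h2 : T (r, c) \in s.
      case/orP: h => // /andP[/= l1 _]; have /andP[/= _ l2] := sc _ h'.
      by have := leq_ltn_trans l1 (ltn_trans lt l2); rewrite ltnn.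
    by rewrite lt_s ?addsE // !addT //; apply: row.
  + move=> r r' c lt; rewrite !rsE.
    have [sk' h _|sk' h /= h'] := boolP (inskew nu lam (r', c)).
      have /eqP -> : add nu T (r', c) == a by rewrite adda.
      case sk: (inskew nu lam (r, c)) h => /= h; last by rewrite lt_sa // addsE.
      have /eqP -> : add nu T (r, c) == a by rewrite adda.
      rewrite lt_aa /=; case ta: (t a) => //.
      have /stripP/(_ r)[_] := st; rewrite ta.
      have := mono_le ml lt.
      by move: sk sk'; rewrite /inskew /=; clear; lia.
    have h2 : T (r, c) \in s.
      case/orP: h => // /andP[/= l1 _]; have /andP[/= _ l2] := sc _ h'.
      by have := leq_ltn_trans l1 (leq_trans l2 (mono_le mn (ltnW lt))); rewrite ltnn.
    by rewrite lt_s ?addsE // !addT //; apply: col.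
  + move=> b; rewrite mem_rcons inE => /orP[/eqP ->|bs].
      rewrite (_ : [set x | _] = [set x | inskew nu lam x]); last first.
        by apply/setP => x; rewrite !inE adda.
      rewrite card_skew; apply/eqP; rewrite -(eqn_add2l (sz nu)) -szl !szE -big_split.
      by apply/eqP; apply: eq_bigr => r _ /=; rewrite subnKC.
    rewrite -cnt //; apply: eq_card => x; rewrite !inE ffunE; case: ifP => // sk.
    rewrite eq_sym (negPf (memPn as_ _ bs)); apply/esym/negP => /eqP e.
    by move: sk; rewrite skn // e.
- apply: pt_inj => r; case: (ltnP r n) => [l|?]; last by rewrite !pt_default.
  have down (r' c c' : 'I_n) : c' < c -> add nu T (r', c) \in s ->
      (c' < pt rho r') || (add nu T (r', c') \in s).
    move=> lt; rewrite !addsE => /sc/andP[/= _ cn].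
    case: (ltnP c' (pt rho r')) => //= rc; have := fill (r', c').
    by rewrite /inskew /= rc (ltn_trans lt cn).
  have E (c : 'I_n) : (c < pt (nuof (add nu T)) r) = (c < pt nu r).
    rewrite (nuofE down (Ordinal l)) addsE; have := fill (Ordinal l, c).
    rewrite /inskew /=; have := sub r; case: (leqP (pt rho r) c) => rc sr /=.
      by case: (c < pt nu r) => [->|->]; rewrite ?(negPf x0s').
    by move=> _; rewrite (leq_trans rc sr).
  by apply/eqP; rewrite eqn_leq; apply/andP; split;
    apply: (leq_cells (pt_le _ _)) => c; rewrite E.
- apply/ffunP => x; rewrite ffunE adda; case: ifP => sk; last by rewrite ffunE sk.
  have := fill x; case: ifP => [/andP[_ h]|_ -> //].
  by move: sk; rewrite /inskew leqNgt h.
Qed.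

End Step.

(** Erasing the letters from the largest to the smallest turns a tableau into a chain, one strip per
    letter, read from its end. *)
Lemma card_tabok s rho lam : uniq s -> x0 \notin s -> mono rho -> mono lam ->
  #|[set T | tabok s rho lam T]| = Kc [seq (Mf a, t a) | a <- s] rho lam.
Proof.
move=> us xs mr; elim/last_ind: s lam us xs => [|s a IH] lam us xs ml; first exact: tab_nil.
have us' : uniq s by move: us; rewrite rcons_uniq => /andP[].
have xs' : x0 \notin s by move: xs; rewrite mem_rcons inE => /norP[].
rewrite map_rcons Kc_rcons.
transitivity #|[set p : Sh n * {ffun 'I_n * 'I_n -> X} |
    [&& mono p.1, step (Mf a, t a) p.1 lam & tabok s rho p.1 p.2]]|.
  pose f T : Sh n * {ffun 'I_n * 'I_n -> X} :=
    ([ffun r : 'I_n => inord #|[set c : 'I_n | (c < pt rho r) || (T (r, c) \in s)]|],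
     [ffun x => if T x == a then x0 else T x]).
  pose g (p : Sh n * {ffun 'I_n * 'I_n -> X}) : {ffun 'I_n * 'I_n -> X} :=
    [ffun x => if inskew p.1 lam x then a else p.2 x].
  apply: (@card_bij _ _ _ _ f g) => [T|[nu T]]; rewrite !inE /=.
    by move=> /(tabok_remove us xs mr ml)[-> -> -> e]; split.
  by case/and3P => mn st /(tabok_add us xs ml mn st)[-> e1 e2]; rewrite /f /g e1 e2.
rewrite -sum1dep_card; under eq_bigl => p do rewrite andbA.
rewrite -(pair_big_dep (fun nu : Sh n => mono nu && step (Mf a, t a) nu lam)
  (fun nu T => tabok s rho nu T) (fun _ _ => 1)) /=.
rewrite [RHS]big_mkcond [LHS]big_mkcond; apply: eq_bigr => nu _.
case: (step _ nu lam); rewrite ?andbF // andbT; case: ifP => mn.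
  by rewrite sum1dep_card IH.
(* The chain count also sums over shapes [nu] that are not decreasing; no chain from the decreasing
   [rho] reaches them. *)
case: (posnP (Kc [seq (Mf i, t i) | i <- s] rho nu)) => // /(Kc_mono mr).
by rewrite mn.
Qed.

End Tableaux.

(** * Partitions and Kostka numbers *)

Lemma sorted_geq_nth s i j : sorted geq s -> i <= j -> nth 0 s j <= nth 0 s i.
Proof.
move=> so ij; case: (ltnP j (size s)) => [js|sj]; last by rewrite (nth_default _ sj).
have tr : transitive geq by move=> a b c ab bc; exact: leq_trans bc ab.
by apply: (sorted_leq_nth tr (fun x => leqnn x) 0 so) => //; rewrite inE (leq_ltn_trans ij).
Qed.

Lemma nth_filter_pos s i : sorted geq s -> nth 0 [seq x <- s | 0 < x] i = nth 0 s i.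
Proof.
elim: s i => [|[|x] s IH] i so //=; last by case: i => //= i; apply: IH; exact: path_sorted so.
have z j : nth 0 (0 :: s) j = 0.
  by apply/eqP; rewrite -leqn0 -[X in _ <= X]/(nth 0 (0 :: s) 0) sorted_geq_nth.
by rewrite IH ?(path_sorted so) // -[LHS]/(nth 0 (0 :: s) i.+1) !z.
Qed.

Lemma sumn_filter_pos s : sumn [seq x <- s | 0 < x] = sumn s.
Proof. by elim: s => [|[|x] s IH] //=; rewrite IH. Qed.

Lemma is_partition_filter s : sorted geq s -> is_partition [seq x <- s | 0 < x].
Proof.
move=> so; rewrite /is_partition filter_all andbT.
by apply: sorted_filter so => a b c ab bc; exact: leq_trans bc ab.
Qed.

Lemma partition_sorted s : is_partition s -> sorted geq s.
Proof. by case/andP. Qed.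

Lemma partition_gt0 s i : is_partition s -> (0 < nth 0 s i) = (i < size s).
Proof.
case/andP => _ /allP ps; case: (ltnP i (size s)) => [l|l]; last by rewrite nth_default.
by apply: ps; rewrite mem_nth.
Qed.

Lemma partition_eq s s' : is_partition s -> is_partition s' ->
  nth 0 s =1 nth 0 s' -> s = s'.
Proof.
move=> ps ps' E; apply: (@eq_from_nth _ 0) => //.
have le r r' : is_partition r -> is_partition r' -> nth 0 r =1 nth 0 r' -> size r <= size r'.
  by move=> pr pr' F; rewrite leqNgt -partition_gt0 // F partition_gt0 // ltnn.
by apply/eqP; rewrite eqn_leq !le // => i; rewrite E.
Qed.

Lemma size_partition s : is_partition s -> size s <= sumn s.
Proof.
case/andP => _; elim: s => //= x s IH /andP[x0 /IH le]; lia.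
Qed.

Lemma nth_le_sumn s i : nth 0 s i <= sumn s.
Proof.
elim: s i => [|x s IH] [|i] //=; rewrite ?nth_nil ?leq_addr //.
by apply: leq_trans (IH i) _; rewrite leq_addl.
Qed.

Definition shp n (s : seq nat) : Sh n := sh_of n (nth 0 s).

Lemma pt_shp n s i : is_partition s -> sumn s <= n -> pt (shp n s) i = nth 0 s i.
Proof.
move=> ps sn; rewrite pt_sh_of ?(leq_trans (nth_le_sumn _ _)) // => ni.
by rewrite nth_default // (leq_trans (size_partition ps)) // (leq_trans sn).
Qed.

Lemma sumn_nth s n : size s <= n -> sumn s = \sum_(i < n) nth 0 s i.
Proof.
move=> sn; rewrite sumnE (big_nth 0) big_mkord (big_ord_widen _ (fun i => nth 0 s i) sn).
rewrite [LHS]big_mkcond /=; apply: eq_bigr => i _; case: ltnP => // ?.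
by rewrite nth_default.
Qed.

Lemma sz_shp n s : is_partition s -> sumn s <= n -> sz (shp n s) = sumn s.
Proof.
move=> ps sn; rewrite szE (sumn_nth (leq_trans (size_partition ps) sn)).
by apply: eq_bigr => i _; rewrite pt_shp.
Qed.

Lemma mono_shp n s : is_partition s -> sumn s <= n -> mono (shp n s).
Proof.
move=> ps sn; apply/monoP => i; rewrite !pt_shp // sorted_geq_nth //.
exact: partition_sorted.
Qed.

Definition parseq n (lam : Sh n) : seq nat := [seq x <- [seq pt lam i | i <- iota 0 n] | 0 < x].

Lemma parseq_seq n (lam : Sh n) i : nth 0 [seq pt lam i | i <- iota 0 n] i = pt lam i.
Proof.
case: (ltnP i n) => [l|l]; last by rewrite nth_default ?pt_default // size_map size_iota.
by rewrite (nth_map 0) ?size_iota // nth_iota.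
Qed.

Lemma sorted_nth s : (forall i, nth 0 s i.+1 <= nth 0 s i) -> sorted geq s.
Proof.
move=> H; case: s H => // x s H; apply/(pathP 0) => i is_; exact: (H i).
Qed.

Lemma parseqP n (lam : Sh n) : mono lam ->
  [/\ is_partition (parseq lam), sumn (parseq lam) = sz lam &
      forall i, nth 0 (parseq lam) i = pt lam i].
Proof.
move=> /monoP m; have so : sorted geq [seq pt lam i | i <- iota 0 n].
  by apply: sorted_nth => i; rewrite !parseq_seq.
split; first exact: is_partition_filter.
- rewrite sumn_filter_pos sumnE big_map szE -(big_mkord xpredT (fun i => pt lam i)).
  by rewrite /index_iota subn0.
- by move=> i; rewrite nth_filter_pos // parseq_seq.
Qed.

Lemma shpK n s : is_partition s -> sumn s <= n -> parseq (shp n s) = s.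
Proof.
move=> ps sn; have [pp _ nn] := parseqP (mono_shp ps sn).
by apply: partition_eq => // i; rewrite nn pt_shp.
Qed.

Lemma parseqK n (lam : Sh n) : mono lam -> sz lam <= n -> shp n (parseq lam) = lam.
Proof.
move=> m s; have [pp ss nn] := parseqP m; apply: pt_inj => i.
by rewrite pt_shp ?ss.
Qed.

Lemma is_ptnE n (lam : Sh n) : is_ptn lam = mono lam && (sz lam == n).
Proof.
congr (_ && _); apply/forallP/idP => [H|m i].
  apply/forallP => i; case: (ltnP i.+1 n) => [l|l]; last by rewrite pt_default.
  have /forallP/(_ (Ordinal l))/implyP := H i; rewrite -!pt_ord; apply=> //=.
by apply/forallP => j; apply/implyP => ij; rewrite -!pt_ord mono_le.
Qed.

Lemma ptseqE n (p : PT n) : ptseq p = parseq (val p).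
Proof.
rewrite /ptseq /parseq -val_enum_ord -map_comp filter_map.
under [in RHS]eq_filter => i do rewrite /= pt_ord.
by apply: eq_map => i /=; rewrite pt_ord.
Qed.

Definition parts n : seq (seq nat) := [seq ptseq p | p : PT n].

Lemma PT_mono n (p : PT n) : mono (val p) /\ sz (val p) = n.
Proof. by have := valP p; rewrite /= is_ptnE => /andP[-> /eqP]. Qed.

Lemma ptseq_inj n : injective (@ptseq n).
Proof.
move=> p q; rewrite !ptseqE => e; apply: val_inj.
have [mp sp] := PT_mono p; have [mq sq] := PT_mono q.
by rewrite -(parseqK mp) ?sp // -(parseqK mq) ?sq // e.
Qed.

Lemma mem_parts n s : (s \in parts n) = is_partition s && (sumn s == n).
Proof.
apply/imageP/andP => [[p _ ->]|[ps /eqP sn]].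
  by have [mp sp] := PT_mono p; rewrite ptseqE; have [-> -> _] := parseqP mp; rewrite sp.
have ok : is_ptn (shp n s) by rewrite is_ptnE mono_shp ?sz_shp ?sn //=.
by exists (Sub (shp n s) ok); rewrite // ptseqE shpK // sn.
Qed.

Lemma uniq_parts n : uniq (parts n).
Proof. by rewrite map_inj_uniq ?enum_uniq //; exact: ptseq_inj. Qed.

Lemma big_PT (V : nmodType) n (f : seq nat -> V) :
  (\sum_(p : PT n) f (ptseq p) = \sum_(s <- parts n) f s)%R.
Proof. by rewrite big_image. Qed.

Definition sh0 n : Sh n := sh_of n (fun=> 0).

Lemma pt_sh0 n i : pt (sh0 n) i = 0.
Proof. by rewrite pt_sh_of. Qed.

Lemma mono_sh0 n : mono (sh0 n).
Proof. by apply/monoP => i; rewrite !pt_sh0. Qed.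

Lemma sz_sh0 n : sz (sh0 n) = 0.
Proof. by rewrite szE big1 // => i _; rewrite pt_sh0. Qed.

Lemma ltn_pred2 x y : 0 < x -> (x.-1 < y.-1) = (x < y).
Proof. by move=> x0; rewrite ltn_predRL prednK. Qed.

Lemma kostka_Kc s mu : is_partition s ->
  kostka s mu = Kc (hw mu) (sh0 (sumn s)) (shp (sumn s) s).
Proof.
move=> ps; set n := sumn s; set m := size mu.
(* Entry [0] means no cell and plays the part of the blank [x0]; the letters are the nonzero entries
   in increasing order, all of horizontal type. *)
pose ls : seq 'I_m.+1 := [seq lift ord0 k | k <- enum 'I_m].
have lsE a : (a \in ls) = (0 < a).
  apply/mapP/idP => [[k _ -> //]|a0].
  have l : a.-1 < m by have := ltn_ord a; lia.
  by exists (Ordinal l); rewrite ?mem_enum //; apply: val_inj; rewrite /= /bump /=; lia.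
have lsi (a : 'I_m.+1) : 0 < a -> index a ls = a.-1.
  rewrite -lsE => /mapP[k _ ->]; rewrite index_map; last exact: lift_inj.
  by rewrite index_enum_ord.
have := @card_tabok 'I_m.+1 ord0 xpred0 (fun a => nth 0 mu a.-1) n ls (sh0 n) (shp n s).
have -> : [seq (nth 0 mu a.-1, xpred0 a) | a : 'I_m.+1 <- ls] = hw mu.
  rewrite /ls -map_comp /hw -[in RHS](mkseq_nth 0 mu) /mkseq -map_comp -val_enum_ord.
  by rewrite -map_comp; apply: eq_map.
move=> <-; rewrite ?mono_sh0 ?mono_shp ?lsE //; last first.
  by rewrite map_inj_uniq ?enum_uniq //; exact: lift_inj.
apply: eq_card => T; rewrite !inE /ssyt /=.
have skE (x : 'I_n * 'I_n) : inskew (sh0 n) (shp n s) x = (x.2 < nth 0 s x.1).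
  by rewrite /inskew pt_sh0 pt_shp.
apply/idP/tabokP => [/andP[/andP[/andP[/forallP h1 /forallP h2] /forallP h3] /forallP h4]|].
  split.
  - by move=> i; rewrite pt_sh0.
  - move=> x; rewrite skE; have /eqP -> := h1 x; rewrite lsE; case: ifP => // /negbT.
    by rewrite -leqNgt leqn0 => /eqP e; apply: val_inj.
  - move=> r c c' lt; rewrite !lsE => p1 p2; rewrite /letter_lt /= !lsi // ltn_pred2 // andbT.
    have /forallP/(_ c)/forallP/(_ c')/implyP := h2 r.
    have /eqP -> := h1 (r, c); have /eqP -> := h1 (r, c'); rewrite lt p1 p2 => /(_ isT).
    by rewrite leq_eqVlt => /orP[/eqP/val_inj->|->//]; rewrite eqxx orbT.
  - move=> r r' c lt; rewrite !lsE => p1 p2; rewrite /letter_lt /= !lsi // ltn_pred2 // andbF orbF.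
    have /forallP/(_ r')/forallP/(_ c)/implyP := h3 r.
    have /eqP -> := h1 (r, c); have /eqP -> := h1 (r', c); rewrite lt p1 p2 => /(_ isT).
    by [].
  - move=> a /mapP[k _ ->]; have /eqP <- := h4 k; apply: eq_card => x.
    by rewrite !inE -val_eqE.
move=> [_ h1 h2 h3 h4].
have h1' (x : 'I_n * 'I_n) : (x.2 < nth 0 s x.1) = (0 < T x).
  by have := h1 x; rewrite skE; case: ifP => [_|_ ->] //; rewrite lsE => ->.
apply/andP; split; [apply/andP; split; [apply/andP; split|]|].
- by apply/forallP => x; rewrite h1'.
- apply/forallP => r; apply/forallP => c; apply/forallP => c'; apply/implyP.
  rewrite (h1' (r, c)) (h1' (r, c')) => /and3P[lt p1 p2].
  have := h2 r c c' lt; rewrite !lsE => /(_ p1 p2); rewrite /letter_lt /= !lsi // ltn_pred2 // andbT.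
  by case/orP => [/ltnW|/eqP -> //].
- apply/forallP => r; apply/forallP => c; apply/forallP => c'; apply/implyP.
  rewrite (h1' (r, c')) (h1' (c, c')) => /and3P[lt p1 p2].
  have := h3 r c c' lt; rewrite !lsE => /(_ p1 p2); rewrite /letter_lt /= !lsi // ltn_pred2 // andbF orbF.
  by [].
- apply/forallP => k; have -> : nth 0 mu k = nth 0 mu (lift ord0 k).-1 by [].
  rewrite -h4; last by rewrite lsE.
  by apply/eqP; apply: eq_card => x; rewrite !inE.
Qed.

(** * Inversion of the Kostka matrix *)

Lemma sum_vanish (f : nat -> nat) a b : (forall i, a <= i -> f i = 0) ->
  (forall i, b <= i -> f i = 0) -> \sum_(i < a) f i = \sum_(i < b) f i.
Proof.
wlog ab : a b / a <= b => [H ha hb|ha _].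
  by case/orP: (leq_total a b) => ab; [|symmetry]; apply: H.
rewrite (big_ord_widen _ f ab) big_mkcond; apply: eq_bigr => i _ /=.
by case: ltnP => // /ha.
Qed.

Lemma leq_sum_eq n (f g : 'I_n -> nat) : (forall i, f i <= g i) ->
  \sum_(i < n) g i <= \sum_(i < n) f i -> forall i, f i = g i.
Proof.
move=> le sle i; apply/eqP; rewrite eqn_leq le /= leqNgt; apply/negP => lt.
move: sle; rewrite leqNgt => /negP; apply.
rewrite (bigD1 i) // [X in _ < X](bigD1 i) //= -addSn leq_add //.
exact: leq_sum.
Qed.

(** Each horizontal strip occupies at most one new row. *)
Lemma Kc_rows n w (rho lam : Sh n) k : 0 < Kc (hw w) rho lam ->
  (forall i, k <= i -> pt rho i = 0) -> forall i, k + size w <= i -> pt lam i = 0.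
Proof.
elim: w rho k => [|b w IH] rho k /=.
  by case: eqP => // <- _ H i; rewrite addn0; exact: H.
rewrite lt0n sum_nat_eq0 => /forallPn /= [nu].
rewrite negb_imply -lt0n => /andP[/and3P[_ /stripP st _] K] H i; rewrite addnS -addSn => l.
apply: (IH nu k.+1 K) => // -[//|j] kj.
by apply/eqP; rewrite -leqn0 -(H j kj); case: (st j).
Qed.

Lemma wt_hw w : wt (hw w) = sumn w.
Proof. by rewrite /wt /hw -map_comp map_id. Qed.

(** The first [j] strips fit in the first [j] rows by [Kc_rows], and the later ones only add
    cells. *)
Lemma Kc_dominance n w (lam : Sh n) j : 0 < Kc (hw w) (sh0 n) lam ->
  sumn (take j w) <= \sum_(i < j) pt lam i.
Proof.
rewrite -{1}(cat_take_drop j w) /hw map_cat Kc_cat lt0n sum_nat_eq0 => /forallPn /= [nu].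
rewrite muln_eq0 negb_or -!lt0n => /andP[K1 K2].
have [_ ] := KcP K1; rewrite sz_sh0 wt_hw add0n => <-.
have [sub _] := KcP K2.
have z := Kc_rows K1 (k := 0) (fun i _ => pt_sh0 n i).
rewrite szE (@sum_vanish (pt nu) n j).
- by apply: leq_sum.
- by move=> i; exact: pt_default.
- move=> i ji; apply: z; rewrite add0n (leq_trans _ ji) // size_take_min; lia.
Qed.

Lemma is_partition_rcons s b : is_partition (rcons s b) -> is_partition s.
Proof.
case/andP => so; rewrite all_rcons => /andP[_ al]; rewrite /is_partition al andbT.
case: s so {al} => //= x s; rewrite rcons_path; by case/andP.
Qed.

(** The only chain adds one full row at a time: before the last strip the shape has at most [size s]
    rows, each bounded by that of the target, and its size forces equality. *)
Lemma Kc_diag n s : is_partition s -> sumn s <= n -> Kc (hw s) (sh0 n) (shp n s) = 1.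
Proof.
elim/last_ind: s => [|s b IH] ps sn.
  by rewrite /= (_ : sh0 n == _) //; apply/eqP/pt_inj => i; rewrite pt_sh0 pt_shp // nth_nil.
have ps' := is_partition_rcons ps; have sn' : sumn s <= n.
  by move: sn; rewrite sumn_rcons; lia.
have pr i : pt (shp n s) i = nth 0 s i := pt_shp i ps' sn'.
have stp : step (b, false) (shp n s) (shp n (rcons s b)).
  rewrite /step mono_shp //= !sz_shp // sumn_rcons eqxx andbT.
  apply/stripP => i; rewrite pr !(pt_shp _ ps sn) !nth_rcons.
  have := sorted_geq_nth (partition_sorted ps) (leqnSn i); rewrite !nth_rcons.
  case: (ltngtP i (size s)) => l; first by move=> h; split.
  - by rewrite (nth_default _ (ltnW l)) => h; split.
  - by rewrite l ltnNge leqnSn /= gtn_eqF // nth_default.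
rewrite /hw map_rcons Kc_rcons (bigD1 (shp n s)) //= -/(hw s) IH // big1 // => nu.
case/andP => /and3P[_ st _] /eqP ne.
case: (posnP (Kc (hw s) (sh0 n) nu)) => // K; case: ne.
have [_] := KcP K; rewrite sz_sh0 wt_hw => sz_nu.
have z := Kc_rows K (k := 0) (fun i _ => pt_sh0 n i).
apply: sz_le_eq => [i|]; last by rewrite sz_nu sz_shp.
case: (ltnP i (size s)) => l; last by rewrite z.
by have := strip_sub i st; rewrite pr (pt_shp _ ps sn) nth_rcons l.
Qed.

(** The sum of all partial sums is strictly monotone for the dominance order, and so provides a
    numerical measure for induction along it. *)
Definition phi n (s : seq nat) := \sum_(j < n.+1) \sum_(i < j) nth 0 s i.

Lemma sum_nth_le s j : \sum_(i < j) nth 0 s i <= sumn s.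
Proof.
elim: j s => [|j IH] s; first by rewrite big_ord0.
rewrite big_ord_recl; case: s => [|x s].
  by rewrite nth_nil big1 // => i _; rewrite nth_nil.
by rewrite leq_add2l (leq_trans _ (IH s)).
Qed.

Lemma phi_le n s : sumn s <= n -> phi n s <= n.+1 * n.
Proof.
move=> sn; rewrite -[X in X * n](card_ord n.+1) -sum_nat_const; apply: leq_sum => j _.
exact: leq_trans (sum_nth_le _ _) sn.
Qed.

Lemma kostka_Kc_parts n s mu : s \in parts n ->
  kostka s mu = Kc (hw mu) (sh0 n) (shp n s).
Proof. by rewrite mem_parts => /andP[ps /eqP <-]; exact: kostka_Kc. Qed.

Lemma sumn_take s j : sumn (take j s) = \sum_(i < j) nth 0 s i.
Proof.
elim: j s => [|j IH] s; first by rewrite take0 big_ord0.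
rewrite big_ord_recl; case: s => [|x s] /=; last by rewrite IH.
by rewrite big1 // => i _; rewrite nth_nil.
Qed.

Lemma kostka_dominance n s b j : s \in parts n -> 0 < kostka s b ->
  \sum_(i < j) nth 0 b i <= \sum_(i < j) nth 0 s i.
Proof.
move=> sp; rewrite (kostka_Kc_parts _ sp) => /(Kc_dominance j); rewrite sumn_take.
move: sp; rewrite mem_parts => /andP[ps /eqP sn].
by under [in X in _ <= X]eq_bigr => i _ do rewrite pt_shp ?sn //.
Qed.

Lemma kostka_head n s b : s \in parts n -> 0 < kostka s b -> head 0 b <= head 0 s.
Proof.
by move=> sp /(kostka_dominance 1 sp); rewrite !big_ord1 !nth0.
Qed.

Lemma kostka_diag n s : s \in parts n -> kostka s s = 1.
Proof.
move=> sp; rewrite (kostka_Kc_parts _ sp); move: sp; rewrite mem_parts => /andP[ps /eqP sn].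
by rewrite Kc_diag // sn.
Qed.

Lemma kostka_phi n s b : s \in parts n -> b \in parts n -> s != b ->
  0 < kostka s b -> phi n b < phi n s.
Proof.
move=> sp bp /eqP ne K; rewrite ltnNge; apply/negP => le; apply: ne.
have H := leq_sum_eq (fun j : 'I_n.+1 => kostka_dominance j sp K) le.
move: sp bp; rewrite !mem_parts => /andP[ps /eqP sn] /andP[pb /eqP bn].
apply: partition_eq => // i; case: (ltnP i n) => [l|l].
  have := H (Ordinal (l : i.+1 < n.+1)); have := H (Ordinal (ltnW l : i < n.+1)).
  by rewrite /= !big_ord_recr /= => -> /addnI.
by rewrite !nth_default // (leq_trans (size_partition _)) ?sn ?bn.
Qed.

Section Inversion.
Local Open Scope ring_scope.

(* Unitriangularity of the Kostka matrix, restricted to the partitions with a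
   large first part, which form an upper set for the dominance order. *)
Lemma kostka_inj (V : lmodType rat) n k (x : seq nat -> V) :
  (forall b, b \in parts n -> (k <= head 0 b)%N ->
     \sum_(s <- parts n) (kostka s b)%:R *: x s = 0) ->
  forall b, b \in parts n -> (k <= head 0 b)%N -> x b = 0.
Proof.
(* Induction from the top of the dominance order. Every other [s] with [kostka s b] nonzero has a
   larger [phi] and a head at least that of [b], hence stays within the restricted range. *)
move=> H; suff Hd d : forall b, b \in parts n -> (k <= head 0 b)%N ->
    (n.+1 * n - phi n b < d)%N -> x b = 0 by move=> b bp kb; exact: (Hd _.+1).
elim: d => // d IH b bp kb lt.
have := H b bp kb; rewrite (bigD1_seq b) ?uniq_parts //= (kostka_diag bp) scale1r.
rewrite big_seq_cond big1 ?addr0 // => s /andP[sp ne].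
case: (posnP (kostka s b)) => [->|K]; first by rewrite scale0r.
have h := kostka_head sp K; have p := kostka_phi sp bp ne K.
have ps : (phi n s <= n.+1 * n)%N.
  by apply: phi_le; move: sp; rewrite mem_parts => /andP[_ /eqP ->].
by rewrite IH ?scaler0 ?(leq_trans kb) //; lia.
Qed.

(** A vector in the kernel is a family of values solving the homogeneous Kostka system, so
    [kostka_inj] with [k = 0] kills it. *)
Lemma kostkaT_unit n : kostkaT n \in unitmx.
Proof.
rewrite -unitmx_tr -row_free_unit; apply: inj_row_free => v v0.
pose x s : rat^o := if [pick p : PT n | ptseq p == s] is Some p then v 0 (enum_rank p) else 0.
have xE p : x (ptseq p) = v 0 (enum_rank p).
  by rewrite /x; case: pickP => [q /eqP/ptseq_inj -> //|/(_ p)]; rewrite eqxx.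
apply/rowP => i; rewrite mxE -[i]enum_valK -xE.
apply: (@kostka_inj _ n 0 x) => //; last exact: image_f.
move=> b /imageP[q _ ->] _; rewrite -big_PT.
have := congr1 (fun M : 'rV_#|{: PT n}| => M 0 (enum_rank q)) v0; rewrite !mxE /= => v0q.
rewrite -[RHS]v0q.
rewrite [RHS](reindex enum_rank) /=; last by apply: onW_bij; exact: enum_rank_bij.
by apply: eq_bigr => p _; rewrite !mxE !enum_rankK xE mulrC.
Qed.

Lemma KinvE n (p q : PT n) :
  Kinv n (ptseq p) (ptseq q) = invmx (kostkaT n) (enum_rank p) (enum_rank q).
Proof.
rewrite /Kinv; case: pickP => [p' /eqP/ptseq_inj ->|/(_ p)]; last by rewrite eqxx.
by case: pickP => [q' /eqP/ptseq_inj ->|/(_ q)]; last by rewrite eqxx.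
Qed.

Lemma kostka_Kinv n b b' : b \in parts n -> b' \in parts n ->
  \sum_(s <- parts n) (kostka s b)%:R * Kinv n s b' = (b == b')%:R.
Proof.
move=> /imageP[p _ ->] /imageP[q _ ->]; rewrite -big_PT (inj_eq (@ptseq_inj n)).
have := congr1 (fun M : 'M_#|{: PT n}| => M (enum_rank p) (enum_rank q)) (mulmxV (kostkaT_unit n)).
rewrite !mxE (inj_eq enum_rank_inj) => <-.
rewrite [RHS](reindex enum_rank) /=; last by apply: onW_bij; exact: enum_rank_bij.
by apply: eq_bigr => r _; rewrite !mxE !enum_rankK KinvE.
Qed.

Variables (V : lmodType rat) (th : seq nat -> V).

(* [tilde_at k] is [tildes] computed at level [n = 2k+1] for all partitions of size
   at most [k] simultaneously. *)
Definition tilde_at k (s : seq nat) : V :=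
  let n := (2 * k).+1 in
  \sum_(b <- parts n | (n - k <= head 0 b)%N) Kinv n s b *: th (behead b).

(** Multiplication by the Kostka matrix undoes [Kinv], for those [b] that the truncated sum in
    [tilde_at] keeps. *)
Lemma kostka_tilde_at k b : let n := (2 * k).+1 in b \in parts n -> (n - k <= head 0 b)%N ->
  \sum_(s <- parts n) (kostka s b)%:R *: tilde_at k s = th (behead b).
Proof.
move=> n bp kb; rewrite /tilde_at -/n.
under eq_bigr => s _ do rewrite scaler_sumr.
rewrite exchange_big /= big_mkcond (bigD1_seq b) ?uniq_parts //= kb.
under eq_bigr => s _ do rewrite scalerA.
rewrite -scaler_suml kostka_Kinv // eqxx scale1r big_seq_cond big1 ?addr0 //.
move=> b' /andP[b'p ne]; case: ifP => // _; under eq_bigr => s _ do rewrite scalerA.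
by rewrite -scaler_suml kostka_Kinv // eq_sym (negPf ne) scale0r.
Qed.

Lemma is_partition_cons a l : is_partition l -> (0 < a)%N -> (nth 0 l 0 <= a)%N ->
  is_partition (a :: l).
Proof.
by move=> /andP[so al] a0 h; rewrite /is_partition /= a0 al andbT; case: l so h {al} => //= x l -> ->.
Qed.

Lemma is_partition_behead l : is_partition l -> is_partition (behead l).
Proof.
case: l => // a l /andP[/= p /andP[_ al]].
by rewrite /is_partition al (path_sorted p).
Qed.

(** When the first part is at least half of the total, the other parts cannot exceed it, so no
    comparison between [a] and [l] is needed. *)
Lemma mem_parts_cons n a l : (n <= a + a)%N -> (0 < a)%N ->
  ((a :: l) \in parts n) = is_partition l && (a + sumn l == n)%N.
Proof.
move=> na a0; rewrite mem_parts /=; apply/andP/andP => [[/is_partition_behead]//|[pl /eqP e]].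
split; last exact/eqP; apply: is_partition_cons => //.
by apply: leq_trans (nth_le_sumn _ _) _; lia.
Qed.

Lemma parts_cons n b : b \in parts n -> (0 < n)%N ->
  b = head 0 b :: behead b /\ (sumn (behead b) = n - head 0 b)%N.
Proof.
rewrite mem_parts => /andP[_ /eqP <-]; case: b => //= a l _; by rewrite addKn.
Qed.

Lemma parts_large_head n k (F : seq nat -> V) : (2 * k < n)%N ->
  \sum_(b <- parts n | (n - k <= head 0 b)%N) F b =
  \sum_(j < k.+1) \sum_(m <- parts j) F ((n - j)%N :: m).
Proof.
move=> kn; rewrite -big_filter -(big_mkord xpredT (fun j => \sum_(m <- parts j) F ((n - j)%N :: m))).
rewrite -(big_allpairs_dep (h := fun j m => (n - j)%N :: m) (r2 := parts)).
apply: perm_big; apply: uniq_perm.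
- by rewrite filter_uniq // uniq_parts.
- apply: allpairs_uniq_dep; [exact: iota_uniq | by move=> j _; exact: uniq_parts |].
  move=> [j m] [j' m'] /allpairsPdep[i [l [ii il [-> ->]]]].
  move=> /allpairsPdep[i' [l' [ii' il' [-> ->]]]] [] /= e ->.
  by move: ii ii' il il'; rewrite !mem_index_iota => ? ? _ _; congr existT; lia.
- move=> b; rewrite mem_filter; apply/andP/allpairsPdep => [[h bp]|].
    have n0 : (0 < n)%N by lia.
    have [e sb] := parts_cons bp n0.
    exists (n - head 0 b)%N, (behead b); split.
    + by rewrite mem_index_iota; lia.
    + move: bp; rewrite !mem_parts => /andP[pb _]; rewrite sb eqxx andbT.
      exact: is_partition_behead.
    + rewrite subKn //; move: bp; rewrite mem_parts => /andP[_ /eqP <-].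
      by rewrite e /= leq_addr.
  move=> [j [m [jk mp ->]]] /=; move: jk mp; rewrite mem_index_iota mem_parts => jk /andP[pm /eqP sm].
  split; first lia.
  rewrite mem_parts_cons; [rewrite pm /= sm| |]; lia.
Qed.

Definition lift_head d (s : seq nat) := (head 0 s + d)%N :: behead s.

Lemma nth_lift_head d s i : nth 0 (lift_head d s) i = shift_head d (nth 0 s) i.
Proof. by rewrite /lift_head /shift_head; case: i s => [|i] [|x s] //=; rewrite ?nth_nil ?addn0 ?mul1n. Qed.

Lemma emb_shp n1 n2 d s : (n1 <= n2)%N -> (0 < n2)%N -> s \in parts n1 -> (n1 + d <= n2)%N ->
  is_partition (lift_head d s) -> sumn (lift_head d s) = n2 ->
  emb n2 d (shp n1 s) = shp n2 (lift_head d s).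
Proof.
move=> le n0; rewrite mem_parts => /andP[ps /eqP sn] dn pl sl; apply: pt_inj => i.
have pE j : pt (shp n1 s) j = nth 0 s j by rewrite pt_shp ?sn.
rewrite pt_emb ?pE ?pt_shp ?sl //; last by rewrite (leq_trans _ dn) // leq_add2r -sn nth_le_sumn.
by rewrite nth_lift_head /shift_head pE.
Qed.

Definition row_shape n b : Sh n := sh_of n (fun i => (i == 0) * b)%N.

Lemma pt_row n b i : (b <= n)%N -> pt (row_shape n b) i = ((i == 0) * b)%N.
Proof.
move=> bn; rewrite pt_sh_of //; first by case: i => [|i]; rewrite ?mul1n.
by case: i => // ni; move: bn ni; rewrite mul1n; lia.
Qed.

Lemma sz_row n b : (b <= n)%N -> sz (row_shape n b) = b.
Proof.
move=> bn; rewrite szE (eq_bigr _ (fun (i : 'I_n) _ => pt_row i bn)).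
case: n bn => [|n bn]; first by rewrite leqn0 big_ord0 => /eqP.
by rewrite big_ord_recl mul1n big1 ?addn0.
Qed.

Lemma mono_row n b : (b <= n)%N -> mono (row_shape n b).
Proof. by move=> bn; apply/monoP => i; rewrite !pt_row. Qed.

Lemma pt_le_sz n (lam : Sh n) i : (pt lam i <= sz lam)%N.
Proof.
case: (ltnP i n) => [l|l]; last by rewrite pt_default.
by rewrite szE (bigD1 (Ordinal l)) //= leq_addr.
Qed.

Lemma Kc_row n b w (lam : Sh n) : (b <= n)%N ->
  Kc ((b, false) :: w) (sh0 n) lam = Kc w (row_shape n b) lam.
Proof.
move=> bn /=; rewrite (big_pred1 (row_shape n b)) // => nu; apply/and3P/eqP => [[m st /eqP s]|->].
  have z i : pt nu i.+1 = 0%N.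
    by apply/eqP; rewrite -leqn0 -(pt_sh0 n i); have /stripP/(_ i)[] := st.
  apply: sz_le_eq => [[|i]|]; rewrite ?sz_row ?pt_row ?z // ?s ?sz_sh0 // mul1n.
  by have := pt_le_sz nu 0; rewrite s sz_sh0.
rewrite /step mono_row // sz_row // sz_sh0 eqxx; split=> //.
by apply/stripP => i; rewrite !pt_row // !pt_sh0.
Qed.

Lemma parts_lift_head n k d s : (2 * k < n)%N -> s \in parts n -> (n - k <= head 0 s)%N ->
  lift_head d s \in parts (n + d).
Proof.
move=> kn sp ks; have [e sb] := parts_cons sp (leq_ltn_trans (leq0n _) kn).
rewrite /lift_head mem_parts_cons; try lia.
move: sp; rewrite mem_parts => /andP[ps /eqP sn]; rewrite is_partition_behead // sb.
have : (head 0 s <= n)%N by rewrite -sn e /= leq_addr.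
lia.
Qed.

(** After its first strip a chain stands at a row of length [head 0 b]. The second row of [s] is at
    most [k], hence at most [head 0 b], so [Kc_emb] applies to the rest of the chain. *)
Lemma kostka_lift_head n k d s b : (2 * k < n)%N -> s \in parts n -> b \in parts n ->
  (n - k <= head 0 s)%N -> (n - k <= head 0 b)%N ->
  kostka (lift_head d s) (lift_head d b) = kostka s b.
Proof.
move=> kn sp bp ks kb; have n0 : (0 < n)%N := leq_ltn_trans (leq0n _) kn.
have nd0 : (0 < n + d)%N by rewrite addn_gt0 n0.
have lp := parts_lift_head d kn sp ks.
rewrite (kostka_Kc_parts _ lp) (kostka_Kc_parts _ sp).
have [e _] := parts_cons bp n0; have [es ss] := parts_cons sp n0.
have hn x : x \in parts n -> (head 0 x <= n)%N.
  by move=> xp; have [ex _] := parts_cons xp n0; move: xp; rewrite mem_parts => /andP[_ /eqP <-];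
     rewrite ex /= leq_addr.
have hb := hn _ bp; have hs := hn _ sp.
have -> : hw b = (head 0 b, false) :: hw (behead b) by rewrite {1}e.
rewrite [hw (lift_head d b)]/= -/(hw _) !Kc_row ?leq_add2r //.
have <- : emb (n + d) d (row_shape n (head 0 b)) = row_shape (n + d) (head 0 b + d).
  apply: pt_inj => i; rewrite pt_emb ?leq_addr // !pt_row ?leq_add2r // ?mul1n ?leq_add2r //.
  by rewrite /shift_head pt_row // -mulnDr.
move: (lp); rewrite mem_parts => /andP[plp /eqP slp].
rewrite -(emb_shp (leq_addr d n) nd0 sp (leqnn _) plp slp).
move: (sp); rewrite mem_parts => /andP[ps /eqP sn].
rewrite Kc_emb ?leq_addr // ?pt_row // ?pt_shp ?sn // ?mul1n ?leq_add2r // ?nth0 //.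
by rewrite -nth_behead (leq_trans (nth_le_sumn _ _)) // ss (leq_trans _ kb) // (leq_trans (leq_sub2l n ks)) //; lia.
Qed.

(** Both families solve the same unitriangular system, since lifting the heads preserves Kostka
    numbers and the right-hand sides [th (behead b)]; [kostka_inj] gives uniqueness. *)
Lemma tilde_at_stable k D s : (k <= D)%N -> s \in parts (2 * k).+1 ->
  ((2 * k).+1 - k <= head 0 s)%N -> tilde_at k s = tilde_at D (lift_head (2 * D - 2 * k) s).
Proof.
move=> kD sp ks; set n := (2 * k).+1; set d := (2 * D - 2 * k)%N.
have kn : (2 * k < n)%N by [].
have nd : (n + d)%N = (2 * D).+1 by rewrite /n /d; lia.
apply/eqP; rewrite -subr_eq0; apply/eqP.
apply: (@kostka_inj _ n (n - k) (fun s => tilde_at k s - tilde_at D (lift_head d s))) => // b bp kb.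
under eq_bigr => r _ do rewrite scalerBr.
rewrite sumrB kostka_tilde_at //; apply/eqP; rewrite subr_eq0; apply/eqP.
have bp' := parts_lift_head d kn bp kb; rewrite nd in bp'.
have kb' : (n + d - k <= head 0 (lift_head d b))%N by rewrite /=; lia.
have kb'' : ((2 * D).+1 - D <= head 0 (lift_head d b))%N.
  by rewrite /=; move: kb; rewrite /n /d; lia.
(* A nonzero Kostka number forces a head at least that of [lift_head d b], and the partitions with
   so large a head are precisely the lifts. *)
transitivity (\sum_(r <- parts (n + d) | (n + d - k <= head 0 r)%N)
    (kostka r (lift_head d b))%:R *: tilde_at D r); last first.
  rewrite -big_filter (perm_big [seq lift_head d r | r <- parts n & (n - k <= head 0 r)%N]).
    rewrite big_map big_filter [LHS]big_seq_cond [RHS](bigID (fun r => n - k <= head 0 r)%N) /=.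
    rewrite [X in _ = _ + X]big_seq_cond [X in _ = _ + X]big1 ?addr0 => [|r /andP[rp h]].
      rewrite [RHS]big_seq_cond; apply: eq_bigr => r /andP[rp h].
      by rewrite (kostka_lift_head _ kn).
    case: (posnP (kostka r b)) => [->|/(kostka_head rp)]; first by rewrite scale0r.
    by move: h kb; lia.
  have n0 : (0 < n)%N by [].
  apply: uniq_perm; first by rewrite filter_uniq // uniq_parts.
    rewrite map_inj_in_uniq ?filter_uniq ?uniq_parts // => x y.
    rewrite !mem_filter => /andP[_ /parts_cons/(_ n0)[ex _]] /andP[_ /parts_cons/(_ n0)[ey _]].
    by move=> [] /addIn e1 e2; rewrite ex ey e1 e2.
  move=> r; rewrite mem_filter; apply/andP/mapP => [[h rp]|[x]]; last first.
    rewrite mem_filter => /andP[h xp] ->; split; last exact: (parts_lift_head d kn).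
    by rewrite /=; lia.
  have nd0 : (0 < n + d)%N by [].
  have [er sr] := parts_cons rp nd0.
  have hr : (head 0 r <= n + d)%N.
    by move: rp; rewrite mem_parts => /andP[_ /eqP <-]; rewrite er /= leq_addr.
  have hd : (n - k <= head 0 r - d)%N by lia.
  exists ((head 0 r - d)%N :: behead r); last by rewrite /lift_head /= subnK //; lia.
  rewrite mem_filter hd /= mem_parts_cons; try lia.
  move: rp; rewrite mem_parts => /andP[/is_partition_behead -> _] /=; rewrite sr; lia.
rewrite -[th _]/(th (behead (lift_head d b))) -(kostka_tilde_at bp' kb'') nd.
rewrite [LHS](bigID (fun r => (2 * D).+1 - k <= head 0 r)%N) /= [X in _ + X]big_seq_cond.
rewrite [X in _ + X]big1 ?addr0 // => r /andP[rp h].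
case: (posnP (kostka r (lift_head d b))) => [->|/(kostka_head rp)]; first by rewrite scale0r.
by move: h kb'; rewrite nd; lia.
Qed.

End Inversion.

Lemma tildes_tilde_at N (th : seq nat -> {mpoly rat[N]}) D l : is_partition l -> sumn l <= D ->
  tildes th l = tilde_at th D (((2 * D).+1 - sumn l) :: l).
Proof.
move=> pl lD; set k := sumn l.
have kp : (((2 * k).+1 - k) :: l) \in parts (2 * k).+1.
  rewrite mem_parts_cons ?pl /=; rewrite -/k; lia.
transitivity (tilde_at th k (((2 * k).+1 - k) :: l)); last first.
  rewrite (tilde_at_stable th lD kp) //; congr tilde_at; congr cons; rewrite /=; rewrite -/k; lia.
rewrite /tildes /tilde_at -/k parts_large_head //; apply: eq_bigr => j _.
exact: (big_PT j (fun m => Kinv _ _ (((2 * k).+1 - j)%N :: m) *: th m)%R).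
Qed.

(** * Generating function of multiset partitions *)

Section GeneratingFunction.
Local Open Scope ring_scope.
Variables (A : comNzRingType) (R D : nat) (X : bool -> nat -> A).
Hypothesis X0 : forall p, X p 0 = 1.
Hypothesis Xrel : forall p n, (0 < n <= D)%N ->
  \sum_(i < n.+1) (-1) ^+ i * X p (n - i) * X (~~ p) i = 0.
Local Notation P := {mpoly A[R]}.

(** Replaces power series modulo an ideal: identities are claimed only for the coefficients in [S],
    and closure of [S] under divisors makes this compatible with products. *)
Definition eqS (S : pred 'X_{1..R}) (p q : P) := forall m, S m -> p@_m = q@_m.
Definition closedS (S : pred 'X_{1..R}) := forall m1 m2, S (m1 + m2)%MM -> S m1.

Lemma eqS_trans S p q r : eqS S p q -> eqS S q r -> eqS S p r.
Proof. by move=> h1 h2 m Sm; rewrite h1 // h2. Qed.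

Lemma eqSD S p p' q q' : eqS S p p' -> eqS S q q' -> eqS S (p + q) (p' + q').
Proof. by move=> h1 h2 m Sm; rewrite !mcoeffD h1 // h2. Qed.

Lemma eqSM S p p' q q' : closedS S -> eqS S p p' -> eqS S q q' -> eqS S (p * q) (p' * q').
Proof.
move=> cS h1 h2 m Sm; rewrite !mcoeffM; apply: eq_bigr => k /eqP e.
have S1 : S k.1 by apply: (cS _ k.2); rewrite -e.
have S2 : S k.2 by apply: (cS _ k.1); rewrite addmC -e.
by rewrite h1 // h2.
Qed.

Lemma eqS_prod S (I : finType) (Q : pred I) (f g : I -> P) : closedS S ->
  (forall i, Q i -> eqS S (f i) (g i)) -> eqS S (\prod_(i | Q i) f i) (\prod_(i | Q i) g i).
Proof.
move=> cS H; apply: (big_ind2 (eqS S)) => //.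
by move=> *; apply: eqSM.
Qed.

Lemma eqS_prod1 S (I : finType) (Q : pred I) (f : I -> P) : closedS S ->
  (forall i, Q i -> eqS S (f i) 1) -> eqS S (\prod_(i | Q i) f i) 1.
Proof.
by move=> cS H; apply: eqS_trans (eqS_prod cS H) _; rewrite big1.
Qed.

Lemma eqS_X0 S m c : ~~ S m -> eqS S (c *: 'X_[m]) 0.
Proof.
move=> nS k kS; rewrite mcoeffZ mcoeffX mcoeff0; case: eqP => [e|_]; last exact: mulr0.
by move: nS; rewrite e kS.
Qed.

Definition Xp p : {poly P} := \poly_(k < D.+1) (X p k)%:MP.
Definition Xs p (q : P) : P := (Xp p).[q].

Lemma XsE p q : Xs p q = \sum_(k < D.+1) X p k *: q ^+ k.
Proof. by rewrite /Xs horner_poly; apply: eq_bigr => k _; rewrite mul_mpolyC. Qed.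

(** [Xrel] says that the product is [1] up to degree [D] in the argument; what remains is a multiple
    of [q ^+ D.+1], which vanishes on [S]. *)
Lemma Xs_inv S p q : closedS S -> eqS S (q ^+ D.+1) 0 ->
  eqS S (Xs p q * Xs (~~ p) (- q)) 1.
Proof.
move=> cS q0; pose Y : {poly P} := \poly_(k < D.+1) ((-1) ^+ k * X (~~ p) k)%:MP.
have -> : Xs (~~ p) (- q) = Y.[q].
  rewrite /Xs !horner_poly; apply: eq_bigr => k _.
  rewrite !mul_mpolyC (exprNn q) -[in LHS]signr_odd -[in RHS]signr_odd.
  by case: (odd k); rewrite ?expr1 ?expr0 ?mulN1r ?mul1r ?scalerN ?scaleNr.
rewrite -hornerM -(poly_take_drop D.+1 (Xp p * Y)) hornerD hornerM hornerXn.
have -> : take_poly D.+1 (Xp p * Y) = 1.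
  apply/polyP => n; rewrite coef_take_poly coef1; case: ifP => nD; last by case: n nD.
  rewrite coefMr; case: n nD => [_|n nD].
    by rewrite big_ord1 !coef_poly /= !X0 mulr1 mul1r.
  rewrite -[RHS](mpolyC0 R A) -(Xrel p (n := n.+1)); last by lia.
  rewrite rmorph_sum; apply: eq_bigr => i _ /=.
  have h1 : (n.+1 - i < D.+1)%N := leq_ltn_trans (leq_subr i n.+1) nD.
  have h2 : (i < D.+1)%N := leq_ltn_trans (leq_ord i) nD.
  rewrite !coef_poly h1 h2.
  by rewrite -mpolyCM mulrCA mulrA.
rewrite hornerC -[X in eqS S _ X]addr0; apply: eqSD => //.
by rewrite -(mulr0 (drop_poly D.+1 (Xp p * Y)).[q]); apply: eqSM.
Qed.

Lemma Xs_1 S p q : closedS S -> eqS S q 0 -> eqS S (Xs p q) 1.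
Proof.
move=> cS q0; rewrite XsE big_ord_recl X0 scale1r expr0 -[X in eqS S _ X]addr0.
apply: eqSD => //; elim/big_ind: _ => // [p1 p2 h1 h2|i _].
  by rewrite -[X in eqS S _ X]addr0; apply: eqSD.
by rewrite -mul_mpolyC exprS mulrCA -(mul0r ((X p (lift ord0 i))%:MP * q ^+ i)); apply: eqSM.
Qed.

Notation Bk := {ffun 'I_R -> 'I_D.+1}.
Definition mB (B : Bk) : 'X_{1..R} := [multinom (B i : nat) | i < R].

(* Variables of type [Some false] generate complete functions, those of type
   [Some true] elementary ones; variables of type [None] are absent. *)
Definition allowed (tau : 'I_R -> option bool) (B : Bk) : bool :=
  [forall i, match tau i with
             | None => (B i : nat) == 0%N
             | Some true => (B i <= 1)%N
             | Some false => true end] && [exists i, (0 < B i)%N].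

Definition par (tau : 'I_R -> option bool) (B : Bk) : bool :=
  odd (\sum_(i | tau i == Some true) B i).

Definition GF (tau : 'I_R -> option bool) : P :=
  \prod_(B | allowed tau B) Xs (par tau B) 'X_[mB B].

Definition below (m : 'X_{1..R}) : pred 'X_{1..R} := fun k => (k <= m)%MM.

Lemma below_closed m : closedS (below m).
Proof.
move=> m1 m2 /mnm_lepP h; apply/mnm_lepP => i; apply: leq_trans (h i).
by rewrite mnmDE leq_addr.
Qed.

(** The nonconstant terms of a factor are multiples of its block's monomial; if this does not divide
    [m], the factor is [1] on the divisors of [m]. *)
Lemma GF_restrict (Q : pred Bk) tau m :
  (forall B, allowed tau B -> (mB B <= m)%MM -> Q B) ->
  eqS (below m) (GF tau) (\prod_(B | allowed tau B && Q B) Xs (par tau B) 'X_[mB B]).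
Proof.
move=> H; rewrite /GF (bigID Q) /= -[X in eqS _ _ X]mulr1.
apply: (eqSM (@below_closed m)) => //; apply: (eqS_prod1 (@below_closed m)) => B /andP[al nQ].
apply: (Xs_1 _ (@below_closed m)); rewrite -[X in eqS _ X]scale1r; apply: eqS_X0.
by apply: contra nQ; exact: H.
Qed.

(** A variable of exponent zero in [m] occurs in no block dividing [m]. An idle variable may
    therefore be declared complete. *)
Lemma GF_type_irrelevant (tau tau' : 'I_R -> option bool) (m : 'X_{1..R}) : (forall i, (0 < m i)%N -> tau i = tau' i) ->
  (GF tau)@_m = (GF tau')@_m.
Proof.
move=> E; have mm : below m m by exact: lepm_refl.
have restr t := @GF_restrict (fun B => (mB B <= m)%MM) t m (fun B _ h => h) _ mm.
rewrite !restr.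
have z B i : (mB B <= m)%MM -> tau i <> tau' i -> B i = 0%N :> nat.
  move=> /mnm_lepP/(_ i); rewrite mnmE => h ne.
  by case: (posnP (m i)) => [e|/E //]; apply/eqP; rewrite -leqn0 -e.
have oeq (a b : option bool) : a = b \/ a <> b by case: (a =P b); [left|right].
congr (_ @_ m); apply: eq_big => [B|B /andP[_ le]].
  case le: (mB B <= m)%MM; rewrite ?andbF ?andbT //; congr (_ && _).
  apply/forallP/forallP => H i; have := H i; case: (oeq (tau i) (tau' i)) => [-> //|/(z _ _ le) ->];
    by case: (tau i) => [[]|]; case: (tau' i) => [[]|].
congr (Xs (odd _) _); rewrite [LHS]big_mkcond [RHS]big_mkcond; apply: eq_bigr => i _.
by case: (oeq (tau i) (tau' i)) => [-> //|/(z _ _ le) ->]; do 2!case: ifP.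
Qed.

(** The map [ext] lets the blocks that matter be indexed by a convenient type: multiplicity vectors
    on a list in one use, sets in another. *)
Lemma GF_coef (Y : finType) (ext : Y -> Bk) tau (m : 'X_{1..R}) : injective ext ->
  (forall B, allowed tau B -> (mB B <= m)%MM -> exists y, B = ext y) ->
  (GF tau)@_m = \sum_(M : {ffun Y -> 'I_D.+1} |
      [forall y, (0 < M y)%N ==> allowed tau (ext y)] &&
      [forall i, \sum_y (M y * ext y i)%N == m i])
    \prod_y X (par tau (ext y)) (M y).
Proof.
move=> inj cov; have mm : below m m by exact: lepm_refl.
rewrite (@GF_restrict (fun B => B \in codom ext) tau m _ _ mm); last first.
  by move=> B al /(cov _ al)[y ->]; exact: codom_f.
have -> : \prod_(B | allowed tau B && (B \in codom ext)) Xs (par tau B) 'X_[mB B] =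
    \prod_(y | allowed tau (ext y)) Xs (par tau (ext y)) 'X_[mB (ext y)].
  transitivity (\prod_(B <- codom ext | allowed tau B) Xs (par tau B) 'X_[mB B]); last first.
    by rewrite big_map big_enum_cond.
  rewrite -big_filter -[RHS]big_filter; apply: perm_big.
  apply: uniq_perm; rewrite ?filter_uniq ?index_enum_uniq //.
    by rewrite map_inj_uniq ?enum_uniq.
  by move=> B; rewrite !mem_filter mem_index_enum andbT.
rewrite big_mkcond /=.
(* A block that is not allowed receives a factor reduced to its term [k = 0], so that expanding the
   product runs over all multiplicity functions on [Y]. *)
pose G y (k : 'I_D.+1) : P := if (0 < k)%N ==> allowed tau (ext y)
   then X (par tau (ext y)) k *: 'X_[mB (ext y) *+ k] else 0.
rewrite (eq_bigr (fun y => \sum_k G y k)) => [|y _]; last first.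
  rewrite /G; case: ifP => al.
    by rewrite XsE; apply: eq_bigr => k _; rewrite implybT mpolyXn.
  by rewrite big_ord_recl /= X0 mulm0n mpolyX0 scale1r big1 ?addr0 //.
rewrite bigA_distr_bigA /= raddf_sum /= [RHS]big_mkcond /=; apply: eq_bigr => M _.
case: (boolP [forall y, _]) => [/forallP al|/forallPn[y ny]]; last first.
  by rewrite (bigD1 y) //= /G (negPf ny) mul0r mcoeff0.
rewrite (eq_bigr (fun y => (X (par tau (ext y)) (M y))%:MP * 'X_[mB (ext y) *+ M y])); last first.
  by move=> y _; rewrite /G al mul_mpolyC.
rewrite big_split /= -rmorph_prod /= mul_mpolyC mcoeffZ mprodXE mcoeffX.
rewrite (_ : _ == m = [forall i, \sum_y (M y * ext y i)%N == m i]); last first.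
  apply/eqP/forallP => [<- i|H].
    by rewrite mnm_sumE; apply/eqP; apply: eq_bigr => y _; rewrite mulmnE mnmE mulnC.
  apply/mnmP => i; rewrite mnm_sumE -(eqP (H i)).
  by apply: eq_bigr => y _; rewrite mulmnE mnmE mulnC.
by case: ifP; rewrite ?mulr1 ?mulr0.
Qed.

(** * The substitution of [- y] for [z] *)

Section Substitution.
Variables (y z : 'I_R).
Hypothesis yz : y != z.

Definition negvar : R.-tuple P := [tuple if i == z then - 'X_y else 'X_i | i < R].

Definition merge (m : 'X_{1..R}) : 'X_{1..R} :=
  [multinom if i == y then (m y + m z)%N else if i == z then 0%N else m i | i < R].

Definition transfer (m : 'X_{1..R}) (k : nat) : 'X_{1..R} :=
  [multinom if i == y then (m y - k)%N else if i == z then k else m i | i < R].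

Lemma negvarX m : 'X_[m] \mPo negvar = (-1) ^+ m z *: 'X_[merge m].
Proof.
rewrite comp_mpolyX mpolyXE_id (bigD1 z) //= [X in _ = _ *: X](bigD1 z) //= .
rewrite (bigD1 y) //= [X in _ = _ *: (_ * X)](bigD1 y) //=.
rewrite !tnth_mktuple eqxx (negPf yz) !mnmE eqxx eq_sym (negPf yz) eqxx expr0 mul1r.
rewrite (exprNn 'X_y) -[in LHS]signr_odd -[in RHS]signr_odd.
set T := (X in _ * (_ * X) = _); set T' := (X in _ = _ *: (_ * X)).
have -> : T = T'.
  apply: eq_bigr => i /andP[iz iy].
  by rewrite tnth_mktuple (negPf iz) mnmE (negPf iy) (negPf iz).
have E : 'X_y ^+ m z * ('X_y ^+ m y * T') = 'X_y ^+ (m y + m z) * T'.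
  by rewrite exprD mulrCA mulrA.
by case: (odd _); rewrite ?expr1 ?expr0 ?scale1r ?scaleN1r ?mulN1r ?mul1r ?mulNr E.
Qed.

Lemma merge_eq (m m' : 'X_{1..R}) : m z = 0%N ->
  (merge m' == m) = (m' z <= m y)%N && (m' == transfer m (m' z)).
Proof.
move=> mz; apply/eqP/andP => [<-|[le /eqP e]].
  rewrite !mnmE eqxx leq_addl; split=> //; apply/eqP/mnmP => i; rewrite !mnmE eqxx addnK.
  by case: (i =P y) => [->|_] //; case: (i =P z) => [->|].
apply/mnmP => i; rewrite !mnmE; case: (i =P y) => [->|ny].
  by rewrite e !mnmE eqxx eq_sym (negPf yz) eqxx subnK.
case: (i =P z) => [->//|nz].
by rewrite e mnmE; case: eqP => // _; case: eqP.
Qed.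

(** The substitution is chosen for this formula: when [y] is elementary and [z] complete, it has the
    form of the relation [sum_k (-1)^k e_(a-k) h_k = 0]. *)
Lemma coef_negvar (p : P) (m : 'X_{1..R}) : m z = 0%N ->
  (p \mPo negvar)@_m = \sum_(k < (m y).+1) (-1) ^+ k * p@_(transfer m k).
Proof.
move=> mz; rewrite comp_mpolyEX raddf_sum /=.
transitivity (\sum_(k < (m y).+1) \sum_(m' <- msupp p)
    (-1) ^+ k * (p@_m' * (m' == transfer m k)%:R)); last first.
  apply: eq_bigr => k _; rewrite -mulr_sumr; congr (_ * _); rewrite [in RHS](mpolyE p) raddf_sum /=.
  by apply: eq_bigr => m' _; rewrite mcoeffZ mcoeffX.
rewrite exchange_big /=; apply: eq_bigr => m' _.
rewrite mcoeffZ negvarX mcoeffZ mcoeffX merge_eq //.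
have tz k : transfer m k z = k by rewrite mnmE eq_sym (negPf yz) eqxx.
have [le|gt] := leqP (m' z) (m y) => /=; last first.
  rewrite !mulr0 big1 // => k _; case: eqP => [e|]; last by rewrite !mulr0.
  by move: gt (ltn_ord k); rewrite e tz ltnS ltnNge => /negPf ->.
rewrite (bigD1 (Ordinal (le : (m' z < (m y).+1)%N))) //= big1 ?addr0 => [|k /eqP nk].
  by rewrite mulrCA.
case: eqP => [e|]; last by rewrite !mulr0.
by case: nk; apply: val_inj; rewrite /= e tz.
Qed.

Definition drop2 (tau : 'I_R -> option bool) i :=
  if (i == y) || (i == z) then None else tau i.

Definition small : pred 'X_{1..R} := fun m => (mdeg m <= D)%N.

Lemma small_closed : closedS small.
Proof. by move=> m1 m2; rewrite /small mdegD; apply: leq_trans; rewrite leq_addr. Qed.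

Lemma merge_deg m : mdeg (merge m) = mdeg m.
Proof.
rewrite !mdegE (bigD1 y) //= [RHS](bigD1 y) //= (bigD1 z) 1?eq_sym //=.
rewrite [in RHS](bigD1 z) 1?eq_sym //= !mnmE eqxx (eq_sym z) (negPf yz) eqxx add0n -addnA.
congr (_ + (_ + _))%N; apply: eq_bigr => i /andP[/negPf iy /negPf iz].
by rewrite mnmE iy iz.
Qed.

Let f tau (B : Bk) : P := Xs (par tau B) ('X_[mB B] \mPo negvar).

Lemma comp_GF tau : GF tau \mPo negvar = \prod_(B | allowed tau B) f tau B.
Proof.
rewrite /GF rmorph_prod /=; apply: eq_bigr => B _; rewrite /f !XsE rmorph_sum /=.
by apply: eq_bigr => k _; rewrite linearZ /= rmorphXn.
Qed.

Lemma factor_large tau (B : Bk) : (D < mdeg (mB B))%N -> eqS small (f tau B) 1.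
Proof.
move=> lt; apply: (Xs_1 _ small_closed); rewrite negvarX; apply: eqS_X0.
by rewrite /small merge_deg -ltnNge.
Qed.

Let shiftB (B : Bk) : Bk :=
  [ffun i => if i == y then inord 1 else if i == z then inord (B z).-1 else B i].
Let unshiftB (B : Bk) : Bk :=
  [ffun i => if i == y then inord 0 else if i == z then inord (B z).+1 else B i].

(* A block [B] with [B y = 0] and [B z = b.+1] cancels against the block with
   [B y = 1] and [B z = b]: they contribute [X_p(u)] and [X_(~~p)(-u)]. *)
Lemma factor_cancel tau (B : Bk) : (0 < D)%N -> tau y = Some true -> tau z = Some false ->
  B y = 0%N :> nat -> (0 < B z)%N ->
  eqS small (f tau B * f tau (shiftB B)) 1.
Proof.
move=> D0 ty tz By Bz.
have sy : shiftB B y = 1%N :> nat by rewrite ffunE eqxx inordK.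
have sz' : shiftB B z = (B z).-1 :> nat.
  rewrite ffunE eq_sym (negPf yz) eqxx inordK //.
  by apply: leq_ltn_trans (ltn_ord (B z)); exact: leq_pred.
have so i : i != y -> i != z -> shiftB B i = B i.
  by move=> /negPf iy /negPf iz; rewrite ffunE iy iz.
have -> : f tau (shiftB B) = Xs (~~ par tau B) (- ('X_[mB B] \mPo negvar)).
  rewrite /f; congr (Xs _ _).
    rewrite /par (bigD1 y) ?ty //= sy oddD /= [in RHS](bigD1 y) ?ty //= By; congr (~~ odd _).
    apply: eq_bigr => i /andP[/eqP ti iy]; rewrite so //.
    by apply/eqP => e; move: ti; rewrite e tz.
  rewrite !negvarX !mnmE sz' -scaleNr; congr (_ *: 'X_[_]).
    by rewrite -[in RHS](prednK Bz) exprS mulN1r opprK.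
  apply/mnmP => i; rewrite !mnmE sy sz' By add0n add1n prednK //.
  by case: eqP => // /eqP iy; case: eqP => // /eqP iz; rewrite so.
apply: (Xs_inv _ small_closed).
rewrite negvarX exprZn mpolyXn; apply: eqS_X0.
rewrite /small mdegMn merge_deg -ltnNge.
by apply: leq_pmull; rewrite mdegE (bigD1 z) //= mnmE addn_gt0 Bz.
Qed.

(** Blocks without [y] and [z] give the right-hand side. Those with [B y = 0] and [B z > 0] are
    matched by [shiftB] with those having [B y = 1] and [B z < D], each pair giving [1]. Those with
    [B y = 1] and [B z = D] are left. *)
Lemma GF_cancel tau : (0 < D)%N -> tau y = Some true -> tau z = Some false ->
  eqS small (GF tau \mPo negvar) (GF (drop2 tau)).
Proof.
move=> D0 ty tz; rewrite comp_GF (bigID (fun B : Bk => (B y : nat) == 0%N)) /=.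
rewrite (bigID (fun B : Bk => (B z : nat) == 0%N)) /=.
rewrite [X in _ * _ * X](bigID (fun B : Bk => (B z : nat) == D)) /=.
have zy : z == y = false by rewrite eq_sym; exact: negPf.
pose ok i (B : Bk) := match tau i with
  | None => (B i : nat) == 0%N | Some true => (B i <= 1)%N | Some false => true end.
(* The partner of such a block would have exponent [D.+1] in [z], out of range; but its own degree
   already exceeds [D], so its factor is [1] on [small]. *)
have p3 : eqS small (\prod_(B | allowed tau B && ((B y : nat) != 0%N) && ((B z : nat) == D)) f tau B) 1.
  apply: (eqS_prod1 small_closed) => B /andP[/andP[_ By] /eqP Bz]; apply: factor_large.
  by rewrite mdegE (bigD1 y) //= (bigD1 z) 1?eq_sym //= !mnmE Bz addnCA -[X in (X < _)%N]addn0 ltn_add2l addn_gt0 lt0n By.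
have -> : \prod_(B | allowed tau B && ((B y : nat) == 0%N) && ((B z : nat) == 0%N)) f tau B =
    GF (drop2 tau).
  apply: eq_big => [B|B /andP[/andP[_ /eqP By] /eqP Bz]].
    rewrite /allowed; case: [exists i, _]; rewrite ?andbF // !andbT.
    apply/andP/forallP => [[/andP[/forallP H By] Bz] i|H].
      rewrite /drop2; case: ifP => [/orP[]/eqP -> //|_]; exact: H.
    have By := H y; have Bz := H z; rewrite /drop2 !eqxx ?orbT /= in By Bz.
    split=> //; rewrite By andbT; apply/forallP => i.
    have := H i; rewrite /drop2; case: ifP => // /orP[]/eqP ->; by rewrite ?ty ?tz ?(eqP By).
  rewrite /f negvarX mnmE Bz expr0 scale1r; congr (Xs (odd _) 'X_[_]).
    rewrite [LHS]big_mkcond [RHS]big_mkcond; apply: eq_bigr => i _.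
    by rewrite /drop2; case h: ((i == y) || (i == z)) => //; case/orP: h => /eqP ->; rewrite ?tz ?ty // By.
  apply/mnmP => i; rewrite !mnmE; case: (i =P y) => [->|_]; first by rewrite Bz addn0.
  by case: (i =P z) => [->|].
rewrite -[X in eqS _ _ X]mulr1 -mulrA; apply: (eqSM small_closed) => //.
rewrite mulrCA -[X in eqS _ _ X]mulr1; apply: (eqSM small_closed) => //.
rewrite [X in _ * X](reindex_onto shiftB unshiftB) /=; last first.
  move=> B /andP[/andP[/andP[/forallP al _] By] Bz].
  have := al y; rewrite ty => By1.
  apply/ffunP => i; apply: val_inj; rewrite !ffunE /=.
  case: (i =P y) => [->|_]; first by rewrite inordK //; lia.
  case: (i =P z) => [->|_] //; rewrite eqxx zy /=.
  have := ltn_ord (B z); rewrite ltnS => le.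
  have lt : (B z < D)%N by rewrite ltn_neqAle Bz.
  by rewrite inordK ?inordK //= ltnW.
rewrite [X in _ * X](eq_bigl (fun B : Bk =>
    allowed tau B && ((B y : nat) == 0%N) && ((B z : nat) != 0%N))); last first.
  move=> B; have := ltn_ord (B z); rewrite ltnS => Bzle.
  have pl : ((B z).-1 < D.+1)%N by rewrite ltnS (leq_trans (leq_pred _)).
  have sy : shiftB B y = 1%N :> nat by rewrite ffunE eqxx inordK.
  have sz' : shiftB B z = (B z).-1 :> nat by rewrite ffunE zy eqxx inordK.
  have so i : i != y -> i != z -> shiftB B i = B i.
    by move=> /negPf iy /negPf iz; rewrite ffunE iy iz.
  apply/andP/andP => [[/andP[/andP[/andP[/forallP al _] _] _] /eqP e]|].
    have By : B y = 0%N :> nat.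
      by have /(congr1 (fun C : Bk => nat_of_ord (C y))) := e; rewrite ffunE eqxx inordK.
    have Bz : (0 < B z)%N.
      have /(congr1 (fun C : Bk => nat_of_ord (C z))) := e.
      rewrite ffunE zy eqxx sz'; case: (posnP (B z)) => // ->.
      by rewrite inordK.
    split; last by rewrite -lt0n.
    rewrite By eqxx andbT; apply/andP; split; last by apply/existsP; exists z.
    apply/forallP => i; have := al i.
    have [->|iy] := eqVneq i y; first by rewrite ty By.
    have [->|iz] := eqVneq i z; first by rewrite tz.
    by rewrite so.
  move=> [/andP[/andP[/forallP al ex] /eqP By] Bz]; split.
    apply/andP; split; last first.
      by rewrite sz' neq_ltn prednK ?lt0n // Bzle.
    rewrite sy /= andbT; apply/andP; split; last by apply/existsP; exists y; rewrite sy.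
    apply/forallP => i; have := al i.
    have [->|iy] := eqVneq i y; first by rewrite ty sy.
    have [->|iz] := eqVneq i z; first by rewrite tz.
    by rewrite so.
  apply/eqP/ffunP => i; rewrite ffunE; apply: val_inj.
  have [->|iy] := eqVneq i y; first by rewrite /= By inordK.
  have [->|iz] := eqVneq i z; last by rewrite so.
  by rewrite /= sz' prednK ?lt0n // inordK // ltnS.
rewrite -big_split /=; apply: (eqS_prod1 small_closed) => B /andP[/andP[_ /eqP By] Bz].
by apply: factor_cancel => //; rewrite lt0n.
Qed.

End Substitution.


End GeneratingFunction.

(** * The expansion of products of elementary functions *)

Local Open Scope ring_scope.

Section Monomials.
Variable N : nat.

Lemma hk0 : hk N 0 = 1.
Proof.
rewrite /hk (bigD1 bm0) /= ?mdeg0 // mpolyX0 big1 ?addr0 // => m /andP[m0 ne].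
by case/negP: ne; rewrite mdeg_eq0 in m0; rewrite -val_eqE /= (eqP m0).
Qed.

Lemma mcoeff_Xhk (a m : 'X_{1..N}) k :
  ('X_[a] * hk N k)@_m = ((a <= m)%MM && (mdeg m == mdeg a + k)%N)%:R.
Proof.
rewrite mulr_sumr raddf_sum /=.
under eq_bigr => b _ do rewrite -mpolyXD mcoeffX.
have [/andP[am /eqP md]|nn] := boolP ((a <= m)%MM && _); last first.
  rewrite big1 // => b /eqP db; case: eqP => // e; case/negP: nn.
  by rewrite -e mdegD db eqxx andbT; apply/mnm_lepP => i; rewrite mnmDE leq_addr.
have db : mdeg (m - a)%MM = k.
  by apply/eqP; rewrite -(eqn_add2l (mdeg a)) -mdegD addmC submK // md.
have lt : (mdeg (m - a)%MM < k.+1)%N by rewrite db.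
rewrite (bigD1 (BMultinom lt)) /= ?db // addmC submK // eqxx big1 ?addr0 // => b /andP[_ ne].
case: eqP => // e; case/negP: ne; rewrite -val_eqE /= -e addmC addmK eqxx //.
Qed.

(** For a monomial [m] of degree [n], each subset of its support contributes a sign, and the signs
    cancel because the support is nonempty. *)
Lemma mesym_hk n : (0 < n)%N -> \sum_(i < n.+1) (-1) ^+ i * mesym N rat (n - i) * hk N i = 0.
Proof.
move=> n0; apply/mpolyP => m; rewrite mcoeff0 raddf_sum /=.
have E (i : 'I_n.+1) : ((-1) ^+ i * mesym N rat (n - i) * hk N i)@_m =
   \sum_(h : {set 'I_N} | #|h| == (n - i)%N) (-1) ^+ i * ((mesym1 h <= m)%MM && (mdeg m == n))%:R.
  rewrite mesymE -mulrA mulr_suml mulr_sumr raddf_sum; apply: eq_bigr => h /eqP hc /=.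
  have -> : (-1) ^+ i * ('X_[mesym1 h] * hk N i) = (-1) ^+ i *: ('X_[mesym1 h] * hk N i).
    by rewrite -[in LHS]signr_odd -[in RHS]signr_odd; case: (odd i);
       rewrite ?expr1 ?expr0 ?mulN1r ?mul1r ?scaleN1r ?scale1r.
  rewrite mcoeffZ mcoeff_Xhk; congr (_ * (_ && _)%:R).
  by rewrite mdeg_mesym1 hc subnK // -ltnS.
rewrite (eq_bigr _ (fun i _ => E i)) => {E}.
have [md|/negPf md] := boolP (mdeg m == n); last first.
  by rewrite big1 // => i _; rewrite big1 // => h _; rewrite andbF mulr0.
(* The sum over subsets is written as an expanded product, whose factor [1 - 1] at any variable of
   the support is zero; subsets outside the support contribute [0]. *)
transitivity ((-1) ^+ n * \sum_(h : {set 'I_N}) \prod_j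
    (if j \in h then - (0 < m j)%N%:R else 1) : rat).
  under eq_bigr => i _ do rewrite big_mkcond.
  rewrite exchange_big mulr_sumr /=; apply: eq_bigr => h _.
  have [le|nle] := boolP (mesym1 h <= m)%MM; last first.
    rewrite big1 => [|i _]; last by rewrite mulr0; case: ifP.
    have [j jh mj] : exists2 j, j \in h & m j = 0%N.
      case/forallPn: nle => j; rewrite mnmE -ltnNge => lt; exists j.
        by case: (j \in h) lt.
      by case: (j \in h) lt; case: (m j).
    by rewrite (bigD1 j) //= jh mj oppr0 mul0r mulr0.
  have hn : (#|h| <= n)%N.
    rewrite -(eqP md) -mdeg_mesym1 !mdegE; apply: leq_sum => j _; exact: (mnm_lepP le).
  have lt : (n - #|h| < n.+1)%N by rewrite ltnS leq_subr.
  rewrite (bigD1 (Ordinal lt)) //= subKn // eqxx big1 ?addr0 => [|i /eqP ni]; last first.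
    case: eqP => // e; case: ni; apply: val_inj; rewrite /= e subKn // -ltnS //.
  rewrite mulr1 -{2}(subnK hn) exprD -mulrA -[LHS]mulr1; congr (_ * _).
  rewrite (eq_bigr (fun j => if j \in h then -1 else 1)) => [|j _]; last first.
    case: ifP => // jh; have /mnm_lepP/(_ j) := le; rewrite mnmE jh => ->//.
  by rewrite -big_mkcond prodr_const -exprD addnn -signr_odd odd_double.
rewrite -(bigA_distr _ _ (fun j => - (0 < m j)%N%:R) (fun=> 1)).
have [j mj] : exists j, (0 < m j)%N.
  apply/existsP; apply: contraTT n0; rewrite negb_exists => /forallP H.
  rewrite -(eqP md) mdegE big1 // => i _; apply/eqP; by rewrite -leqn0 leqNgt H.
by rewrite (bigD1 j) //= mj addNr mul0r mulr0.
Qed.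
End Monomials.

Section ElementaryFromComplete.
Variables (A : comNzRingType) (h : nat -> A).
Hypothesis h0 : h 0 = 1.

(** The recursion for [e_n] needs all earlier values, so the whole list [e_n, ..., e_0] is carried
    along. *)
Fixpoint elist n : seq A :=
  if n is n'.+1 then
    (\sum_(j < n) (-1) ^+ j * h j.+1 * (elist n')`_j) :: elist n'
  else [:: 1].

Definition efc n : A := head 0 (elist n).

Definition hefc (p : bool) n := if p then efc n else h n.

Lemma nth_elist n j : (j <= n)%N -> (elist n)`_j = efc (n - j).
Proof.
elim: n j => [|n IH] [|j] //= jn; exact: IH.
Qed.

Lemma efcS n : efc n.+1 = \sum_(j < n.+1) (-1) ^+ j * h j.+1 * efc (n - j).
Proof. by apply: eq_bigr => j _; rewrite nth_elist // -ltnS. Qed.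

Lemma hefc0 p : hefc p 0 = 1. Proof. by case: p. Qed.

Lemma hefc_rel p n : (0 < n)%N ->
  \sum_(i < n.+1) (-1) ^+ i * hefc p (n - i) * hefc (~~ p) i = 0.
Proof.
case: n => // n _.
have E : \sum_(i < n.+2) (-1) ^+ i * efc (n.+1 - i) * h i = 0.
  rewrite big_ord_recl /= expr0 mul1r h0 mulr1 subn0 efcS -big_split /= big1 // => i _.
  by rewrite /bump /= !add1n subSS exprS -!mulrA [efc _ * _]mulrC mulN1r addrN.
(* For [p = false] the sum is read backwards, which only multiplies it by [(-1) ^+ n.+1]. *)
case: p => //=; rewrite (reindex_inj rev_ord_inj) /=.
have := congr1 (fun x => (-1) ^+ n.+1 * x) E; rewrite mulr0 => E'.
rewrite -[RHS]E' mulr_sumr; apply: eq_bigr => i _.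
have le : (i <= n.+1)%N by rewrite -ltnS.
rewrite subSS subKn // -!mulrA [h i * _]mulrC [RHS]mulrA; congr (_ * _).
by move: (i : nat) le => k le; rewrite -[in RHS](subnK le) exprD -mulrA -expr2 sqrr_sign mulr1.
Qed.

End ElementaryFromComplete.

Section LinearForm.
Variables (D : nat) (V : lmodType rat) (th : seq nat -> V).

(** Variable [i] stands for the generator [h_(i+1)], so a monomial is a partition given by its
    multiplicities. *)
Definition partsof (m : 'X_{1..D}) : seq nat :=
  sort geq (flatten [seq nseq (m i) i.+1 | i <- enum 'I_D]).

Definition Lf (p : {mpoly rat[D]}) : V := \sum_(m <- msupp p) p@_m *: th (partsof m).

Lemma Lf_sub (r : seq 'X_{1..D}) p : uniq r -> {subset msupp p <= r} ->
  Lf p = \sum_(m <- r) p@_m *: th (partsof m).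
Proof.
move=> ur sr; rewrite [RHS](bigID (fun m => m \in msupp p)) /= [X in _ + X]big1 ?addr0.
  rewrite -big_filter; apply: perm_big; apply: uniq_perm; rewrite ?filter_uniq ?msupp_uniq //.
  by move=> m; rewrite mem_filter; case: (boolP (m \in msupp p)) => // /sr ->.
by move=> m; rewrite -mcoeff_eq0 => /eqP ->; rewrite scale0r.
Qed.

Lemma Lf_linear a p q : Lf (a *: p + q) = a *: Lf p + Lf q.
Proof.
pose r := undup (msupp (a *: p + q) ++ msupp p ++ msupp q).
have ur : uniq r by exact: undup_uniq.
rewrite (@Lf_sub r) // ?(@Lf_sub r p) // ?(@Lf_sub r q) //; last first.
- by move=> m mp; rewrite mem_undup !mem_cat mp.
- by move=> m mp; rewrite mem_undup !mem_cat mp orbT.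
- by move=> m mp; rewrite mem_undup !mem_cat mp !orbT.
rewrite scaler_sumr -big_split /=; apply: eq_bigr => m _.
by rewrite mcoeffD mcoeffZ scalerDl scalerA.
Qed.

Lemma LfD p q : Lf (p + q) = Lf p + Lf q.
Proof. by rewrite -[p]scale1r Lf_linear !scale1r. Qed.

Lemma Lf0 : Lf 0 = 0.
Proof. by rewrite /Lf msupp0 big_nil. Qed.

Lemma LfZ a p : Lf (a *: p) = a *: Lf p.
Proof. by rewrite -[a *: p]addr0 Lf_linear Lf0 addr0. Qed.

Lemma Lf_sum (I : Type) (r : seq I) (Q : pred I) (F : I -> {mpoly rat[D]}) :
  Lf (\sum_(i <- r | Q i) F i) = \sum_(i <- r | Q i) Lf (F i).
Proof. by apply: (big_morph Lf) => [p q|]; [exact: LfD | exact: Lf0]. Qed.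

Lemma Lf_sign k p : Lf ((-1) ^+ k * p) = (-1) ^+ k *: Lf p.
Proof.
rewrite -LfZ; congr Lf; rewrite -[in LHS]signr_odd -[in RHS]signr_odd.
by case: (odd k); rewrite ?expr1 ?expr0 ?mulN1r ?mul1r ?scaleN1r ?scale1r.
Qed.

Lemma LfX m : Lf 'X_[m] = th (partsof m).
Proof. by rewrite /Lf msuppX big_seq1 mcoeffX eqxx scale1r. Qed.

(* The generator [h_a] of the free algebra; it is [1] for [a = 0] and,
   as a junk value, for [a > D]. *)
Definition hA a : {mpoly rat[D]} := 'X_[[multinom (i.+1 == a)%N : nat | i < D]].

Lemma hA0 : hA 0 = 1.
Proof. by rewrite /hA -mpolyX0; congr 'X_[_]; apply/mnmP => i; rewrite !mnmE. Qed.

Lemma Lf_prod_hA s : all (fun a => a <= D)%N s ->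
  Lf (\prod_(a <- s) hA a) = th (sort geq [seq a <- s | 0 < a]%N).
Proof.
move=> /allP sD; rewrite mprodXE LfX; congr th.
have tr : transitive geq by move=> a b c ab bc; exact: leq_trans bc ab.
have an : antisymmetric geq by move=> a b; rewrite /= andbC -eqn_leq => /eqP.
have to : total geq by move=> a b; exact: leq_total.
apply/(perm_sortP to tr an); apply/allP => x _; apply/eqP.
rewrite count_flatten -map_comp sumnE big_map big_enum /=.
under eq_bigr => i _ do rewrite count_nseq mnm_sumE /=.
rewrite count_filter.
have [/andP[x0 xD]|nx] := boolP (0 < x <= D)%N.
  have lt : (x.-1 < D)%N by rewrite prednK.
  rewrite (bigD1 (Ordinal lt)) //= prednK // eqxx mul1n [X in (_ + X)%N]big1 ?addn0 => [|i /eqP ni]; last first.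
    rewrite (_ : (i.+1 == x) = false) //; apply/negbTE/eqP => e.
    by case: ni; apply: val_inj; rewrite /= -e.
  rewrite -sum1_count [RHS]big_mkcond /=; apply: eq_bigr => a _; rewrite mnmE /= prednK //.
  by rewrite eq_sym; case: eqP => // ->; rewrite x0.
rewrite big1 => [|i _]; last first.
  rewrite (_ : (i.+1 == x) = false) //; apply/negbTE/eqP => e.
  by case/negP: nx; rewrite -e /=.
apply/esym/eqP; rewrite -leqn0 leqNgt -has_count; apply/hasPn => a /sD aD /=.
by apply/negP => /andP[/eqP ax a0]; case/negP: nx; rewrite -ax a0.
Qed.

End LinearForm.

Section AllComplete.
Variables (A : comNzRingType) (X : bool -> nat -> A).
Hypothesis X0 : forall p, X p 0 = 1.
Variables (l : seq nat) (R : nat) (m : 'X_{1..R}) (tau : 'I_R -> option bool).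
Variable phi : 'I_(size l) -> 'I_R.
Hypotheses (phi_inj : injective phi) (mphi : forall j, m (phi j) = nth 0%N l j).
Hypothesis mcov : forall i, (0 < m i)%N -> exists j, i = phi j.
Hypothesis tphi : forall j, tau (phi j) = Some false.

Let ext (B : Blk l) : {ffun 'I_R -> 'I_(sumn l).+1} :=
  [ffun i => if [pick j | phi j == i] is Some j then B j else ord0].

Lemma ext_phi B j : ext B (phi j) = B j.
Proof.
rewrite ffunE; case: pickP => [j' /eqP/phi_inj -> //|/(_ j)]; by rewrite eqxx.
Qed.

Lemma ext_out B i : (forall j, i <> phi j) -> ext B i = ord0.
Proof. by move=> H; rewrite ffunE; case: pickP => // j /eqP e; case: (H j). Qed.

Lemma phiP i : (exists j, i = phi j) \/ forall j, i <> phi j.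
Proof.
case: (pickP (fun j => i == phi j)) => [j /eqP e|H]; [left|right]; first by exists j.
by move=> j /eqP; rewrite H.
Qed.

(** With complete variables only, every block has even elementary degree, and [GF_coef] indexed by
    the blocks on [l] yields exactly the conditions of [msp_valid]. *)
Lemma GF_all_complete :
  (GF (sumn l) X tau)@_m = \sum_(pi : MSP l | msp_valid pi) \prod_B X false (pi B).
Proof.
rewrite (GF_coef X0 (ext := ext)) => [|B B' e|B al le]; last first.
- exists [ffun j => B (phi j)]; apply/ffunP => i; apply: val_inj.
  have [[j ->]|H] := phiP i; first by rewrite ext_phi ffunE.
  rewrite ext_out //; have /mnm_lepP/(_ i) := le; rewrite mnmE /=.
  by case: (posnP (m i)) => [->|/mcov[j /H //]]; rewrite leqn0 => /eqP.
- by apply/ffunP => j; rewrite -!ext_phi e.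
apply: eq_big => [M|M _]; last first.
  apply: eq_bigr => B _; congr (X _ _); rewrite /par big1 // => i /eqP ti.
  by have [[j e]|/ext_out -> //] := phiP i; move: ti; rewrite e tphi.
rewrite /msp_valid; congr (_ && _).
  apply: eq_forallb => B; congr (_ ==> _); rewrite /allowed.
  have -> /= : [forall i, match tau i with | None => (ext B i : nat) == 0%N
      | Some true => (ext B i <= 1)%N | Some false => true end].
    apply/forallP => i; have [[j ->]|/ext_out ->] := phiP i; first by rewrite tphi.
    by case: (tau i) => [[]|].
  apply/existsP/existsP => [[i]|[j h]]; last by exists (phi j); rewrite ext_phi.
  by have [[j ->]|/ext_out -> //] := phiP i; rewrite ext_phi => h; exists j.
apply/forallP/forallP => H.
  move=> j; rewrite -mphi -(eqP (H (phi j))).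
  by apply/eqP; apply: eq_bigr => B _; rewrite ext_phi.
move=> i; have [[j ->]|ni] := phiP i.
  by rewrite mphi -(eqP (H j)); apply/eqP; apply: eq_bigr => B _; rewrite ext_phi.
rewrite big1 => [|B _]; last by rewrite ext_out // muln0.
by case: (posnP (m i)) => [->//|/mcov[j /ni]].
Qed.

End AllComplete.

(** [sumn l] occurs in the types of the blocks; its replacement by an equal [D] is done here once
    and for all. *)
Lemma GF_all_complete_deg (A : comNzRingType) (X : bool -> nat -> A) (l : seq nat) (R D : nat)
    (m : 'X_{1..R}) (tau : 'I_R -> option bool) (phi : 'I_(size l) -> 'I_R) :
  (forall p, X p 0 = 1) -> injective phi -> (forall j, m (phi j) = nth 0%N l j) ->
  (forall i, (0 < m i)%N -> exists j, i = phi j) -> (forall j, tau (phi j) = Some false) ->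
  sumn l = D ->
  (GF D X tau)@_m = \sum_(pi : MSP l | msp_valid pi) \prod_B X false (pi B).
Proof. by move=> X0 ? ? ? ? <-; exact: (GF_all_complete X0 (phi := phi)). Qed.

Section MainExpansion.
Variables (D N : nat) (th : seq nat -> {mpoly rat[N]}).
Hypothesis Hth : forall l : seq nat, is_partition l -> h_ N l = msp_sum th l.
Local Notation R := D.+1.

Definition XA := hefc (@hA D).

Lemma XA0 p : XA p 0 = 1. Proof. by apply: hefc0; exact: hA0. Qed.

Definition XV (o : option bool) k : {mpoly rat[N]} :=
  if o is Some true then mesym N rat k else hk N k.

Definition GV (tau : 'I_R -> option bool) (m : 'X_{1..R}) : {mpoly rat[N]} :=
  \prod_i XV (tau i) (m i).

Lemma XV0 o : XV o 0 = 1.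
Proof. by case: o => [[]|]; rewrite /XV ?hk0 // mesym0E. Qed.

Lemma GV_all_complete tau (m : 'X_{1..R}) : mdeg m = D ->
  (forall i, (0 < m i)%N -> tau i = Some false) -> GV tau m = Lf th (GF D XA tau)@_m.
Proof.
move=> md th_; pose leT (i j : 'I_R) := (m j <= m i)%N.
pose s := sort leT [seq i <- enum 'I_R | 0 < m i]%N; pose l := [seq m i | i <- s].
have mem_s i : (i \in s) = (0 < m i)%N by rewrite mem_sort mem_filter mem_enum andbT.
have us : uniq s by rewrite sort_uniq filter_uniq // enum_uniq.
have perm_s : perm_eq s [seq i <- enum 'I_R | 0 < m i]%N by rewrite perm_sort.
have pl : is_partition l.
  apply/andP; split.
    have -> : l = sort geq [seq m i | i <- [seq i <- enum 'I_R | 0 < m i]%N] by rewrite sort_map.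
    by apply: sort_sorted => a b; exact: leq_total.
  by apply/allP => x /mapP[i]; rewrite mem_s => mi ->.
have sl : sumn l = D.
  rewrite -md mdegE /l sumnE big_map (perm_big _ perm_s) big_filter big_enum_cond /=.
  by rewrite [LHS]big_mkcond; apply: eq_bigr => i _; case: posnP.
pose phi (j : 'I_(size l)) := nth ord0 s j.
have szl : size l = size s by rewrite size_map.
rewrite (@GF_all_complete_deg _ XA l _ _ m tau phi XA0) //; first last.
- by move=> j; apply: th_; rewrite -mem_s mem_nth // -szl.
- move=> i; rewrite -mem_s => si.
  have lt : (index i s < size l)%N by rewrite szl index_mem.
  by exists (Ordinal lt); rewrite /phi /= nth_index.
- by move=> j; rewrite /l (nth_map ord0) // -szl.
- move=> j j' /eqP; rewrite nth_uniq -?szl // => /eqP; exact: val_inj.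
transitivity (h_ N l).
  rewrite /h_ /l big_map (perm_big _ perm_s) big_filter big_enum_cond /= [RHS]big_mkcond.
  apply: eq_bigr => i _; case: (posnP (m i)) => [->|mi]; first exact: XV0.
  by rewrite th_.
rewrite (Hth pl) /msp_sum Lf_sum; apply: eq_bigr => pi _.
rewrite -big_enum /= -(big_map (fun B => nat_of_ord (pi B)) xpredT (fun a => XA false a)).
rewrite [in RHS](eq_bigr (@hA D)) // Lf_prod_hA; last first.
  by apply/allP => a /mapP[B _ ->]; rewrite -sl -ltnS.
by rewrite /mtilde filter_map.
Qed.

Definition eweight (tau : 'I_R -> option bool) (m : 'X_{1..R}) :=
  (\sum_(i | tau i == Some true) m i)%N.

Lemma isolate_first (V : lmodType rat) n (f : nat -> V) :
  \sum_(k < n.+1) (-1) ^+ k *: f k = 0 -> f 0%N = - \sum_(k < n) (-1) ^+ k.+1 *: f k.+1.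
Proof. by rewrite big_ord_recl expr0 scale1r => /eqP; rewrite addr_eq0 => /eqP. Qed.

Lemma GV_GF tau (m : 'X_{1..R}) : mdeg m = D ->
  (forall i, (0 < m i)%N -> tau i != None) -> GV tau m = Lf th (GF D XA tau)@_m.
Proof.
move: {2}(eweight tau m) (leqnn (eweight tau m)) => w.
elim: w tau m => [|w IH] tau m le md tn.
  apply: GV_all_complete => // i mi; move: (tn i mi); case ti: (tau i) => [[]|] // _.
  by move: le; rewrite /eweight (bigD1 i) ?ti //= leqn0 addn_eq0 -leqn0 leqNgt mi.
have [/existsP[y /andP[/eqP ty my]]|/existsPn ne] :=
    boolP [exists y, (tau y == Some true) && (0 < m y)%N]; last first.
  apply: GV_all_complete => // i mi; move: (tn i mi) (ne i); rewrite mi.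
  by case: (tau i) => [[]|].
have [z mz] : exists z, m z = 0%N.
  case: (pickP (fun z => m z == 0%N)) => [z /eqP e|H]; first by exists z.
  have : (R <= mdeg m)%N.
    rewrite mdegE -{1}(card_ord R) -sum1_card; apply: leq_sum => i _.
    by rewrite lt0n H.
  by rewrite md ltnn.
have yz : y != z by apply/eqP => e; move: my; rewrite e mz.
have D0 : (0 < D)%N by rewrite -md mdegE (bigD1 y) //= addn_gt0 my.
pose tau' i := if i == z then Some false else tau i.
have ty' : tau' y = Some true by rewrite /tau' (negPf yz).
have tz' : tau' z = Some false by rewrite /tau' eqxx.
have -> : GV tau m = GV tau' m.
  apply: eq_bigr => i _; rewrite /tau'; case: eqP => // ->.
  by rewrite mz !XV0.
have -> : (GF D XA tau)@_m = (GF D XA tau')@_m.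
  apply: GF_type_irrelevant => [|i mi]; first exact: XA0.
  by rewrite /tau'; case: eqP => // e; move: mi; rewrite e mz.
have tm0 : transfer y z m 0 = m.
  by apply/mnmP => i; rewrite mnmE; case: eqP => [->|_]; [rewrite subn0|case: eqP => [->|]].
have tdeg k : (k <= m y)%N -> mdeg (transfer y z m k) = D.
  move=> ky; rewrite -[RHS]md !mdegE (bigD1 y) //= (bigD1 z) 1?eq_sym //=.
  rewrite [in RHS](bigD1 y) //= [in RHS](bigD1 z) 1?eq_sym //= mz !mnmE eqxx (eq_sym z) (negPf yz) eqxx.
  rewrite addnA subnK // add0n; congr (_ + _)%N; apply: eq_bigr => i /andP[/negPf iy /negPf iz].
  by rewrite mnmE iy iz.
have rel1 : \sum_(k < (m y).+1) (-1) ^+ k *: Lf th (GF D XA tau')@_(transfer y z m k) = 0.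
  under eq_bigr => k _ do rewrite -Lf_sign.
  rewrite -Lf_sum -coef_negvar // (GF_cancel XA0 _ yz) //; last first.
  - by rewrite /small md.
  - by move=> p n /andP[n0 _]; apply: hefc_rel => //; exact: hA0.
  rewrite (GF_coef XA0 (ext := id)) //; last by move=> B; exists B.
  rewrite big_pred0 ?Lf0 // => M; apply/negP => /andP[/forallP al /forallP/(_ y)].
  rewrite big1 => [|B _]; first by rewrite eq_sym -leqn0 leqNgt my.
  case: (posnP (M B)) => [->//|MB]; have := al B; rewrite MB => /andP[/forallP/(_ y)].
  by rewrite /drop2 eqxx /= => /eqP ->; rewrite muln0.
have rel2 : \sum_(k < (m y).+1) (-1) ^+ k *: GV tau' (transfer y z m k) = 0.
  pose Q := \prod_(i | (i != y) && (i != z)) XV (tau' i) (m i).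
  rewrite (eq_bigr (fun k : 'I_(m y).+1 =>
      ((-1) ^+ k * mesym N rat (m y - k) * hk N k) * Q)) => [|k _].
    by rewrite -mulr_suml mesym_hk ?mul0r.
  rewrite /GV (bigD1 y) //= (bigD1 z) 1?eq_sym //= ty' tz' !mnmE eqxx (eq_sym z) (negPf yz) eqxx.
  rewrite (eq_bigr (fun i => XV (tau' i) (m i))) => [|i /andP[/negPf iy /negPf iz]]; last first.
    by rewrite mnmE iy iz.
  rewrite -/Q /= -!mulrA -[in LHS]signr_odd -[in RHS]signr_odd.
  by case: (odd k); rewrite ?expr1 ?expr0 ?scaleN1r ?scale1r ?mulN1r ?mul1r.
rewrite -[in LHS]tm0 -[in RHS]tm0 (isolate_first (f := fun k => GV tau' (transfer y z m k)) rel2).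
rewrite (isolate_first (f := fun k => Lf th (GF D XA tau')@_(transfer y z m k)) rel1).
congr (- _); apply: eq_bigr => k _; congr (_ *: _); apply: IH.
- rewrite -ltnS (leq_trans _ le) // /eweight.
  rewrite (bigD1 y) ?ty' //= [X in (_ < X)%N](bigD1 y) ?ty //= mnmE eqxx.
  rewrite -addSn leq_add //; first by move: my (ltn_ord k); lia.
  rewrite big_mkcond [X in (_ <= X)%N]big_mkcond; apply: leq_sum => i _.
  rewrite /tau'; case: (i =P z) => [->|/eqP/negPf iz] //=.
  by case: ifP => // /andP[_ /negPf iy]; rewrite mnmE iy iz.
- exact: tdeg.
- move=> i; rewrite mnmE /tau'; case: (i =P z) => // _.
  case: (i =P y) => [->|_]; first by rewrite ty.
  exact: tn.
Qed.

End MainExpansion.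

(** * Irreducible character expansion *)

Section WordExpansion.
Variables (D : nat) (V : lmodType rat) (th : seq nat -> V).
Local Notation n := (2 * D).+1.

Definition word_value (w : seq (nat * bool)) : V := Lf th (\prod_(x <- w) XA D x.2 x.1).

Definition word_tilde (w : seq (nat * bool)) : V :=
  \sum_(s <- parts n) (Kc (((n - wt w)%N, false) :: w) (sh0 n) (shp n s))%:R *: tilde_at th D s.

Lemma word_value_cancel w1 w2 a : (0 < a)%N ->
  \sum_(k < a.+1) (-1) ^+ k *: word_value (w1 ++ ((a - k)%N, true) :: (k : nat, false) :: w2) = 0.
Proof.
move=> a0; under eq_bigr => k _ do rewrite -Lf_sign big_cat /= !big_cons /=.
rewrite -Lf_sum; set P1 := \prod_(x <- w1) _; set P2 := \prod_(x <- w2) _.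
rewrite (eq_bigr (fun k : 'I_a.+1 => ((-1) ^+ k * XA D true (a - k) * XA D false k) * (P1 * P2))).
  by rewrite -mulr_suml (@hefc_rel _ (@hA D) _ true) ?mul0r ?Lf0 //; exact: hA0.
by move=> k _; rewrite -!mulrA; congr (_ * _); rewrite mulrCA; congr (_ * _); rewrite mulrCA.
Qed.

Lemma word_tilde_cancel w1 w2 a : (0 < a)%N ->
  \sum_(k < a.+1) (-1) ^+ k *: word_tilde (w1 ++ ((a - k)%N, true) :: (k : nat, false) :: w2) = 0.
Proof.
move=> a0; pose b := (n - wt (w1 ++ (a, true) :: w2))%N.
have wE (k : 'I_a.+1) : wt (w1 ++ ((a - k)%N, true) :: (k : nat, false) :: w2) =
    wt (w1 ++ (a, true) :: w2).
  rewrite /wt !map_cat !sumn_cat /= [in X in (_ + X)%N]addnA subnK // -ltnS; exact: ltn_ord.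
under eq_bigr => k _ do rewrite /word_tilde wE -/b scaler_sumr.
rewrite exchange_big big1_seq // => s _.
under eq_bigr => k _ do rewrite scalerA.
rewrite -scaler_suml (_ : \sum_(k < a.+1) _ = 0) ?scale0r //.
have E (k : 'I_a.+1) := Kc_cat ((b, false) :: w1) (((a - k)%N, true) :: (k : nat, false) :: w2)
  (sh0 n) (shp n s).
under eq_bigr => k _ do rewrite [Kc _ _ _]E natr_sum mulr_sumr.
rewrite exchange_big big1 // => nu _.
under eq_bigr => k _ do rewrite natrM mulrCA.
rewrite -mulr_sumr; case: (posnP (Kc ((b, false) :: w1) (sh0 n) nu)) => [->|K].
  by rewrite mul0r.
by rewrite Kc_vh_cancel ?mulr0 //; apply: Kc_mono K; exact: mono_sh0.
Qed.

Lemma Kc_zero_types m w (rho lam : Sh m) : mono rho ->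
  all (fun x => x.2 ==> (x.1 == 0%N)) w -> Kc w rho lam = Kc (hw (map fst w)) rho lam.
Proof.
elim: w rho => [|[a t] w IH] rho m0 //= /andP[at0 al].
case: t at0 => /= [/eqP ->|_].
  by rewrite -/(Kc ((0%N, true) :: w) rho lam) -/(Kc ((0%N, false) :: hw (map fst w)) rho lam) !Kc_cons0 // IH.
by apply: eq_bigr => nu /and3P[mn _ _]; apply: IH.
Qed.

Definition eweight_word (w : seq (nat * bool)) := sumn [seq (x.2 * x.1)%N | x : nat * bool <- w].

Lemma word_value_tilde_complete w : (wt w <= D)%N ->
  all (fun x => x.2 ==> (x.1 == 0%N)) w -> word_value w = word_tilde w.
Proof.
move=> wD al; rewrite /word_value /word_tilde; set v := map fst w.
have -> : \prod_(x <- w) XA D x.2 x.1 = \prod_(a <- v) hA D a.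
  rewrite big_map; elim: w al {wD v} => [|[a t] w IH] al; first by rewrite !big_nil.
  case/andP: al => /= at0 al; rewrite !big_cons IH //; congr (_ * _) => /=.
  by case: t at0 => // /eqP ->; rewrite XA0 hA0.
have vw : sumn v = wt w by [].
rewrite Lf_prod_hA; last first.
  apply/allP => a av; apply: leq_trans wD; rewrite -vw.
  by rewrite -(nth_index 0%N av) nth_le_sumn.
set b := (n - wt w)%N; set be := sort geq _.
have tr : transitive geq by move=> x y z xy yz; exact: leq_trans yz xy.
have pbe : is_partition be.
  rewrite /is_partition all_sort filter_all andbT.
  by apply: sort_sorted => x y; exact: leq_total.
have sbe : sumn be = wt w.
  rewrite -vw -(sumn_filter_pos v); apply: perm_sumn; by rewrite perm_sort.
have bp : (b :: be) \in parts n.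
  rewrite mem_parts_cons; rewrite /b ?pbe ?sbe /=; move: wD; lia.
rewrite -[th be]/(th (behead (b :: be))) -(kostka_tilde_at th bp); last by rewrite /= /b; move: wD; lia.
apply: eq_big_seq => s sp; congr (_%:R *: _); rewrite (kostka_Kc_parts _ sp).
apply: (@Kc_eq_tail _ [:: (b, false)] (hw be) w _ _ (mono_sh0 _)) => nu mn.
rewrite (Kc_zero_types _ mn al) -(Kc_hfilter (map fst w) _ mn).
by apply: Kc_hperm => //; rewrite /be perm_sort.
Qed.

Lemma word_value_tilde w : (wt w <= D)%N -> word_value w = word_tilde w.
Proof.
move: {2}(eweight_word w) (leqnn (eweight_word w)) => d; elim: d w => [|d IH] w le wD.
  apply: word_value_tilde_complete => //; apply/allP => -[a t] xw /=; apply/implyP => tt.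
  move: le; rewrite leqn0 => /eqP e0.
  have : ((t * a)%N <= eweight_word w)%N.
    rewrite -[(t * a)%N]/((fun x : nat * bool => (x.2 * x.1)%N) (a, t)).
    have : (t * a)%N \in [seq (x.2 * x.1)%N | x : nat * bool <- w] by apply/mapP; exists (a, t).
    by move=> h; rewrite -(nth_index 0%N h) nth_le_sumn.
  by rewrite e0 tt mul1n leqn0.
have [al|/allPn[[a t] xw]] := boolP (all (fun x => x.2 ==> (x.1 == 0%N)) w).
  exact: word_value_tilde_complete.
rewrite negb_imply /= => /andP[tt a0]; rewrite {t}tt in xw *.
case/splitPr: xw le wD => w1 w2 le wD; rewrite -lt0n in a0.
have L0 : word_value (w1 ++ (a, true) :: w2) = word_value (w1 ++ ((a - 0)%N, true) :: (0%N, false) :: w2).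
  by rewrite /word_value !big_cat !big_cons subn0 [XA D (0%N, false).2 _](XA0 D false) /= mul1r.
have R0 : word_tilde (w1 ++ (a, true) :: w2) = word_tilde (w1 ++ ((a - 0)%N, true) :: (0%N, false) :: w2).
  have wE : wt (w1 ++ ((a - 0)%N, true) :: (0%N, false) :: w2) = wt (w1 ++ (a, true) :: w2).
    by rewrite /wt !map_cat !sumn_cat /= subn0 add0n.
  rewrite /word_tilde wE; apply: eq_bigr => s _; congr (_%:R *: _).
  rewrite -!cat_cons subn0; apply: Kc_eq_tail; first exact: mono_sh0.
  by move=> nu mn; apply: eq_bigr => nu' /and3P[mn' _ _]; rewrite -/(Kc ((0%N, false) :: w2) nu' _) Kc_cons0.
rewrite L0 R0 (isolate_first (f := fun k => word_value (w1 ++ ((a - k)%N, true) :: (k, false) :: w2)) (word_value_cancel w1 w2 a0)).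
rewrite (isolate_first (f := fun k => word_tilde (w1 ++ ((a - k)%N, true) :: (k, false) :: w2)) (word_tilde_cancel w1 w2 a0)).
congr (- _); apply: eq_bigr => k _; congr (_ *: _); have lk := ltn_ord k; apply: IH.
- move: le; rewrite /eweight_word !map_cat !sumn_cat /= !mul1n !mul0n add0n; lia.
- move: wD; rewrite /wt !map_cat !sumn_cat /=; lia.
Qed.

End WordExpansion.

Definition set_content (mu : seq nat) (M : {ffun {set 'I_(size mu)} -> 'I_(sumn mu).+1}) : bool :=
  [forall S, (0 < M S)%N ==> (S != set0)] &&
  [forall i : 'I_(size mu), (\sum_S M S * (i \in S))%N == nth 0%N mu i].

Section SetBlocks.
Variable mu : seq nat.
Hypothesis Hmu : is_partition mu.
Local Notation D := (sumn mu).
Local Notation r := (size mu).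

Let chi (S : {set 'I_r}) (i : nat) : bool := [exists j : 'I_r, (j == i :> nat) && (j \in S)].

Lemma chiE S (j : 'I_r) : chi S j = (j \in S).
Proof.
apply/existsP/idP => [[j' /andP[/eqP/val_inj -> //]]|jS]; by exists j; rewrite eqxx.
Qed.

Lemma chi_out S i : (r <= i)%N -> chi S i = false.
Proof.
by move=> ri; apply/existsP => -[j /andP[/eqP e _]]; move: (ltn_ord j); rewrite e ltnNge ri.
Qed.

Let ext (S : {set 'I_r}) : {ffun 'I_D.+1 -> 'I_D.+1} :=
  [ffun i : 'I_D.+1 => if chi S i then inord 1 else ord0].

Lemma setextE S (i : 'I_D.+1) : ext S i = chi S i :> nat.
Proof.
rewrite ffunE; case: ifP => // /existsP[j _]; rewrite inordK // ltnS.
by apply: leq_trans (size_partition Hmu); apply: leq_ltn_trans (ltn_ord j).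
Qed.

Let wd (j : 'I_r) : 'I_D.+1 := widen_ord (leqW (size_partition Hmu)) j.

Lemma chi_card S : (\sum_(i < D.+1) chi S i = #|S|)%N.
Proof.
rewrite (@sum_vanish (fun i => nat_of_bool (chi S i)) D.+1 r) => [|i|i].
- by rewrite -sum1_card [RHS]big_mkcond; apply: eq_bigr => j _; rewrite chiE; case: ifP.
- by move=> l; rewrite chi_out // (leq_trans (leqW (size_partition Hmu))).
- by move=> l; rewrite chi_out.
Qed.

Variables (N : nat) (th : seq nat -> {mpoly rat[N]}).
Hypothesis Hth : forall l : seq nat, is_partition l -> h_ N l = msp_sum th l.

Lemma e_expansion : e_ N mu = \sum_(M : {ffun {set 'I_r} -> 'I_D.+1} | set_content M)
  Lf th (\prod_(S : {set 'I_r}) XA D (odd #|S|) (M S)).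
Proof.
pose m : 'X_{1..D.+1} := [multinom nth 0%N mu i | i < D.+1].
pose tau (i : 'I_D.+1) := Some true.
have md : mdeg m = D.
  rewrite mdegE [RHS](@sumn_nth mu D.+1) ?(leqW (size_partition Hmu)) //.
  by apply: eq_bigr => i _; rewrite mnmE.
have -> : e_ N mu = GV N tau m.
  rewrite /e_ (big_nth 0%N) big_mkord /GV.
  rewrite (big_ord_widen D.+1 (fun i => mesym N rat (nth 0%N mu i))) ?(leqW (size_partition Hmu)) //.
  rewrite big_mkcond; apply: eq_bigr => i _; rewrite mnmE /=.
  by case: ltnP => // l; rewrite nth_default // mesym0E.
rewrite (GV_GF Hth md) //.
rewrite (GF_coef (@XA0 D) (ext := ext)) => [|S S' e|B /andP[/forallP al _] le]; last first.
- exists [set j | 0 < B (wd j)]%N; apply/ffunP => i; apply: val_inj; rewrite /= setextE.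
  case: (ltnP i r) => [l|l].
    have := chiE [set j | 0 < B (wd j)]%N (Ordinal l); rewrite /= => ->; rewrite inE.
    have -> : wd (Ordinal l) = i by apply: val_inj.
    by have := al i; case: (nat_of_ord (B i)) => [|[]].
  rewrite chi_out //; have /mnm_lepP/(_ i) := le; rewrite !mnmE nth_default // leqn0.
  by move/eqP.
- apply/setP => j; rewrite -!chiE; have := congr1 (fun B : {ffun _} => nat_of_ord (B (wd j))) e.
  by rewrite /= !setextE; do 2!case: (chi _ _).
rewrite Lf_sum; apply: eq_big => [M|M _]; last first.
  congr Lf; apply: eq_bigr => S _; congr (XA D _ _); rewrite /par.
  by rewrite -chi_card; congr odd; apply: eq_big => // i _; rewrite setextE.
rewrite /set_content; congr (_ && _).
  apply: eq_forallb => S; congr (_ ==> _); rewrite /allowed.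
  have -> /= : [forall i, (ext S i <= 1)%N] by apply/forallP => i; rewrite setextE leq_b1.
  apply/existsP/set0Pn => [[i]|[j jS]].
    by rewrite setextE lt0b => /existsP[j /andP[_ jS]]; exists j.
  by exists (wd j); rewrite setextE /= chiE jS.
apply/forallP/forallP => H.
  move=> j; have := H (wd j); rewrite mnmE /= => /eqP <-; apply/eqP; apply: eq_bigr => S _.
  by rewrite setextE /= chiE.
move=> i; rewrite mnmE; case: (ltnP i r) => [l|l].
  rewrite -[nat_of_ord i]/(nat_of_ord (Ordinal l)) -(eqP (H (Ordinal l))).
  by apply/eqP; apply: eq_bigr => S _; rewrite setextE -chiE.
by rewrite nth_default // big1 // => S _; rewrite setextE chi_out // muln0.
Qed.

End SetBlocks.

Lemma tildes_sum D N (th : seq nat -> {mpoly rat[N]}) w : let n := (2 * D).+1 in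
  (wt w <= D)%N ->
  \sum_(lf : {ffun 'I_n -> 'I_n} | sorted geq (lamseq lf))
     (Kc w (row_shape n (nth 0%N (lamseq lf) 1)) (sh_of n (nth 0%N (lamseq lf))))%:R *:
       tildes th (lambar lf) = word_tilde D th w.
Proof.
move=> n wD.
have szl (lf : {ffun 'I_n -> 'I_n}) : size (lamseq lf) = n by rewrite size_map size_enum_ord.
have nthl (lf : {ffun 'I_n -> 'I_n}) (i : 'I_n) : nth 0%N (lamseq lf) i = lf i.
  by rewrite /lamseq (nth_map i) ?size_enum_ord // nth_ord_enum.
have nthle (lf : {ffun 'I_n -> 'I_n}) i : (nth 0%N (lamseq lf) i <= n)%N.
  case: (ltnP i n) => [l|l]; last by rewrite nth_default ?szl.
  by rewrite (nthl lf (Ordinal l)) ltnW.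
have ptl (lf : {ffun 'I_n -> 'I_n}) i :
    pt (sh_of n (nth 0%N (lamseq lf))) i = nth 0%N (lamseq lf) i.
  by rewrite pt_sh_of // => l; rewrite nth_default ?szl.
have consl (lf : {ffun 'I_n -> 'I_n}) : lamseq lf = head 0%N (lamseq lf) :: behead (lamseq lf).
  by case: (lamseq lf) (szl lf).
have nb (lf : {ffun 'I_n -> 'I_n}) i : sorted geq (lamseq lf) ->
    nth 0%N (lambar lf) i = nth 0%N (lamseq lf) i.+1.
  move=> so; rewrite nth_filter_pos ?nth_behead //; move: so; rewrite consl; exact: path_sorted.
have pb (lf : {ffun 'I_n -> 'I_n}) : sorted geq (lamseq lf) -> is_partition (lambar lf).
  by move=> so; apply: is_partition_filter; move: so; rewrite consl; exact: path_sorted.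
have sb (lf : {ffun 'I_n -> 'I_n}) : sz (sh_of n (nth 0%N (lamseq lf))) =
    (nth 0%N (lamseq lf) 0 + sumn (lambar lf))%N.
  rewrite szE (eq_bigr _ (fun (i : 'I_n) _ => ptl lf i)) -sumn_nth ?szl // nth0 sumn_filter_pos.
  by rewrite {1}consl.
pose P (lf : {ffun 'I_n -> 'I_n}) := [&& sorted geq (lamseq lf), sumn (lambar lf) <= wt w &
  nth 0%N (lamseq lf) 0 + sumn (lambar lf) == nth 0%N (lamseq lf) 1 + wt w]%N.
pose sq (lf : {ffun 'I_n -> 'I_n}) := (n - sumn (lambar lf))%N :: lambar lf.
have KP (lf : {ffun 'I_n -> 'I_n}) : sorted geq (lamseq lf) ->
    (0 < Kc w (row_shape n (nth 0 (lamseq lf) 1)) (sh_of n (nth 0 (lamseq lf))))%N -> P lf.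
  move=> so /KcP[sub]; rewrite sz_row // sb => e; rewrite /P so e eqxx andbT /=.
  have := sub 0%N; rewrite pt_row // ptl mul1n; lia.
transitivity (\sum_(lf | P lf) (Kc w (row_shape n (n - wt w)) (shp n (sq lf)))%:R *: tilde_at th D (sq lf)).
  rewrite [LHS](bigID P) /= [X in _ + X]big1 ?addr0 => [|lf /andP[so nP]]; last first.
    case: (posnP (Kc w (row_shape n (nth 0 (lamseq lf) 1)) (sh_of n (nth 0 (lamseq lf))))) => [->|/(KP _ so)].
      by rewrite scale0r.
    by rewrite (negPf nP).
  apply: eq_big => [lf|lf /andP[so /and3P[_ le /eqP e]]].
    by rewrite /P; case: (sorted _ _).
  rewrite (@tildes_tilde_at _ th D) ?pb ?(leq_trans le) //; congr (_%:R *: _).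
  have l1 : (nth 0 (lamseq lf) 1 <= sumn (lambar lf))%N by rewrite -(nb lf 0%N so) nth_le_sumn.
  have sqp : sq lf \in parts n by rewrite mem_parts_cons ?pb //=; move: le wD; rewrite /n; lia.
  pose d := (n - wt w - nth 0 (lamseq lf) 1)%N.
  have hd : (nth 0 (lamseq lf) 0 + d = n - sumn (lambar lf))%N by rewrite /d; move: le wD l1 e; rewrite /n; lia.
  have hd1 : (nth 0 (lamseq lf) 1 + d = n - wt w)%N by rewrite /d; move: le wD l1 e; rewrite /n; lia.
  rewrite -(@Kc_emb n n d (leqnn n) w) ?ptl ?pt_row ?hd ?mul1n ?hd1 ?leq_subr //.
  congr (Kc w _ _); apply: pt_inj => i.
    rewrite pt_emb ?pt_row ?mul1n ?hd1 ?leq_subr // /shift_head pt_row //.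
    by case: i => [|i]; rewrite ?mul1n.
  move: (sqp); rewrite mem_parts => /andP[psq /eqP ssq].
  rewrite pt_emb ?ptl ?hd ?leq_subr // /shift_head ptl pt_shp ?ssq //.
  by case: i => [|i]; rewrite ?mul1n ?hd //= mul0n addn0 nb.
rewrite /word_tilde.
transitivity (\sum_(s <- parts n | (n - wt w <= head 0 s)%N)
    (Kc w (row_shape n (n - wt w)) (shp n s))%:R *: tilde_at th D s); last first.
  rewrite [RHS](bigID (fun s => n - wt w <= head 0 s)%N) /= [X in _ = _ + X]big_seq_cond.
  rewrite [X in _ = _ + X]big1 ?addr0 => [|s /andP[sp nh]].
    by apply: eq_bigr => s _; rewrite -[\sum_(nu | _) _]/(Kc (_ :: w) _ _) Kc_row ?leq_subr.
  rewrite -[\sum_(nu | _) _]/(Kc (((n - wt w)%N, false) :: w) (sh0 n) (shp n s)) Kc_row ?leq_subr //.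
  case: (posnP (Kc w (row_shape n (n - wt w)) (shp n s))) => [->|/KcP[/(_ 0%N)]]; first by rewrite scale0r.
  move: sp; rewrite mem_parts => /andP[ps /eqP sn].
  by rewrite pt_row ?leq_subr // pt_shp ?sn // mul1n nth0 (negPf nh).
rewrite -big_filter -[RHS]big_filter.
rewrite -(big_map sq xpredT (fun s => (Kc w (row_shape n (n - wt w)) (shp n s))%:R *: tilde_at th D s)).
apply: perm_big; apply: uniq_perm.
- rewrite map_inj_in_uniq ?filter_uniq ?index_enum_uniq // => lf lf'.
  rewrite !mem_filter => /andP[/and3P[so _ /eqP e] _] /andP[/and3P[so' _ /eqP e'] _] [] _ eb.
  apply/ffunP => i; apply: val_inj; rewrite /= -!nthl.
  have tl j : nth 0%N (lamseq lf) j.+1 = nth 0%N (lamseq lf') j.+1 by rewrite -!nb // eb.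
  case: (nat_of_ord i) => [|j]; last exact: tl.
  by move: e e'; rewrite eb (tl 0%N) => <- /addIn ->.
- by rewrite filter_uniq // uniq_parts.
move=> s; rewrite mem_filter; apply/mapP/andP => [[lf]|[h sp]].
  rewrite mem_filter => /andP[/and3P[so le _] _] ->; split; first by rewrite /= leq_sub2l.
  by rewrite mem_parts_cons ?pb //=; move: le wD; rewrite /n; lia.
have [es ss] := parts_cons sp (ltn0Sn _).
move: (sp); rewrite mem_parts => /andP[ps /eqP sn].
have hs : (head 0 s <= n)%N by rewrite -sn es /= leq_addr.
set l := behead s in es ss *; have lw : (sumn l <= wt w)%N by rewrite ss; lia.
have pl : is_partition l := is_partition_behead ps.
have l0 : (nth 0 l 0 <= sumn l)%N := nth_le_sumn _ _.
pose f i := nth 0%N ((nth 0 l 0 + wt w - sumn l)%N :: l) i.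
have fn i : (f i < n)%N.
  case: i => [|i]; rewrite /f /=; first by rewrite /n; lia.
  by have := nth_le_sumn l i; rewrite /n; lia.
pose lf : {ffun 'I_n -> 'I_n} := [ffun i : 'I_n => inord (f i)].
have lfE i : nth 0%N (lamseq lf) i = f i.
  case: (ltnP i n) => [li|li].
    by rewrite (nthl lf (Ordinal li)) ffunE inordK.
  rewrite nth_default ?szl //; case: i li => [//|i li].
  by rewrite /f /= nth_default // (leq_trans (size_partition pl)) //; move: li; rewrite /n; lia.
have so : sorted geq (lamseq lf).
  apply: sorted_nth => i; rewrite !lfE /f; case: i => [|i] /=; first lia.
  by apply: sorted_geq_nth => //; exact: partition_sorted.
have lb : lambar lf = l by apply: partition_eq; rewrite ?pb // => i; rewrite nb // lfE.
exists lf; last by rewrite /sq lb ss subKn.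
rewrite mem_filter mem_index_enum andbT /P so lb lw /= !lfE /f /=; apply/eqP; lia.
Qed.

Lemma mem_setF r (A : {set 'I_r}) (i : 'I_r) : ((i : nat).+1 \in setF A) = (i \in A).
Proof.
apply/imfsetP/idP => [[j /= jA [/val_inj ->]] //|iA]; by exists i.
Qed.

Lemma setF_inj r : injective (@setF r).
Proof. by move=> A B e; apply/setP => i; rewrite -!mem_setF e. Qed.

Lemma posset_setF r (A : {set 'I_r}) : A != set0 -> posset (setF A).
Proof.
case/set0Pn => i iA; apply/andP; split.
  by apply/fset0Pn; exists i.+1; rewrite mem_setF.
by apply/negP => /imfsetP[].
Qed.

Section SetTableaux.
Variable le : rel {fset nat}.
Hypothesis le_refl : forall A, posset A -> le A A.
Hypothesis le_anti : forall A B, posset A -> posset B -> le A B -> le B A -> A = B.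
Hypothesis le_trans : forall A B C, posset A -> posset B -> posset C ->
  le A B -> le B C -> le A C.
Hypothesis le_total : forall A B, posset A -> posset B -> le A B || le B A.
Variable mu : seq nat.
Local Notation D := (sumn mu).
Local Notation r := (size mu).
Local Notation n := (tabB mu).

(* [le] is only assumed to be an order on nonempty sets; [set0] is put first. *)
Definition leS (S S' : {set 'I_r}) :=
  (S == set0) || (S' != set0) && le (setF S) (setF S').

Lemma leS_total : total leS.
Proof.
move=> S S'; rewrite /leS; case: (eqVneq S set0) => //= S0.
case: (eqVneq S' set0) => //= S0'.
by apply: le_total; exact: posset_setF.
Qed.

Lemma leS_trans : transitive leS.
Proof.
move=> S2 S1 S3; rewrite /leS; case: (eqVneq S1 set0) => //= S10.
case: (eqVneq S2 set0) => //= S20 l12 /andP[S30 l23]; rewrite S30 /=.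
by apply: le_trans l12 l23; exact: posset_setF.
Qed.

Definition letters := sort leS [seq S <- enum {set 'I_r} | S != set0].

Lemma mem_letters S : (S \in letters) = (S != set0).
Proof. by rewrite mem_sort mem_filter mem_enum andbT. Qed.

Lemma uniq_letters : uniq letters.
Proof. by rewrite sort_uniq filter_uniq // enum_uniq. Qed.

Lemma letter_ltE rep S S' : S != set0 -> S' != set0 ->
  letter_lt letters rep S S' = le (setF S) (setF S') && ((S == S') ==> rep S).
Proof.
move=> S0 S0'; rewrite /letter_lt.
have so : sorted leS letters by apply: sort_sorted; exact: leS_total.
have ix A B : A != set0 -> B != set0 -> (index A letters < index B letters)%N ->
    le (setF A) (setF B).
  move=> A0 B0 lt; have := sorted_ltn_index leS_trans so A B.
  by rewrite !mem_letters => /(_ A0 B0 lt); rewrite /leS (negPf A0) B0.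
have [<-|ne] := eqVneq S S'; first by rewrite ltnn le_refl //; exact: posset_setF.
rewrite orbF andbT; apply/idP/idP => [|l]; first exact: ix.
case: (ltngtP (index S letters) (index S' letters)) => // [gt|e].
  case/eqP: ne; apply: setF_inj; apply: le_anti => //; rewrite ?posset_setF //.
  exact: ix gt.
by case/eqP: ne; rewrite -(nth_index set0 (_ : S \in letters)) ?mem_letters // e nth_index ?mem_letters.
Qed.

Lemma card_content (T : finType) (F : {ffun T -> {set 'I_r}}) i :
  #|[set x | i \in F x]| = (\sum_S #|[set x | F x == S]| * (i \in S))%N.
Proof.
rewrite -sum1dep_card (partition_big F xpredT) //=; apply: eq_bigr => S _.
rewrite -sum1dep_card big_distrl /= [LHS]big_mkcond [RHS]big_mkcond; apply: eq_bigr => x _.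
by case: eqP => [->|]; rewrite ?andbF //= andbT mul1n; case: (i \in S).
Qed.

Definition wordM (M : {ffun {set 'I_r} -> 'I_D.+1}) : seq (nat * bool) :=
  [seq (nat_of_ord (M A), odd #|A|) | A : {set 'I_r} <- letters].

Lemma nth_lamseq B (lf : {ffun 'I_B -> 'I_B}) i : (nth 0%N (lamseq lf) i <= B)%N.
Proof.
case: (ltnP i B) => [l|l]; last by rewrite nth_default // size_map size_enum_ord.
rewrite (nth_map (Ordinal l)) ?size_enum_ord // -[i]/(nat_of_ord (Ordinal l)) nth_ord_enum.
by rewrite ltnW.
Qed.

Lemma pt_lamseq B (lf : {ffun 'I_B -> 'I_B}) i :
  pt (sh_of B (nth 0%N (lamseq lf))) i = nth 0%N (lamseq lf) i.
Proof.
by rewrite pt_sh_of ?nth_lamseq // => l; rewrite nth_default // size_map size_enum_ord.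
Qed.

Lemma tab_valid_tabok (lf : {ffun 'I_n -> 'I_n}) (M : {ffun {set 'I_r} -> 'I_D.+1}) F :
  set_content M -> sorted geq (lamseq lf) ->
  tab_valid le lf F && [forall S, (S != set0) ==> (#|[set x | F x == S]| == M S)] =
  tabok set0 (fun S : {set 'I_r} => odd #|S|) (fun S => nat_of_ord (M S)) letters
    (row_shape n (nth 0%N (lamseq lf) 1)) (sh_of n (nth 0%N (lamseq lf))) F.
Proof.
move=> /andP[/forallP M0 /forallP Mc] so.
have fE x : filled lf x =
    inskew (row_shape n (nth 0%N (lamseq lf) 1)) (sh_of n (nth 0%N (lamseq lf))) x.
  case: x => a b; rewrite /filled /inskew /= pt_lamseq pt_row ?nth_lamseq // andbC.
  by case: (a : nat) => [|k]; rewrite ?mul1n ?mul0n.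
apply/andP/tabokP.
  case=> /andP[/andP[/andP[/andP[/andP[/andP[_ /forallP h1] /forallP h2] /forallP h3] /forallP h4] /forallP h5] h6].
  move=> /forallP cnt; have h1' x : filled lf x = (F x != set0) by exact/eqP.
  split.
  - move=> i; rewrite pt_row ?nth_lamseq // pt_lamseq; case: i => [|i]; rewrite ?mul0n //.
    by rewrite mul1n sorted_geq_nth.
  - move=> x; rewrite -fE; case: ifP => fx; first by rewrite mem_letters -h1'.
    by apply/eqP; rewrite -[_ == _]negbK -h1' fx.
  - move=> a c c' lt; rewrite !mem_letters => p1 p2; rewrite letter_ltE //.
    have /forallP/(_ c)/forallP/(_ c')/implyP -> := h2 a; last by rewrite lt !h1' p1.
    apply/implyP => e; have /forallP/(_ c)/forallP/(_ c')/implyP := h4 a; apply.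
    by rewrite lt !h1' p1 p2.
  - move=> a a' c lt; rewrite !mem_letters => p1 p2; rewrite letter_ltE //.
    have /forallP/(_ a')/forallP/(_ c)/implyP -> := h3 a; last by rewrite lt !h1' p1.
    apply/implyP => e; have /forallP/(_ a')/forallP/(_ c)/implyP := h5 a; apply.
    by rewrite lt !h1' p1 p2.
  - move=> A; rewrite mem_letters => A0; apply/eqP; exact: (implyP (cnt A)).
move=> [_ h1 h2 h3 cnt].
have h1' x : filled lf x = (F x != set0).
  have := h1 x; rewrite -fE; case: ifP => _; first by rewrite mem_letters => ->.
  by move=> ->; rewrite eqxx.
have rel a b rep : F a != set0 -> F b != set0 -> letter_lt letters rep (F a) (F b) ->
    le (setF (F a)) (setF (F b)) /\ (F a == F b -> rep (F a)).
  by move=> p1 p2; rewrite letter_ltE // => /andP[? /implyP].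
have row (a c c' : 'I_n) : (c < c')%N -> filled lf (a, c) -> filled lf (a, c') ->
    le (setF (F (a, c))) (setF (F (a, c'))) /\ (F (a, c) == F (a, c') -> ~~ odd #|F (a, c)|).
  rewrite !h1' => lt p1 p2; have := h2 a c c' lt; rewrite !mem_letters.
  by move=> /(_ p1 p2); exact: rel.
have col (a a' c : 'I_n) : (a < a')%N -> filled lf (a, c) -> filled lf (a', c) ->
    le (setF (F (a, c))) (setF (F (a', c))) /\ (F (a, c) == F (a', c) -> odd #|F (a, c)|).
  rewrite !h1' => lt p1 p2; have := h3 a a' c lt; rewrite !mem_letters.
  by move=> /(_ p1 p2); exact: rel.
split; last first.
  by apply/forallP => A; apply/implyP => A0; apply/eqP; apply: cnt; rewrite mem_letters.
rewrite /tab_valid so /= -!andbA; apply/and5P; split; last (apply/andP; split).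
- by apply/forallP => x; rewrite h1'.
- apply/forallP => a; apply/forallP => c; apply/forallP => c'; apply/implyP => /and3P[lt p1 p2].
  by case: (row a c c' lt p1 p2).
- apply/forallP => a; apply/forallP => c; apply/forallP => c'; apply/implyP => /and3P[lt p1 p2].
  by case: (col a c c' lt p1 p2).
- apply/forallP => a; apply/forallP => c; apply/forallP => c'; apply/implyP => /and4P[lt p1 p2 e].
  by case: (row a c c' lt p1 p2) => _; apply.
- apply/forallP => a; apply/forallP => c; apply/forallP => c'; apply/implyP => /and4P[lt p1 p2 e].
  by case: (col a c c' lt p1 p2) => _; apply.
- apply/forallP => i; rewrite card_content -(eqP (Mc i)); apply/eqP; apply: eq_bigr => A _.
  have [->|A0] := eqVneq A set0; first by rewrite inE !muln0.
  by rewrite cnt // mem_letters.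
Qed.

Definition countM (F : {ffun 'I_n * 'I_n -> {set 'I_r}}) : {ffun {set 'I_r} -> 'I_D.+1} :=
  [ffun A => if A == set0 then ord0 else inord #|[set x | F x == A]|].

Lemma countME (lf : {ffun 'I_n -> 'I_n}) F : tab_valid le lf F ->
  forall A, A != set0 -> countM F A = #|[set x | F x == A]| :> nat.
Proof.
case/andP => _ /forallP h6 A A0; rewrite ffunE (negPf A0) inordK // ltnS.
case/set0Pn: A0 => i iA; apply: leq_trans (_ : nth 0%N mu i <= D)%N; last exact: nth_le_sumn.
rewrite -(eqP (h6 i)); apply/subset_leq_card/subsetP => x; rewrite !inE => /eqP ->; exact: iA.
Qed.

Lemma countM_content (lf : {ffun 'I_n -> 'I_n}) F : tab_valid le lf F -> set_content (countM F).
Proof.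
move=> tv; apply/andP; split.
  by apply/forallP => A; rewrite ffunE; case: eqVneq => // _; rewrite implybT.
case/andP: (tv) => _ /forallP h6; apply/forallP => i; rewrite -(eqP (h6 i)) card_content.
apply/eqP; apply: eq_bigr => A _; have [->|A0] := eqVneq A set0; first by rewrite inE !muln0.
by rewrite (countME tv).
Qed.

Lemma card_tab_valid (lf : {ffun 'I_n -> 'I_n}) (M : {ffun {set 'I_r} -> 'I_D.+1}) :
  set_content M ->
  #|[set F | tab_valid le lf F && (countM F == M)]| =
  if sorted geq (lamseq lf) then
    Kc (wordM M) (row_shape n (nth 0%N (lamseq lf) 1)) (sh_of n (nth 0%N (lamseq lf)))
  else 0%N.
Proof.
move=> cM; case: ifP => so; last first.
  by apply: eq_card0 => F; rewrite inE /tab_valid so.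
rewrite -(@card_tabok _ set0 (fun A : {set 'I_r} => odd #|A|) (fun A => nat_of_ord (M A)) n).
- apply: eq_card => F; rewrite !inE -tab_valid_tabok //.
  have [tv|] := boolP (tab_valid le lf F) => //=.
  apply/eqP/forallP => [<- A|H]; first by apply/implyP => A0; rewrite (countME tv).
  apply/ffunP => A; apply: val_inj; have [->|A0] := eqVneq A set0.
    rewrite ffunE eqxx /=; case/andP: cM => /forallP/(_ set0) + _.
    by rewrite eqxx implybF -leqNgt leqn0 => /eqP.
  by rewrite /= (countME tv) //; apply/eqP; exact: (implyP (H A)).
- exact: uniq_letters.
- by rewrite mem_letters eqxx.
- by rewrite mono_row // nth_lamseq.
- by apply/monoP => i; rewrite !pt_lamseq sorted_geq_nth.
Qed.

Lemma wordM_wt (M : {ffun {set 'I_r} -> 'I_D.+1}) : set_content M -> (wt (wordM M) <= D)%N.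
Proof.
move=> /andP[/forallP M0 /forallP Mc].
rewrite /wt -map_comp sumnE big_map /letters (perm_big _ (permEl (perm_sort _ _))) /=.
rewrite big_filter big_enum_cond /=.
rewrite [X in (_ <= X)%N](_ : D = \sum_i \sum_A M A * (i \in A))%N; last first.
  rewrite [LHS](sumn_nth (leqnn r)); apply: eq_bigr => i _; by rewrite (eqP (Mc i)).
rewrite exchange_big /= big_mkcond; apply: leq_sum => A _; case: ifP => // /set0Pn[i iA].
by rewrite (bigD1 i) //= iA muln1 leq_addr.
Qed.

Lemma word_value_wordM (V : lmodType rat) (th : seq nat -> V) (M : {ffun {set 'I_r} -> 'I_D.+1}) :
  set_content M -> word_value D th (wordM M) = Lf th (\prod_(A : {set 'I_r}) XA D (odd #|A|) (M A)).
Proof.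
move=> /andP[/forallP M0 _]; rewrite /word_value /wordM big_map /letters; congr Lf.
rewrite (perm_big _ (permEl (perm_sort _ _))) /= big_filter big_enum_cond /= big_mkcond.
apply: eq_bigr => A _; case: eqVneq => //= ->.
by have := M0 set0; rewrite eqxx implybF -leqNgt leqn0 => /eqP ->; rewrite XA0.
Qed.

Lemma tab_sum_words N (th : seq nat -> {mpoly rat[N]}) :
  tab_sum le th mu =
  \sum_(M : {ffun {set 'I_r} -> 'I_D.+1} | set_content M) word_tilde D th (wordM M).
Proof.
rewrite /tab_sum.
rewrite (eq_bigr (fun lf => \sum_(M | set_content M)
    (#|[set F | tab_valid le lf F && (countM F == M)]|)%:R *: tildes th (lambar lf))); last first.
  move=> lf _; rewrite (partition_big countM (@set_content mu)) /=; last exact: countM_content.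
  by apply: eq_bigr => M _; rewrite sumr_const scaler_nat cardsE.
rewrite exchange_big /=; apply: eq_bigr => M cM; rewrite -tildes_sum ?wordM_wt //.
rewrite [RHS]big_mkcond; apply: eq_bigr => lf _; rewrite card_tab_valid //.
by case: ifP; rewrite ?scale0r.
Qed.

End SetTableaux.

Local Close Scope ring_scope.

Theorem theorem8
  (le : rel {fset nat})
  (le_refl : forall A, posset A -> le A A)
  (le_anti : forall A B, posset A -> posset B -> le A B -> le B A -> A = B)
  (le_trans : forall A B C, posset A -> posset B -> posset C ->
                le A B -> le B C -> le A C)
  (le_total : forall A B, posset A -> posset B -> le A B || le B A)
  (N : nat) (th : seq nat -> {mpoly rat[N]})
  (Hth : forall l : seq nat, is_partition l -> h_ N l = msp_sum th l)
  (mu : seq nat) (Hmu : is_partition mu) :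
  e_ N mu = tab_sum le th mu.
Proof.
rewrite (tab_sum_words le_refl le_anti le_trans le_total) (e_expansion Hmu Hth).
apply: eq_bigr => M cM; rewrite -(word_value_wordM le th cM) word_value_tilde //.
exact: wordM_wt.
Qed.
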